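(* Let $\ell\ge0$, $\beta\in\mathbb{R}$, $\gamma>\max\{0,-\frac{\beta}{4\pi^2}\}$, $\theta>0$ and $T>0$. There exists $\delta>0$ such that, whenever $\phi\in H^\ell_{per,0}$ and $f\in L^\infty([0,\infty);H^\ell_{per,0})$ is $\theta$-periodic in time ($f(\cdot,t+\theta)=f(\cdot,t)$ for all $t\ge0$) with $\langle f(t)\rangle=0$ for $t\in[0,\theta)$, and $$\|\phi\|_{H^{\ell}_{per,0}}+\|f\|_{L^{\infty}([0,\infty);H^{\ell}_{per,0})}\le\delta,$$ the mild solution $u$ of $$u_t+u_x-u_{xxt}+uu_x+\beta u-\gamma u_{xx}=f(x,t)\ \text{ on }\mathbb{T}\times[0,\infty),\qquad u(x,0)=\phi(x),$$ satisfies the following: there exist $C>0$ and $\rho>0$ such that for all $\tau>0$ $$\|u(\cdot,\cdot+\theta)-u(\cdot,\cdot)\|_{Y^\ell_{\tau,T}}\le Ce^{-\rho\tau}.$$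
   Context: $\mathbb{T}=\mathbb{R}/\mathbb{Z}$ and $\Delta=\partial_x^2$. For $\ell\in\mathbb{R}$, $H^\ell_{per}$ is the space of 1-periodic distributions $g$ with $\|g\|_{H^\ell_{per}}=\big(\sum_{k\in\mathbb{Z}}(1+(2\pi k)^2)^\ell|\widehat g(k)|^2\big)^{1/2}<\infty$, where $\widehat g(k)=\int_0^1 e^{-2\pi i kx}g(x)\,dx$. We write $\langle g\rangle=\int_{\mathbb{T}}g\,dx=\widehat g(0)$; $H^\ell_{per,0}$ is the subspace of $g\in H^\ell_{per}$ with $\langle g\rangle=0$, with the same norm. For $\tau\ge0$, $T>0$, $$\|u\|_{Y^\ell_{\tau,T}}=\sup_{\tau\le s\le\tau+T}\|u(s)\|_{H^\ell_{per}}+\Big(\int_\tau^{\tau+T}\|u(s)\|_{H^\ell_{per}}^2ds\Big)^{1/2}.$$ Let $Av=(I-\Delta)^{-1}(-v_x-\beta v+\gamma v_{xx})$, which generates a $C_0$-semigroup $e^{At}$ on $H^\ell_{per,0}$. A mild solution of the initial value problem is a function $u$ with $u(t)\in H^\ell_{per,0}$ and $$u(t)=e^{At}\phi+\int_0^t e^{A(t-s)}(I-\Delta)^{-1}\big[f(s)-u(s)u_x(s)\big]ds,\qquad t\ge0,$$ where $uu_x$ means $\tfrac12\partial_x(u^2)$. Under the smallness assumption (for $\delta$ small) the mild solution exists and is unique. *)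

(* Defs.v *)
From HB Require Import structures.
From mathcomp Require Import all_boot all_order all_algebra.
From mathcomp Require Import all_classical all_reals all_analysis.
From mathcomp Require Import ess_sup_inf complex ring lra.
Import Order.TTheory GRing.Theory Num.Theory.
Import numFieldNormedType.Exports.

Set Implicit Arguments.
Unset Strict Implicit.
Unset Printing Implicit Defensive.

Local Open Scope classical_set_scope.
Local Open Scope ring_scope.
Local Open Scope complex_scope.

Section Periodic.
Context {R : realType}.
Implicit Types (c : int -> R[i]) (g : R -> R[i]) (l : R).
Local Notation mu := (@lebesgue_measure R).
Local Notation Re := (@complex.Re R).
Local Notation Im := (@complex.Im R).
Local Notation normc := (@ComplexField.Normc.normc R).

(* [normc z] is |z| as an element of R, whereas [`|z|] lives in R[i]. *)

Definition cexp (z : R[i]) : R[i] :=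
  (expR (Re z) * cos (Im z)) +i* (expR (Re z) * sin (Im z)).

Definition cintegral (D : set R) g : R[i] :=
  (\int[mu]_(x in D) Re (g x)) +i* (\int[mu]_(x in D) Im (g x)).

Definition freq (k : int) : R := 2 * pi * k%:~R.

Definition fourier g (k : int) : R[i] :=
  cintegral `[0, 1] (fun x => cexp (0 -i* (freq k * x)) * g x).

(* A 1-periodic distribution is given by the family c of its Fourier
   coefficients; an integrable 1-periodic function g is the distribution
   [fourier g].  Sobolev norms, derivatives and Fourier multipliers act on
   distributions.  [Hnorm] takes the value +oo outside of H^l_per. *)

Definition Hnorm l c : \bar R :=
  sqrte (\esum_(k in [set: int])
    ((1 + freq k ^+ 2) `^ l * normc (c k) ^+ 2)%:E)%E.

Definition ddx c (k : int) : R[i] := (0 +i* freq k) * c k.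

Definition inv_I_minus_Laplacian c (k : int) : R[i] :=
  ((1 + freq k ^+ 2)^-1)%:C * c k.

Lemma inv_I_minus_LaplacianK c k :
  let v := inv_I_minus_Laplacian c in v k - ddx (ddx v) k = c k.
Proof.
rewrite /= /ddx /inv_I_minus_Laplacian; set w := freq k.
have w0 : 1 + w ^+ 2 != 0 by rewrite gt_eqF// ltr_wpDr// sqr_ge0.
case: (c k) => a b; apply/eqP; rewrite eq_complex /=.
by apply/andP; split; apply/eqP; field.
Qed.

Definition opA (beta gamma : R) c : int -> R[i] :=
  inv_I_minus_Laplacian
    (fun k => - ddx c k - beta%:C * c k + gamma%:C * ddx (ddx c) k).

Definition symbolA (beta gamma : R) (k : int) : R[i] :=
  (- (beta + gamma * freq k ^+ 2) / (1 + freq k ^+ 2))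
  -i* (freq k / (1 + freq k ^+ 2)).

(* The semigroup e^{At}; see [expA0], [expAD] and [expA_generator]. *)
Definition expA (beta gamma t : R) c (k : int) : R[i] :=
  cexp (t%:C * symbolA beta gamma k) * c k.

(* For l >= 0 the elements of H^l_per are functions: their Fourier
   coefficients are square summable.  Two functions that agree almost
   everywhere are the same element. *)
Definition Hper l g : Prop :=
  [/\ forall x, g (x + 1) = g x,
      mu.-integrable `[0, 1] (EFin \o (Re \o g)),
      mu.-integrable `[0, 1] (EFin \o (Im \o g)) &
      (Hnorm l (fourier g) < +oo)%E].

Definition mean g : R[i] := cintegral `[0, 1] g.

Definition Hper0 l g : Prop := Hper l g /\ mean g = 0.

(* Strong measurability of a function of time with values in the separable
   Hilbert space H^l_per amounts (Pettis) to measurability of its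
   coefficients. *)
Definition time_measurable (D : set R) (h : R -> int -> R[i]) : Prop :=
  forall k, measurable_fun D (fun t => Re (h t k)) /\
            measurable_fun D (fun t => Im (h t k)).

Definition bochner_integrable l (D : set R) (h : R -> int -> R[i]) : Prop :=
  time_measurable D h /\ (\int[mu]_(s in D) Hnorm l (h s) < +oo)%E.

(* The Bochner integral in H^l_per of an integrable function: integration
   commutes with the continuous functionals "k-th coefficient". *)
Definition bochner (D : set R) (h : R -> int -> R[i]) (k : int) : R[i] :=
  cintegral D (fun s => h s k).

(* The cut-off \_ makes this the essential supremum over [0, +oo). *)
Definition LinfHnorm l (f : R -> R -> R[i]) : \bar R :=
  ess_sup mu ((fun t : R => Hnorm l (fourier (f t))) \_ `[0, +oo[).

Definition LinfHper0 l (f : R -> R -> R[i]) : Prop :=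
  [/\ forall t : R, 0 <= t -> Hper0 l (f t),
      time_measurable `[0, +oo[ (fun t => fourier (f t)) &
      (LinfHnorm l f < +oo)%E].

Definition Ynorm l (tau T : R) (w : R -> R -> R[i]) : \bar R :=
  (ereal_sup [set Hnorm l (fourier (w s)) | s in `[tau, (tau + T)%R]]
   + sqrte (\int[mu]_(s in `[tau, (tau + T)%R])
              (Hnorm l (fourier (w s)) ^+ 2)))%E.

(* u u_x = (u^2)_x / 2, in the sense of distributions *)
Definition uux g : int -> R[i] :=
  ddx (fourier (fun x => (2^-1)%:C * g x ^+ 2)).

Definition duhamel (beta gamma : R) (f u : R -> R -> R[i]) (t s : R) :
    int -> R[i] :=
  expA beta gamma (t - s)
    (inv_I_minus_Laplacian (fun k => fourier (f s) k - uux (u s) k)).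

Definition mild_solution l beta gamma (phi : R -> R[i])
    (f u : R -> R -> R[i]) : Prop :=
  forall t : R, 0 <= t ->
    [/\ Hper0 l (u t),
        bochner_integrable l `[0, t] (duhamel beta gamma f u t) &
        forall k, fourier (u t) k =
          expA beta gamma t (fourier phi) k
          + bochner `[0, t] (duhamel beta gamma f u t) k].

Lemma opAE beta gamma c k : opA beta gamma c k = symbolA beta gamma k * c k.
Proof.
rewrite /opA /inv_I_minus_Laplacian /ddx /symbolA; set w := freq k.
have w0 : 1 + w ^+ 2 != 0 by rewrite gt_eqF// ltr_wpDr// sqr_ge0.
case: (c k) => a b; apply/eqP; rewrite eq_complex /=.
by apply/andP; split; apply/eqP; field.
Qed.

Lemma expA0 beta gamma c : expA beta gamma 0 c = c.
Proof.
apply/funext => k; rewrite /expA (_ : 0%:C = 0)// mul0r /cexp /=.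
by rewrite expR0 cos0 sin0 mulr1 mulr0; exact: mul1r.
Qed.

Lemma cexpD z z' : cexp (z + z') = cexp z * cexp z'.
Proof.
case: z z' => [a b] [a' b']; apply/eqP; rewrite eq_complex /= expRD cosD sinD.
by apply/andP; split; apply/eqP; ring.
Qed.

Lemma expAD beta gamma s t c :
  expA beta gamma (s + t) c = expA beta gamma s (expA beta gamma t c).
Proof.
by apply/funext => k; rewrite /expA mulrA -cexpD -mulrDl -rmorphD.
Qed.


Let P (a b p q s : R) := expR (s * a) * (p * cos (s * b) + q * sin (s * b)).

Let P_derive a b p q (s : R) :
  is_derive s 1 (P a b p q) (P a b (a * p + b * q) (a * q - b * p) s).
Proof.
have lin r : is_derive s 1 (fun x : R => x * r) r.
  have -> : (fun x : R => x * r) = (id : R -> R) * cst r by [].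
  by apply: is_derive_eq; rewrite scaler0 add0r /GRing.scale /= mulr1.
have dE := @is_derive1_comp R expR ( *%R^~ a) s _ _
  (is_derive_expR (s * a)) (lin a).
have dC := @is_derive1_comp R cos ( *%R^~ b) s _ _
  (is_derive_cos (s * b)) (lin b).
have dS := @is_derive1_comp R sin ( *%R^~ b) s _ _
  (is_derive_sin (s * b)) (lin b).
have dP := is_deriveM dE (is_deriveD (is_deriveZ p dC) (is_deriveZ q dS)).
apply: (is_derive_eq dP).
set v := (X in X *: (expR _ * a)).
have -> : v = p * cos (s * b) + q * sin (s * b) by [].
by rewrite /P /GRing.scale /=; ring.
Qed.

Let P_bound (a b p q m B s : R) : 0 <= s <= 1 -> `|a| <= m -> `|p| + `|q| <= B ->
  `|P a b p q s| <= expR m * B.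
Proof.
move=> /andP[s0 s1] am pq; rewrite normrM ger0_norm ?expR_ge0//.
apply: ler_pM; [exact: expR_ge0|exact: normr_ge0| |].
  rewrite ler_expR (le_trans (ler_norm _))// normrM ger0_norm//.
  by rewrite (le_trans _ am)// ler_piMl.
apply: le_trans pq; rewrite (le_trans (ler_normD _ _))// !normrM.
apply: lerD; apply: ler_piMr => //; rewrite ler_norml.
  by rewrite cos_geN1 cos_le1.
by rewrite sin_geN1 sin_le1.
Qed.

Let P_continuous a b p q h : {within `[0, h], continuous (P a b p q)}.
Proof.
apply: derivable_within_continuous => x _.
by have [] := P_derive a b p q x.
Qed.

Let P_taylor (a b p q m h : R) : 0 < h <= 1 -> `|a| <= m -> `|b| <= m ->
    `|p| + `|q| <= 1 ->
  `|h^-1 * (P a b p q h - p) - (a * p + b * q)|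
    <= h * (expR m * (4 * m ^+ 2)).
Proof.
move=> /andP[h0 h1] am bm pq.
set p1 := a * p + b * q; set q1 := a * q - b * p.
have P0 p' q' : P a b p' q' 0 = p'.
  by rewrite /P !mul0r expR0 cos0 sin0 mul1r mulr1 mulr0 addr0.
have [s sI] := MVT h0 (fun x _ => P_derive a b p q x) (@P_continuous _ _ _ _ _).
rewrite P0 subr0 -/p1 -/q1 => ->; move: sI; rewrite in_itv/= => /andP[s0 sh].
have [r rI] := MVT s0 (fun x _ => P_derive a b p1 q1 x) (@P_continuous _ _ _ _ _).
rewrite P0 subr0 mulrCA mulVf ?gt_eqF// mulr1 => ->.
move: rI; rewrite in_itv/= => /andP[r0 rs].
rewrite normrM mulrC (gtr0_norm s0).
apply: ler_pM; [exact: ltW|exact: normr_ge0|exact: ltW|].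
apply: P_bound => //.
  by rewrite (ltW r0)/= (le_trans (ltW rs))// (le_trans (ltW sh)).
have key p' q' B : `|p'| + `|q'| <= B ->
    `|a * p' + b * q'| + `|a * q' - b * p'| <= 2 * m * B.
  move=> pqB; have m0 : 0 <= m by rewrite (le_trans _ am).
  apply: (@le_trans _ _ ((`|a| + `|b|) * (`|p'| + `|q'|))).
    have := ler_normD (a * p') (b * q'); have := ler_normB (a * q') (b * p').
    rewrite !normrM; lra.
  apply: ler_pM => //; rewrite ?addr_ge0//; lra.
have -> : 4 * m ^+ 2 = 2 * m * (2 * m * 1) by ring.
by apply: (key); apply: (key).
Qed.

Lemma normc_le (z : R[i]) : normc z <= `|Re z| + `|Im z|.
Proof.
case: z => x y /=; rewrite -(ger0_norm (addr_ge0 (normr_ge0 x) (normr_ge0 y))).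
rewrite -sqrtr_sqr ler_sqrt ?sqr_ge0// sqrrD !real_normK ?num_real//.
by rewrite lerD2r lerDl mulrn_wge0// mulr_ge0.
Qed.

Lemma normc_ge0 (z : R[i]) : 0 <= normc z.
Proof. by case: z => x y; exact: sqrtr_ge0. Qed.

Lemma Hnorm_ge0 l c : (0 <= Hnorm l c)%E.
Proof. exact: sqrte_ge0. Qed.

Lemma le_Hnorm l c c' (r : R) : 0 <= r ->
  (forall k, normc (c k) <= r * normc (c' k)) ->
  (Hnorm l c <= r%:E * Hnorm l c')%E.
Proof.
move=> r0 cc'; rewrite /Hnorm.
set w := fun k : int => (1 + freq k ^+ 2) `^ l.
have w0 k : 0 <= w k by exact: powR_ge0.
have S0 : (0 <= \esum_(k in [set: int]) (w k * normc (c' k) ^+ 2)%:E)%E.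
  by apply: esum_ge0 => k _; rewrite lee_fin mulr_ge0 ?sqr_ge0.
have -> : r%:E = sqrte (r ^+ 2)%:E by rewrite /= sqrtr_sqr ger0_norm.
rewrite -sqrteM ?lee_fin ?sqr_ge0// lee_sqrt ?mule_ge0 ?lee_fin ?sqr_ge0//.
apply: ge_ereal_sup => /= _ [X [finX _] <-].
apply: (@le_trans _ _
    ((r ^+ 2)%:E * \sum_(k \in X) (w k * normc (c' k) ^+ 2)%:E)%E).
  rewrite ge0_mule_fsumr; last first.
    by move=> k; rewrite lee_fin mulr_ge0 ?sqr_ge0.
  apply: lee_fsum => // k _; rewrite -EFinM lee_fin.
  have -> : r ^+ 2 * (w k * normc (c' k) ^+ 2)
      = w k * (r * normc (c' k)) ^+ 2 by ring.
  apply: ler_wpM2l; first exact: w0.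
  by rewrite ler_sqr ?nnegrE ?mulr_ge0 ?normc_ge0.
rewrite lee_wpmul2l ?lee_fin ?sqr_ge0//.
by apply: ereal_sup_ubound; exists X.
Qed.

Lemma symbolA_bounded beta gamma : exists m : R, forall k,
  `|Re (symbolA beta gamma k)| <= m /\ `|Im (symbolA beta gamma k)| <= m.
Proof.
exists (`|beta| + `|gamma| + 1) => k; rewrite /symbolA /=; set w := freq k.
have w0 : 0 < 1 + w ^+ 2 by rewrite ltr_wpDr// sqr_ge0.
have w2 := sqr_ge0 w.
have wle : `|w| <= 1 + w ^+ 2.
  rewrite -(real_normK (num_real w)); have := sqr_ge0 (`|w| - 1); nra.
have b0 := normr_ge0 beta; have g0 := normr_ge0 gamma.
split; first rewrite mulNr; rewrite normrN normrM normfV (gtr0_norm w0).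
  rewrite ler_pdivrMr//; apply: le_trans (ler_normD _ _) _.
  by rewrite normrM (ger0_norm w2); nra.
by rewrite ler_pdivrMr//; nra.
Qed.

(* A is the infinitesimal generator of e^{At} in H^l_per. *)
Lemma expA_generator l beta gamma c : (Hnorm l c < +oo)%E ->
  Hnorm l (fun k => (h^-1)%:C * (expA beta gamma h c k - c k)
                    - opA beta gamma c k) @[h --> 0^'+] --> 0%E.
Proof.
move=> cfin; have [m Hm] := symbolA_bounded beta gamma.
pose K := 2 * (expR m * (4 * m ^+ 2)).
have K0 : 0 <= K.
  by apply: mulr_ge0 => //; rewrite mulr_ge0 ?expR_ge0//; have := sqr_ge0 m; lra.
have cE : Hnorm l c = (fine (Hnorm l c))%:E.
  by rewrite fineK// ge0_fin_numE// Hnorm_ge0.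
apply: (@squeeze_cvge _ _ _ _ (cst 0%E) _
          (fun h : R => (h * K)%:E * Hnorm l c)%E); last 2 first.
- exact: cvg_cst.
- rewrite cE; under eq_fun do rewrite -EFinM -mulrA.
  apply: cvg_EFin; first by near=> h.
  rewrite /comp /= -[X in _ --> X](mul0r (K * fine (Hnorm l c))).
  apply: cvgMr_tmp; apply: cvg_at_right_filter; exact: cvg_id.
near=> h.
have h01 : 0 < h <= 1.
  by apply/andP; split; near: h; [exact: nbhs_right_gt|exact: nbhs_right_le].
rewrite Hnorm_ge0/=; apply: le_Hnorm => [|k].
  by case/andP: h01 => h0 _; rewrite mulr_ge0// ltW.
have [am bm] := Hm k; rewrite opAE /expA.
set z := symbolA beta gamma k in am bm *.
have -> : (h^-1)%:C * (cexp (h%:C * z) * c k - c k) - z * c k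
    = ((h^-1)%:C * (cexp (h%:C * z) - 1) - z) * c k by ring.
rewrite ComplexField.Normc.normcM ler_wpM2r ?normc_ge0//.
apply: le_trans (normc_le _) _.
case: z am bm => a b /= am bm.
rewrite /K mulrCA [2 * _]mulrDl mul1r.
have p1 : `|1 : R| + `|0 : R| <= 1 by rewrite normr1 normr0 addr0.
have q1 : `|0 : R| + `|1 : R| <= 1 by rewrite normr1 normr0 add0r.
have := P_taylor h01 am bm p1.
have := P_taylor h01 am bm q1.
rewrite /P !mul0r !mul1r !mulr0 !mulr1 !add0r !addr0 !subr0 => ds dc.
exact: lerD.
Unshelve. all: by end_near. Qed.

End Periodic.

(* Main.v *)
Require Import Defs.
From mathcomp Require Import all_boot all_order all_algebra.
From mathcomp Require Import all_classical all_reals all_analysis.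
From mathcomp Require Import measurable_realfun ess_sup_inf.
From mathcomp Require Import complex zify ring lra.
Import Order.TTheory GRing.Theory Num.Theory.
Import numFieldNormedType.Exports.

(** The linear semigroup contracts [H^l_per,0] at a rate [rho > 0], the spectral gap.
    The nonlinearity [(I - Delta)^-1 (v w)_x / 2] is bounded bilinear on [H^l], [l >= 0]:
    by Peetre's inequality and Cauchy-Schwarz the k-th coefficient of [v w] is
    [O(<k>^-l |v|_l |w|_l)], and the multiplier [O(1/|k|)] is square summable.
    Elements of [H^l_per] are only given as L^1 functions with Fourier coefficients
    in l^2, so this rests on [plancherel_le]: such a function is in L^2.  Its primitive [G]
    is differentiable almost everywhere (Lebesgue), hence its Fourier series converges
    almost everywhere (Chernoff's argument), so the difference quotients of [G] are
    limits of trigonometric polynomials of bounded L^2 norm, and Fatou's lemma applies twice.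

    For small data the norm of [u] cannot jump upwards, and a continuity argument keeps it
    below a small [eps] for all times.  The difference [w = u(. + theta) - u] solves
    the equation linearized with coefficient [u(. + theta) + u], of size [2 eps]; by Duhamel,
    [M = sup e^(rho s / 2) |w(s)|] over [0, t] satisfies [M <= 2 eps + M / 2], so [M <= 4 eps]. *)

Set Implicit Arguments.
Unset Strict Implicit.
Unset Printing Implicit Defensive.
Local Open Scope classical_set_scope.
Local Open Scope ring_scope.
Local Open Scope complex_scope.

(** * Integrals of complex-valued functions *)

(** Nothing in [mild_solution] says that $u$ is continuous in time. What replaces continuity is
    one-sided: $e^{Ah}$ contracts and the Duhamel integral over $[t,t+h]$ is small. The bootstrap
    looks at the infimum of the times at which the bound fails; the integral equation still applies
    there, since it does not see its endpoint, and it returns half of [eps]. At frequency 0 the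
    symbol is $-\beta$, of any sign; zero mean removes this mode, and the condition on $\gamma$
    makes the real part of the symbol negative at $k=\pm1$ and in the limit of large $|k|$, between
    which it is monotone. The decay rate is halved because the convolution of $e^{-\rho t}$ with
    $e^{-\rho t/2}$ decays only like $e^{-\rho t/2}$, with a factor $2/\rho$ that the smallness of
    [eps] has to beat. Bessel's inequality presupposes a function in $L^2$ and so says nothing about
    $g$ itself; its primitive is bounded, and at a point of differentiability the increments are
    $O(|y-x|)$, which makes Chernoff's quotient bounded. *)

Notation normc := (@ComplexField.Normc.normc _).

Section ComplexIntegral.
Context {R : realType}.
Implicit Types (D : set (measurableTypeR R)) (g h : R -> R[i]) (z : R[i]).
Local Notation mu := (@lebesgue_measure R).
Local Notation Re := (@complex.Re R).
Local Notation Im := (@complex.Im R).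

Lemma ReD z z' : Re (z + z') = Re z + Re z'. Proof. by case: z z' => ? ? []. Qed.
Lemma ImD z z' : Im (z + z') = Im z + Im z'. Proof. by case: z z' => ? ? []. Qed.
Lemma ReM z z' : Re (z * z') = Re z * Re z' - Im z * Im z'.
Proof. by case: z z' => ? ? []. Qed.
Lemma ImM z z' : Im (z * z') = Re z * Im z' + Im z * Re z'.
Proof. by case: z z' => ? ? []. Qed.

Lemma normcD z z' : normc (z + z') <= normc z + normc z'.
Proof. by have := ler_normD z z'; rewrite -rmorphD /= lecR. Qed.

Lemma normcN z : normc (- z) = normc z.
Proof. by case: z => x y /=; rewrite !sqrrN. Qed.

Lemma normcB z z' : normc (z - z') <= normc z + normc z'.
Proof. by rewrite -[normc z']normcN normcD. Qed.

Lemma normc_sum (I : Type) (r : seq I) (F : I -> R[i]) :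
  normc (\sum_(i <- r) F i) <= \sum_(i <- r) normc (F i).
Proof.
elim: r => [|i r IH]; first by rewrite !big_nil /= expr0n /= addr0 sqrtr0.
by rewrite !big_cons (le_trans (normcD _ _))// lerD2l.
Qed.

Lemma normc_sqr z : normc z ^+ 2 = Re z ^+ 2 + Im z ^+ 2.
Proof. by case: z => x y /=; rewrite sqr_sqrtr// addr_ge0 ?sqr_ge0. Qed.

Lemma normc_conj z : normc z^*%C = normc z.
Proof. by case: z => x y /=; rewrite sqrrN. Qed.

Lemma normc_sqrE z : normc z ^+ 2 = Re (z^*%C * z).
Proof. by rewrite normc_sqr; case: z => x y /=; ring. Qed.

Lemma normc_real (x : R) : normc x%:C = `|x|.
Proof. by rewrite /= expr0n /= addr0 sqrtr_sqr. Qed.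

Lemma Re_le_normc z : `|Re z| <= normc z.
Proof. by case: z => x y /=; rewrite -sqrtr_sqr ler_wsqrtr// lerDl sqr_ge0. Qed.

Lemma Im_le_normc z : `|Im z| <= normc z.
Proof. by case: z => x y /=; rewrite -sqrtr_sqr ler_wsqrtr// lerDr sqr_ge0. Qed.

Definition cmeasurable D g :=
  measurable_fun D (Re \o g) /\ measurable_fun D (Im \o g).

Definition cintegrable D g :=
  mu.-integrable D (EFin \o (Re \o g)) /\ mu.-integrable D (EFin \o (Im \o g)).

Lemma cmeasurable_cst D z : cmeasurable D (fun=> z).
Proof. by split; exact: measurable_cst. Qed.

Lemma cmeasurableD D g h : cmeasurable D g -> cmeasurable D h ->
  cmeasurable D (fun x => g x + h x).
Proof.
move=> [gr gi] [hr hi]; split.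
  rewrite (_ : _ \o _ = (Re \o g) \+ (Re \o h)); first exact: measurable_funD.
  by apply/funext => x /=; rewrite ReD.
rewrite (_ : _ \o _ = (Im \o g) \+ (Im \o h)); first exact: measurable_funD.
by apply/funext => x /=; rewrite ImD.
Qed.

Lemma cmeasurableM D g h : cmeasurable D g -> cmeasurable D h ->
  cmeasurable D (fun x => g x * h x).
Proof.
move=> [gr gi] [hr hi]; split.
  rewrite (_ : _ \o _ =
    ((Re \o g) \* (Re \o h)) \- ((Im \o g) \* (Im \o h))).
    by apply: measurable_funB; apply: measurable_funM.
  by apply/funext => x /=; rewrite ReM.
rewrite (_ : _ \o _ =
    ((Re \o g) \* (Im \o h)) \+ ((Im \o g) \* (Re \o h))).
  by apply: measurable_funD; apply: measurable_funM.
by apply/funext => x /=; rewrite ImM.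
Qed.

Lemma cmeasurableB D g h : cmeasurable D g -> cmeasurable D h ->
  cmeasurable D (fun x => g x - h x).
Proof.
move=> mg mh; have := cmeasurableD mg (cmeasurableM (cmeasurable_cst D (-1)) mh).
by under eq_fun do rewrite mulN1r.
Qed.

Lemma cmeasurable_sum (I : Type) (r : seq I) D (F : I -> R -> R[i]) :
  (forall i, cmeasurable D (F i)) ->
  cmeasurable D (fun x => \sum_(i <- r) F i x).
Proof.
move=> mF; elim: r => [|i r IH].
  by under eq_fun do rewrite big_nil; exact: cmeasurable_cst.
by under eq_fun do rewrite big_cons; exact: cmeasurableD.
Qed.

Lemma cintegrable_measurable D g : cintegrable D g -> cmeasurable D g.
Proof.
by move=> [/(measurable_int mu) r /(measurable_int mu) i]; split; exact/measurable_EFinP.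
Qed.

Lemma measurable_normc_sqr D g : cmeasurable D g ->
  measurable_fun D (fun x => normc (g x) ^+ 2).
Proof.
move=> [r i]; under eq_fun do rewrite normc_sqr.
by apply: measurable_funD; apply: measurable_funX.
Qed.

Lemma measurable_normc D g : cmeasurable D g ->
  measurable_fun D (fun x => normc (g x)).
Proof.
move=> mg; under eq_fun do rewrite -[normc _]ger0_norm ?normc_ge0// -sqrtr_sqr.
apply: (@measurableT_comp _ _ _ _ _ _ (@Num.sqrt R)) => //.
  by apply: continuous_measurable_fun; exact: sqrt_continuous.
exact: measurable_normc_sqr.
Qed.

Lemma cintegrable_le D g (q : R -> R) : measurable D -> cmeasurable D g ->
  mu.-integrable D (EFin \o q) -> (forall x, D x -> normc (g x) <= q x) ->
  cintegrable D g.
Proof.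
move=> mD [mr mi] iq gq; split.
  apply: le_integrable iq => //; first exact/measurable_EFinP.
  move=> x Dx /=; rewrite lee_fin (le_trans (Re_le_normc _))//.
  by rewrite (le_trans (gq _ Dx))// ler_norm.
apply: le_integrable iq => //; first exact/measurable_EFinP.
move=> x Dx /=; rewrite lee_fin (le_trans (Im_le_normc _))//.
by rewrite (le_trans (gq _ Dx))// ler_norm.
Qed.

Lemma cintegrable_normc D g : measurable D -> cintegrable D g ->
  mu.-integrable D (EFin \o (fun x => normc (g x))).
Proof.
move=> mD ig; have [r i] := ig.
have r' : mu.-integrable D (EFin \o (fun x => `|Re (g x)|)) := integrable_norm r.
have i' : mu.-integrable D (EFin \o (fun x => `|Im (g x)|)) := integrable_norm i.
have s : mu.-integrable D (EFin \o (fun x => `|Re (g x)| + `|Im (g x)|)).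
  exact: (integrableD mD r' i').
apply: le_integrable s => //.
  by apply/measurable_EFinP; apply: measurable_normc; exact: cintegrable_measurable.
move=> x Dx /=; rewrite lee_fin ger0_norm ?normc_ge0//.
by rewrite (le_trans (normc_le _))// ler_norm.
Qed.

Lemma eq_cintegrable D g h : measurable D -> {in D, g =1 h} ->
  cintegrable D g -> cintegrable D h.
Proof.
move=> mD gh [r i]; split.
  by apply: eq_integrable r => // x xD /=; rewrite gh.
by apply: eq_integrable i => // x xD /=; rewrite gh.
Qed.

Lemma cintegrableS D E g : measurable D -> measurable E -> E `<=` D ->
  cintegrable D g -> cintegrable E g.
Proof. by move=> mD mE ED [r i]; split; exact: (integrableS mD). Qed.

Lemma cintegrableD D g h : measurable D -> cintegrable D g -> cintegrable D h ->
  cintegrable D (fun x => g x + h x).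
Proof.
move=> mD ig ih.
apply: (@cintegrable_le _ _ (fun x => normc (g x) + normc (h x))) => //.
- by apply: cmeasurableD; exact: cintegrable_measurable.
- exact: (integrableD mD (cintegrable_normc mD ig) (cintegrable_normc mD ih)).
- by move=> x _; exact: normcD.
Qed.

Lemma cintegrableM_bounded D g h (M : R) : measurable D -> cmeasurable D g ->
  (forall x, D x -> normc (g x) <= M) -> cintegrable D h ->
  cintegrable D (fun x => g x * h x).
Proof.
move=> mD mg gM ih.
apply: (@cintegrable_le _ _ (fun x => M * normc (h x))) => //.
- by apply: cmeasurableM => //; exact: cintegrable_measurable.
- exact: (integrableZl mD M (cintegrable_normc mD ih)).
- by move=> x Dx; rewrite ComplexField.Normc.normcM ler_wpM2r ?normc_ge0 ?gM.
Qed.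

Lemma cintegrableZ D g z : measurable D -> cintegrable D g ->
  cintegrable D (fun x => z * g x).
Proof.
move=> mD; apply: (@cintegrableM_bounded _ _ _ (normc z)) => //.
exact: cmeasurable_cst.
Qed.

Lemma cintegrableB D g h : measurable D -> cintegrable D g -> cintegrable D h ->
  cintegrable D (fun x => g x - h x).
Proof.
move=> mD ig ih; have := cintegrableD mD ig (cintegrableZ (-1) mD ih).
by under eq_fun do rewrite mulN1r.
Qed.

Lemma cintegrable_bounded D g (M : R) : measurable D -> (mu D < +oo)%E ->
  cmeasurable D g -> (forall x, D x -> normc (g x) <= M) -> cintegrable D g.
Proof.
move=> mD Doo mg gM; apply: (@cintegrable_le _ _ (cst M)) => //.
by apply: measurable_bounded_integrable => //; exists `|M|; split => // x Mx y _ /=; exact: ltW.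
Qed.

Lemma cintegrable_sum (I : Type) (r : seq I) D (F : I -> R -> R[i]) : measurable D ->
  (forall i, cintegrable D (F i)) -> cintegrable D (fun x => \sum_(i <- r) F i x).
Proof.
move=> mD iF; elim: r => [|i r IH].
  under eq_fun do rewrite big_nil.
  by split; exact: integrable0.
by under eq_fun do rewrite big_cons; exact: cintegrableD.
Qed.

Lemma eq_cintegral D g h : {in D, g =1 h} -> cintegral D g = cintegral D h.
Proof. by move=> gh; congr Complex; apply: eq_Rintegral => x xD; rewrite gh. Qed.

Lemma cintegralD D g h : measurable D -> cintegrable D g -> cintegrable D h ->
  cintegral D (fun x => g x + h x) = cintegral D g + cintegral D h.
Proof.
move=> mD [gr gi] [hr hi]; rewrite /cintegral.
under eq_Rintegral do rewrite ReD.
under [X in _ +i* X]eq_Rintegral do rewrite ImD.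
by rewrite !RintegralD.
Qed.

Lemma cintegralZ D g z : measurable D -> cintegrable D g ->
  cintegral D (fun x => z * g x) = z * cintegral D g.
Proof.
move=> mD [gr gi]; rewrite /cintegral.
under eq_Rintegral do rewrite ReM.
under [X in _ +i* X]eq_Rintegral do rewrite ImM.
rewrite RintegralB ?RintegralD ?RintegralZl//; last 4 first.
- exact: (integrableZl mD _ gi).
- exact: (integrableZl mD _ gr).
- exact: (integrableZl mD _ gr).
- exact: (integrableZl mD _ gi).
by case: z.
Qed.

Lemma cintegralB D g h : measurable D -> cintegrable D g -> cintegrable D h ->
  cintegral D (fun x => g x - h x) = cintegral D g - cintegral D h.
Proof.
move=> mD ig ih; rewrite -[X in _ = _ + X]mulN1r -cintegralZ// -cintegralD//.
  by apply: eq_cintegral => x _; rewrite mulN1r.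
exact: cintegrableZ.
Qed.

Lemma cintegral0 D : cintegral D (fun=> 0) = 0.
Proof. by rewrite /cintegral /= /Rintegral integral0. Qed.

Lemma cintegral_sum (I : Type) (r : seq I) D (F : I -> R -> R[i]) : measurable D ->
  (forall i, cintegrable D (F i)) ->
  cintegral D (fun x => \sum_(i <- r) F i x) = \sum_(i <- r) cintegral D (F i).
Proof.
move=> mD iF; elim: r => [|i r IH].
  by rewrite big_nil -[RHS](cintegral0 D); apply: eq_cintegral => x _; rewrite big_nil.
rewrite big_cons -IH -cintegralD//; last exact: cintegrable_sum.
by apply: eq_cintegral => x _; rewrite big_cons.
Qed.

(** With $z$ the integral, $|z|^2$ is the integral of $\mathrm{Re}(\bar z g)$, hence at most
    $|z|\int|g|$; divide by $|z|$. *)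
Lemma normc_cintegral D g : measurable D -> cintegrable D g ->
  normc (cintegral D g) <= \int[mu]_(x in D) normc (g x).
Proof.
move=> mD ig; set z := cintegral D g.
have [z0|z0] := eqVneq (normc z) 0.
  by rewrite z0; apply: Rintegral_ge0 => x _; exact: normc_ge0.
have zp : 0 < normc z by rewrite lt_neqAle eq_sym z0 normc_ge0.
rewrite -(ler_pM2l zp) -expr2 normc_sqrE.
have -> : Re (z^*%C * z) = \int[mu]_(x in D) Re (z^*%C * g x).
  by rewrite {2}/z -cintegralZ.
move: z^*%C (normc_conj z) => z' <-.
have izg := cintegrableZ z' mD ig.
rewrite -RintegralZl//; last exact: cintegrable_normc.
apply: le_Rintegral => //; first by case: izg.
  exact: (integrableZl mD _ (cintegrable_normc mD ig)).
move=> x Dx; rewrite (le_trans (ler_norm _))// (le_trans (Re_le_normc _))//.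
by rewrite ComplexField.Normc.normcM.
Qed.

End ComplexIntegral.

(** * Fourier coefficients *)

Section Exponentials.
Context {R : realType}.
Local Notation mu := (@lebesgue_measure R).
Local Notation Re := (@complex.Re R).
Local Notation Im := (@complex.Im R).
Local Notation I01 := (`[(0 : R), 1]%classic : set (measurableTypeR R)).
Implicit Types (j k : int) (x y : R).

Lemma Rintegral_derive (F f : R -> R) (a b : R) : a <= b ->
  (forall x, is_derive x 1 F (f x)) -> continuous f ->
  \int[mu]_(x in `[a, b]) f x = F b - F a.
Proof.
rewrite le_eqVlt => /predU1P[<- _ _|ab dF cf].
  by rewrite set_itv1 Rintegral_set1 subrr.
have cF x : {for x, continuous F}.
  by apply: differentiable_continuous; apply/derivable1_diffP; have [] := dF x.
rewrite /Rintegral (continuous_FTC2 ab (F := F)) //.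
- by apply: continuous_subspaceT => x; exact: cf.
- split; first by move=> x _; have [] := dF x.
    by apply: cvg_at_right_filter; exact: cF.
  by apply: cvg_at_left_filter; exact: cF.
- by move=> x _; rewrite derive1E; have [] := dF x.
Qed.

Lemma freqD j k : freq (j + k) = freq j + freq k :> R.
Proof. by rewrite /freq intrD mulrDr. Qed.

Lemma freqN k : freq (- k) = - freq k :> R.
Proof. by rewrite /freq mulrNz mulrN. Qed.

Lemma freq0 : freq 0 = 0 :> R. Proof. by rewrite /freq mulr0. Qed.

Lemma freq_eq0 k : (freq k == 0 :> R) = (k == 0).
Proof. by rewrite /freq !mulf_eq0 (gt_eqF (@pi_gt0 R)) pnatr_eq0 /= intr_eq0. Qed.

(** This is $e^{-2\pi ikx}$, the kernel of [fourier]; Fourier series are therefore sums over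
    [ek (- k)]. *)
Definition ek (k : int) (x : R) : R[i] := cexp (0 -i* (freq k * x)).
Arguments ek : simpl never.

Lemma ekE k x : ek k x = cos (freq k * x) -i* sin (freq k * x).
Proof. by rewrite /ek /cexp /= expR0 !mul1r cosN sinN. Qed.

Lemma ekDl j k x : ek (j + k) x = ek j x * ek k x.
Proof.
rewrite /ek -cexpD freqD mulrDl opprD; congr cexp.
by apply/eqP; rewrite eq_complex /= addr0 !eqxx.
Qed.

Lemma ekDr k x y : ek k (x + y) = ek k x * ek k y.
Proof.
rewrite /ek -cexpD mulrDr opprD; congr cexp.
by apply/eqP; rewrite eq_complex /= addr0 !eqxx.
Qed.

Lemma ek0l x : ek 0 x = 1.
Proof. by rewrite ekE freq0 mul0r cos0 sin0 oppr0. Qed.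

Lemma ek0r k : ek k 0 = 1.
Proof. by rewrite ekE mulr0 cos0 sin0 oppr0. Qed.

Lemma ek_conj k x : ek (- k) x = (ek k x)^*%C.
Proof. by rewrite !ekE freqN mulNr cosN sinN opprK /= opprK. Qed.

Lemma ek_oppr k x : ek k (- x) = ek (- k) x.
Proof. by rewrite !ekE freqN mulrN mulNr. Qed.

Lemma normc_ek k x : normc (ek k x) = 1.
Proof. by rewrite ekE /= sqrrN cos2Dsin2 sqrtr1. Qed.

Lemma ek1r k : ek k 1 = 1.
Proof.
have nat1 (n : nat) : ek n%:Z 1 = 1.
  elim: n => [|n IH]; first exact: ek0l.
  rewrite -addn1 PoszD ekDl IH mul1r ekE /freq !mulr1.
  by rewrite mulr_natl cos2pi sin2pi oppr0.
case: k => n; first exact: nat1.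
by rewrite NegzE ek_conj nat1 /= oppr0.
Qed.

Lemma is_derive_cosM (w x : R) :
  is_derive x 1 (fun y => cos (w * y)) (- w * sin (w * x)).
Proof.
have lin : is_derive x 1 (fun y : R => w * y) w.
  have -> : (fun y : R => w * y) = w \*: (id : R -> R^o) by [].
  by apply: is_derive_eq; rewrite /GRing.scale /= mulr1.
apply: is_derive_eq (@is_derive1_comp R cos ( *%R w) x _ _ (is_derive_cos (w * x)) lin) _.
by rewrite mulrC mulrN mulNr.
Qed.

Lemma is_derive_sinM (w x : R) :
  is_derive x 1 (fun y => sin (w * y)) (w * cos (w * x)).
Proof.
have lin : is_derive x 1 (fun y : R => w * y) w.
  have -> : (fun y : R => w * y) = w \*: (id : R -> R^o) by [].
  by apply: is_derive_eq; rewrite /GRing.scale /= mulr1.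
apply: is_derive_eq (@is_derive1_comp R sin ( *%R w) x _ _ (is_derive_sin (w * x)) lin) _.
by rewrite mulrC.
Qed.

Lemma continuous_cosM (w : R) : continuous (fun y => cos (w * y)).
Proof.
move=> x; apply: differentiable_continuous; apply/derivable1_diffP.
by have [] := is_derive_cosM w x.
Qed.

Lemma continuous_sinM (w : R) : continuous (fun y => sin (w * y)).
Proof.
move=> x; apply: differentiable_continuous; apply/derivable1_diffP.
by have [] := is_derive_sinM w x.
Qed.

Lemma Re_ek k : Re \o ek k = (fun x => cos (freq k * x)).
Proof. by apply/funext => x; rewrite -[LHS]/(Re (ek k x)) ekE. Qed.

Lemma Im_ek k : Im \o ek k = (fun x => - sin (freq k * x)).
Proof. by apply/funext => x; rewrite -[LHS]/(Im (ek k x)) ekE. Qed.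

Lemma cmeasurable_ek (D : set (measurableTypeR R)) k : cmeasurable D (ek k).
Proof.
split; rewrite ?Re_ek ?Im_ek; apply: measurable_funTS.
  exact: continuous_measurable_fun (@continuous_cosM _).
apply: measurable_funN.
exact: continuous_measurable_fun (@continuous_sinM _).
Qed.

(** Here [ddx] is just the factor $2\pi ik$. Keeping it on the left instead of dividing by it lets
    the identity cover $k=0$, where both sides vanish. *)
Lemma cintegral_ek k (a b : R) : a <= b ->
  ddx (fun k => cintegral `[a, b] (ek k)) k = ek k a - ek k b.
Proof.
move=> ab; rewrite /ddx.
have -> : cintegral `[a, b] (ek k) = (\int[mu]_(x in `[a, b]) cos (freq k * x))
    +i* (\int[mu]_(x in `[a, b]) - sin (freq k * x)).
  by rewrite -Re_ek -Im_ek.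
have [->|k0] := eqVneq k 0.
  by rewrite freq0 !ek0l subrr -[0 +i* 0]/(0 : R[i]) mul0r.
have w0 : freq k != 0 :> R by rewrite freq_eq0.
set w : R := freq k in w0 *.
have dS x : is_derive x 1 (fun x => w^-1 * sin (w * x)) (cos (w * x)).
  have -> : (fun x => w^-1 * sin (w * x)) = w^-1 \*: (fun x => sin (w * x) : R^o) by [].
  apply: is_derive_eq (is_deriveZ w^-1 (is_derive_sinM w x)) _.
  by rewrite /GRing.scale /= mulrA mulVf// mul1r.
have dC x : is_derive x 1 (fun x => w^-1 * cos (w * x)) (- sin (w * x)).
  have -> : (fun x => w^-1 * cos (w * x)) = w^-1 \*: (fun x => cos (w * x) : R^o) by [].
  apply: is_derive_eq (is_deriveZ w^-1 (is_derive_cosM w x)) _.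
  by rewrite /GRing.scale /= mulrA mulrN mulVf// mulN1r.
have cNs : continuous (fun x : R => - sin (w * x)).
  by move=> x; apply: cvgN; exact: continuous_sinM.
rewrite (Rintegral_derive ab dS (@continuous_cosM w)) (Rintegral_derive ab dC cNs).
rewrite !ekE -/w -!mulrBr; apply/eqP; rewrite eq_complex /=; apply/andP; split; apply/eqP.
  by rewrite mul0r sub0r mulrA divff// mul1r opprB.
by rewrite mul0r add0r mulrA divff// mul1r opprK addrC.
Qed.

Lemma measurable01 : measurable I01. Proof. exact: measurable_itv. Qed.

Lemma mu01 : mu I01 = 1%E.
Proof. by rewrite lebesgue_measure_itv/= lte_fin ltr01 sube0. Qed.

Lemma mu01_lty : (mu I01 < +oo)%E. Proof. by rewrite mu01 ltry. Qed.

Lemma cintegral_cst01 (z : R[i]) : cintegral I01 (fun=> z) = z.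
Proof.
have m1 : fine (mu I01) = 1 by rewrite mu01.
rewrite /cintegral !Rintegral_cst; [|exact: measurable01..].
by rewrite m1 !mulr1; case: z.
Qed.

Lemma cintegrable_cst01 (z : R[i]) : cintegrable I01 (fun=> z).
Proof.
apply: (@cintegrable_bounded _ _ _ (normc z)) => //; first by rewrite mu01 ltry.
exact: cmeasurable_cst.
Qed.

Lemma fourier1 k : fourier (fun=> 1) k = (k == 0)%:R :> R[i].
Proof.
rewrite /fourier -/(ek k _).
under eq_cintegral do rewrite mulr1 -/(ek k _).
have [->|k0] := eqVneq k 0.
  by under eq_cintegral do rewrite ek0l; rewrite cintegral_cst01.
have := cintegral_ek k (@ler01 R); rewrite ek0r ek1r subrr /ddx => /eqP.
rewrite mulf_eq0 => /orP[|/eqP//].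
by rewrite eq_complex /= eqxx /= freq_eq0 (negbTE k0).
Qed.

Lemma cintegrable_ekM k (g : R -> R[i]) : cintegrable I01 g ->
  cintegrable I01 (fun x => ek k x * g x).
Proof.
apply: (@cintegrableM_bounded _ _ _ _ 1) => //; first exact: cmeasurable_ek.
by move=> x _; rewrite normc_ek.
Qed.

Lemma fourierD (g h : R -> R[i]) k : cintegrable I01 g -> cintegrable I01 h ->
  fourier (fun x => g x + h x) k = fourier g k + fourier h k.
Proof.
move=> ig ih; rewrite /fourier -cintegralD//; [|exact: cintegrable_ekM..].
by apply: eq_cintegral => x _; rewrite mulrDr.
Qed.

Lemma fourierB (g h : R -> R[i]) k : cintegrable I01 g -> cintegrable I01 h ->
  fourier (fun x => g x - h x) k = fourier g k - fourier h k.
Proof.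
move=> ig ih; rewrite /fourier -cintegralB//; [|exact: cintegrable_ekM..].
by apply: eq_cintegral => x _; rewrite mulrBr.
Qed.

Lemma fourierZ (z : R[i]) (g : R -> R[i]) k : cintegrable I01 g ->
  fourier (fun x => z * g x) k = z * fourier g k.
Proof.
move=> ig; rewrite /fourier -cintegralZ//; last exact: cintegrable_ekM.
by apply: eq_cintegral => x _; rewrite mulrCA.
Qed.

Lemma fourier_ekM (g : R -> R[i]) j k :
  fourier (fun x => ek j x * g x) k = fourier g (k + j).
Proof. by apply: eq_cintegral => x _; rewrite mulrA -ekDl. Qed.

Lemma normc_fourier (g : R -> R[i]) k : cintegrable I01 g ->
  normc (fourier g k) <= \int[mu]_(x in `[0, 1]) normc (g x).
Proof.
move=> ig.
have <- : \int[mu]_(x in `[0, 1]) normc (ek k x * g x) =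
    \int[mu]_(x in `[0, 1]) normc (g x).
  by apply: eq_Rintegral => x _; rewrite ComplexField.Normc.normcM normc_ek mul1r.
exact: (normc_cintegral _ (cintegrable_ekM k ig)).
Qed.

(** * Trigonometric polynomials and Bessel's inequality *)

Definition trig (X : seq int) (a : int -> R[i]) (x : R) : R[i] :=
  \sum_(k <- X) a k * ek (- k) x.

Lemma cmeasurable_trig D X a : cmeasurable D (trig X a).
Proof.
apply: cmeasurable_sum => k; apply: cmeasurableM; first exact: cmeasurable_cst.
exact: cmeasurable_ek.
Qed.

Lemma normc_trig X a x : normc (trig X a x) <= \sum_(k <- X) normc (a k).
Proof.
apply: le_trans (normc_sum _ _) _; apply: ler_sum => k _.
by rewrite ComplexField.Normc.normcM normc_ek mulr1.
Qed.

Lemma cintegrable_trigM X a (g : R -> R[i]) : cintegrable I01 g ->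
  cintegrable I01 (fun x => trig X a x * g x).
Proof.
apply: (@cintegrableM_bounded _ _ _ _ (\sum_(k <- X) normc (a k))) => //.
  exact: cmeasurable_trig.
by move=> x _; exact: normc_trig.
Qed.

Lemma cintegrable_trig X a : cintegrable I01 (trig X a).
Proof.
apply: (@cintegrable_bounded _ _ _ (\sum_(k <- X) normc (a k))) => //.
- by rewrite mu01 ltry.
- exact: cmeasurable_trig.
- by move=> x _; exact: normc_trig.
Qed.

(** Multiplication by $e^{2\pi ijx}$ shifts the coefficients by $j$, so the product with a
    trigonometric polynomial is a finite convolution. *)
Lemma fourier_trigM X a (g : R -> R[i]) k : cintegrable I01 g ->
  fourier (fun x => trig X a x * g x) k = \sum_(j <- X) a j * fourier g (k - j).
Proof.
move=> ig; rewrite /trig.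
transitivity (fourier (fun x => \sum_(j <- X) a j * (ek (- j) x * g x)) k).
  by congr fourier; apply/funext => x; rewrite big_distrl /=;
    apply: eq_bigr => j _; rewrite mulrA.
rewrite /fourier.
transitivity (cintegral `[0, 1]
    (fun x => \sum_(j <- X) a j * (ek k x * (ek (- j) x * g x)))).
  by apply: eq_cintegral => x _; rewrite big_distrr /=; apply: eq_bigr => j _;
    rewrite mulrCA.
rewrite cintegral_sum//; last first.
  by move=> j; apply: cintegrableZ => //; do 2 apply: cintegrable_ekM.
apply: eq_bigr => j _; rewrite cintegralZ//; last by do 2 apply: cintegrable_ekM.
by congr (_ * _); exact: fourier_ekM.
Qed.

Lemma fourier_trig X a k : uniq X ->
  fourier (trig X a) k = if k \in X then a k else 0.
Proof.
move=> uX; have -> : trig X a = (fun x => trig X a x * 1).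
  by apply/funext => x; rewrite mulr1.
rewrite fourier_trigM; last exact: cintegrable_cst01.
under eq_bigr do rewrite fourier1 subr_eq0.
case: ifPn => kX.
  rewrite (bigD1_seq k)//= eqxx mulr1 big1 ?addr0// => j jk.
  by rewrite eq_sym (negbTE jk) mulr0.
rewrite big_seq big1// => j jX; case: eqP => [kj|]; last by rewrite mulr0.
by rewrite kj jX in kX.
Qed.

(** The $L^2$ pairing with a trigonometric polynomial: for [h] the polynomial itself it gives
    Parseval's identity, for general [h] the cross term in Bessel's inequality. *)
Lemma cintegral_conj_trigM X a (h : R -> R[i]) : cintegrable I01 h ->
  cintegral I01 (fun x => (trig X a x)^*%C * h x)
    = \sum_(k <- X) (a k)^*%C * fourier h k.
Proof.
move=> ih.
transitivity (cintegral I01 (fun x => \sum_(k <- X) (a k)^*%C * (ek k x * h x))).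
  apply: eq_cintegral => x _; rewrite /trig rmorph_sum big_distrl /=.
  apply: eq_bigr => k _; rewrite ek_conj mulrA; congr (_ * _).
  by case: (a k) (ek k x) => p q [r s]; apply/eqP; rewrite eq_complex /=;
    apply/andP; split; apply/eqP; ring.
rewrite cintegral_sum//; last first.
  by move=> j; apply: cintegrableZ => //; exact: cintegrable_ekM.
by apply: eq_bigr => k _; rewrite cintegralZ//; exact: cintegrable_ekM.
Qed.

Lemma Re_sum (I : Type) (r : seq I) (F : I -> R[i]) :
  Re (\sum_(i <- r) F i) = \sum_(i <- r) Re (F i).
Proof. by elim: r => [|i r IH]; rewrite ?big_nil ?big_cons ?ReD ?IH. Qed.

Lemma Rintegral_trig_sqr X a : uniq X ->
  \int[mu]_(x in I01) (normc (trig X a x) ^+ 2) = \sum_(k <- X) normc (a k) ^+ 2.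
Proof.
move=> uX; under eq_Rintegral do rewrite normc_sqrE.
rewrite -[LHS]/(Re (cintegral I01 (fun x => (trig X a x)^*%C * trig X a x))).
rewrite cintegral_conj_trigM; last exact: cintegrable_trig.
rewrite Re_sum big_seq [RHS]big_seq; apply: eq_bigr => k kX.
by rewrite fourier_trig// kX normc_sqrE.
Qed.

Lemma integrable_trig_sqr X a :
  mu.-integrable I01 (EFin \o (fun x => normc (trig X a x) ^+ 2)).
Proof.
apply: measurable_bounded_integrable => //; first exact: mu01_lty.
  by apply: measurable_normc_sqr; exact: cmeasurable_trig.
exists ((\sum_(k <- X) normc (a k)) ^+ 2).
split => [|M sM x _ /=]; first exact: num_real.
rewrite ger0_norm ?sqr_ge0//; apply: le_trans (ltW sM).
rewrite ler_sqr ?nnegrE ?normc_ge0 ?normc_trig//.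
by rewrite sumr_ge0// => k _; exact: normc_ge0.
Qed.

(** Expand $\int|h-p|^2\ge0$ for the partial Fourier sum $p$ over [X]: both $\int|p|^2$ and the real
    part of the cross integral equal the sum on the left. *)
Lemma bessel X (h : R -> R[i]) : uniq X -> cintegrable I01 h ->
  mu.-integrable I01 (EFin \o (fun x => normc (h x) ^+ 2)) ->
  \sum_(k <- X) normc (fourier h k) ^+ 2 <= \int[mu]_(x in I01) (normc (h x) ^+ 2).
Proof.
move=> uX ih i2h; set p := trig X (fourier h).
have ip2 := integrable_trig_sqr X (fourier h); rewrite -/p in ip2.
have ich : cintegrable I01 (fun x => (p x)^*%C * h x).
  apply: (@cintegrableM_bounded _ _ _ _ (\sum_(k <- X) normc (fourier h k))) => //.
    have [r i] := cmeasurable_trig I01 X (fourier h).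
    split; first by rewrite (_ : _ \o _ = Re \o p)//; apply/funext => x /=; case: (p x).
    rewrite (_ : _ \o _ = \- (Im \o p)); first exact: measurable_funN.
    by apply/funext => x /=; case: (p x).
  by move=> x _; rewrite normc_conj normc_trig.
have E : \int[mu]_(x in I01) Re ((p x)^*%C * h x) =
    \sum_(k <- X) normc (fourier h k) ^+ 2.
  rewrite -[LHS]/(Re (cintegral I01 (fun x => (p x)^*%C * h x))).
  by rewrite cintegral_conj_trigM// Re_sum; apply: eq_bigr => k _; rewrite normc_sqrE.
have := Rintegral_trig_sqr (fourier h) uX; rewrite -/p => P.
rewrite -subr_ge0; have -> : \int[mu]_(x in I01) (normc (h x) ^+ 2)
    - \sum_(k <- X) normc (fourier h k) ^+ 2 =
  \int[mu]_(x in I01) (normc (h x) ^+ 2 + normc (p x) ^+ 2)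
    - \int[mu]_(x in I01) (2 * Re ((p x)^*%C * h x)).
  rewrite RintegralD// RintegralZl//; last by case: ich.
  by rewrite E P; lra.
rewrite -RintegralB//; last 2 first.
- exact: (integrableD measurable01 i2h ip2).
- by have [r _] := ich; exact: (integrableZl measurable01 2 r).
apply: Rintegral_ge0 => x _; rewrite !normc_sqr.
case: (p x) (h x) => a b [c d] /=.
have := sqr_ge0 (a - c); have := sqr_ge0 (b - d); lra.
Qed.

End Exponentials.

(** * Pointwise convergence of Fourier series *)

Section Chernoff.
Context {R : realType}.
Local Notation mu := (@lebesgue_measure R).
Local Notation Re := (@complex.Re R).
Local Notation Im := (@complex.Im R).
Local Notation I01 := (`[(0 : R), 1]%classic : set (measurableTypeR R)).
Implicit Types (j k : int) (x y : R).

(** Along an injective sequence the partial sums are monotone and bounded by [B], so the series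
    converges and its terms vanish. *)
Lemma cvg0_bounded_sums (c : int -> R) (s : nat -> int) (B : R) :
  injective s -> (forall k, 0 <= c k) ->
  (forall X, uniq X -> \sum_(k <- X) c k <= B) ->
  c (s n) @[n --> \oo] --> (0 : R).
Proof.
move=> sI c0 cB; apply: cvg_series_cvg_0.
apply: nondecreasing_is_cvgn.
  apply/nondecreasing_seqP => n; rewrite /series /= big_nat_recr//=.
  by rewrite lerDl.
exists B => _ [n _ <-]; rewrite /series /=.
rewrite -(big_map s xpredT c); apply: cB.
by rewrite map_inj_uniq// iota_uniq.
Qed.

Lemma cmeasurableV (D : set (measurableTypeR R)) (g : R -> R[i]) :
  cmeasurable D g -> cmeasurable D (fun x => (g x)^-1).
Proof.
move=> mg; have mn : measurable_fun D (fun x => (normc (g x) ^+ 2) `^ (-1)).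
  exact: (measurableT_comp (measurable_powR (-1)) (measurable_normc_sqr mg)).
(* $z^{-1}=|z|^{-2}\bar z$, valid at $z=0$ too since both sides are then 0 by convention. *)
have E x : (g x)^-1 = ((normc (g x) ^+ 2) `^ (-1))%:C * (g x)^*%C.
  rewrite powR_inv1 ?sqr_ge0// normc_sqr; case: (g x) => a b.
  apply/eqP; rewrite eq_complex /=; apply/andP; split; apply/eqP.
    by rewrite mul0r subr0 mulrC.
  by rewrite mul0r addr0 mulrC mulrN.
under eq_fun do rewrite E.
apply: cmeasurableM; first by split=> //=; exact: measurable_cst.
have [r i] := mg; split.
  by rewrite (_ : _ \o _ = Re \o g)//; apply/funext => x /=; case: (g x).
rewrite (_ : _ \o _ = \- (Im \o g)); first exact: measurable_funN.
by apply/funext => x /=; case: (g x).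
Qed.

(** The mean value theorem gives $y\cos y\le\sin y$. At $y=s/2$ this yields $\sin
    s=2\sin(s/2)\cos(s/2)\ge s\cos^2(s/2)=s(1+\cos s)/2\ge s/2$. *)
Lemma sin_ge_half (s : R) : 0 <= s <= pi / 2 -> s / 2 <= sin s.
Proof.
move=> /andP[s0 sp].
have h (y : R) : 0 <= y <= pi / 2 -> y * cos y <= sin y.
  move=> /andP[]; rewrite le_eqVlt => /predU1P[<- _|y0 yp].
    by rewrite mul0r sin0.
  have [|c cI] := MVT y0 (fun x _ => is_derive_sin x).
    by apply: continuous_subspaceT => x; exact: continuous_sin.
  rewrite sin0 !subr0 => ->; rewrite mulrC ler_wpM2r ?(ltW y0)//.
  move: cI; rewrite in_itv/= => /andP[c0 cy].
  have cpi : y <= pi by apply: le_trans yp _; have := @pi_ge0 R; lra.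
  apply/ltW; rewrite (@ltr_cos R)// in_itv/= ?(ltW c0) ?(ltW y0) ?cpi//.
  by rewrite (le_trans (ltW cy)).
have sh : 0 <= s / 2 <= pi / 2 by apply/andP; split; have := @pi_ge0 R; lra.
have := h _ sh; have E : sin s = 2 * (sin (s / 2) * cos (s / 2)).
  by rewrite {1}(splitr s) sinD [X in _ + X]mulrC mulrDl mul1r.
have C : cos s = 2 * cos (s / 2) ^+ 2 - 1.
  by rewrite {1}(splitr s) cosD -!expr2 [sin _ ^+ 2]sin2cos2; lra.
have c0 : 0 <= cos s by apply: cos_ge0_pihalf; apply/andP; split; have := @pi_ge0 R; lra.
have ch0 : 0 <= cos (s / 2).
  by apply: cos_ge0_pihalf; apply/andP; split; have := @pi_ge0 R; lra.
by rewrite E; nra.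
Qed.

(** The right side is $|e^{2\pi it}-1|=2|\sin\pi t|$. It vanishes at all integers, and the margin
    [d] keeps $t$ away from $\pm1$; for $|t|>1/2$ the reflection $|t|\mapsto1-|t|$ leads back to
    [sin_ge_half]. *)
Lemma normc_ek_sub1 (t d : R) : 0 < d <= 1 -> `|t| <= 1 - d ->
  d * `|t| <= normc (ek (-1) t - 1).
Proof.
move=> /andP[d0 d1] td.
have -> : normc (ek (-1) t - 1) = 2 * `|sin (pi * `|t|)|.
  have -> : `|sin (pi * `|t|)| = `|sin (pi * t)|.
    by case: (ger0P t) => // _; rewrite mulrN sinN normrN.
  apply/eqP; rewrite -(@eqrXn2 _ 2)// ?normc_ge0 ?mulr_ge0//; apply/eqP.
  rewrite normc_sqr exprMn real_normK ?num_real// ek_conj !ekE /= /freq mulr1.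
  rewrite subr0 opprK.
  have -> : 2 * pi * t = pi * t + pi * t by ring.
  rewrite cosD sinD -!expr2.
  have := cos2Dsin2 (pi * t); set c := cos _; set s := sin _ => cs.
  have -> : c ^+ 2 = 1 - s ^+ 2 by rewrite -cs addrK.
  have -> : (s * c + c * s) ^+ 2 = 4 * s ^+ 2 * c ^+ 2 by ring.
  have -> : c ^+ 2 = 1 - s ^+ 2 by rewrite -cs addrK.
  ring.
move: `|t| (normr_ge0 t) td => r r0 rd.
have pi2 := @pi_ge2 R.
have [rh|rh] := lerP (pi * r) (pi / 2).
  have sr : pi * r / 2 <= sin (pi * r) by apply: sin_ge_half; rewrite rh mulr_ge0//; lra.
  have := ler_norm (sin (pi * r)); nra.
have -> : sin (pi * r) = sin (pi * (1 - r)).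
  by rewrite mulrBr mulr1 sinB sinpi cospi mul0r mulN1r sub0r opprK.
have sr : pi * (1 - r) / 2 <= sin (pi * (1 - r)).
  by apply: sin_ge_half; apply/andP; split; nra.
have := ler_norm (sin (pi * (1 - r))); nra.
Qed.

Definition zrange (N : nat) : seq int := [seq n%:Z - N%:Z | n <- iota 0 N.*2.+1].

Lemma zrange_uniq N : uniq (zrange N).
Proof. by rewrite map_inj_uniq ?iota_uniq// => m n /addIr []. Qed.

Lemma mem_zrange N k : (k \in zrange N) = (`|k| <= N)%N.
Proof.
apply/mapP/idP => [[n]|kN].
  by rewrite mem_iota => /andP[_ nN] ->; lia.
exists (absz (k + N%:Z)); last by lia.
by rewrite mem_iota; lia.
Qed.

(* Chernoff's argument: dividing [G - G x] by [e^{2 pi i (y - x)} - 1] makes the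
   partial Fourier sum at [x] telescope to two Fourier coefficients of a bounded
   function, which tend to 0 by Bessel's inequality. *)
Lemma fourier_pointwise_cvg (G : R -> R[i]) (x C : R) :
  0 < x < 1 -> cmeasurable I01 G ->
  (forall y, 0 <= y <= 1 -> normc (G y - G x) <= C * `|y - x|) ->
  normc (trig (zrange N) (fourier G) x - G x) @[N --> \oo] --> (0 : R).
Proof.
move=> /andP[x0 x1] mG GC.
have C0 : 0 <= C.
  have := GC 0; rewrite lexx ler01 sub0r normrN gtr0_norm// => /(_ isT).
  by move=> /(le_trans (normc_ge0 _)); rewrite pmulr_lge0.
(* Distance from $x$ to the ends of the interval: for $y\in[0,1]$ it gives $|y-x|\le1-d$, so the
   denominator [E] vanishes only at $y=x$. *)
pose d := Num.min x (1 - x).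
have d0 : 0 < d by rewrite lt_min x0 subr_gt0.
have dx : d <= x by rewrite ge_min lexx.
have dx' : d <= 1 - x by rewrite ge_min lexx orbT.
have d1 : d <= 1 by lra.
pose E y : R[i] := ek (-1) (y - x) - 1.
have EB y : 0 <= y <= 1 -> d * `|y - x| <= normc (E y).
  move=> /andP[y0 y1]; apply: normc_ek_sub1; first by rewrite d0.
  by rewrite ler_norml; apply/andP; split; lra.
have E0 y : 0 <= y <= 1 -> y != x -> E y != 0.
  move=> y01 yx; apply/eqP => Ey; have := EB y y01.
  rewrite Ey ComplexField.Normc.normc0 pmulr_rle0// normr_le0 subr_eq0.
  by rewrite (negbTE yx).
(* At $y=x$ the value is 0; elsewhere the hypothesis on [G] and the lower bound [EB] cancel the
   factor $|y-x|$ and leave $C/d$. *)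
pose h y := (G y - G x) * (E y)^-1.
have hB y : I01 y -> normc (h y) <= C / d.
  rewrite /= in_itv/= => y01; rewrite /h ComplexField.Normc.normcM.
  have [->|yx] := eqVneq y x.
    by rewrite subrr ComplexField.Normc.normc0 mul0r divr_ge0// ltW.
  rewrite ComplexField.Normc.normcV.
  have yx0 : 0 < `|y - x| by rewrite normr_gt0 subr_eq0.
  have En : 0 < normc (E y) by apply: lt_le_trans (EB y y01); rewrite mulr_gt0.
  rewrite ler_pdivrMr// (le_trans (GC y y01))//.
  rewrite -mulrA ler_wpM2l// -ler_pdivrMl ?invr_gt0// invrK.
  exact: EB.
have mE : cmeasurable I01 E.
  have -> : E = (fun y => ek (-1) y * ek (-1) (- x) - 1).
    by apply/funext => y; rewrite /E ekDr.
  apply: cmeasurableB; last exact: cmeasurable_cst.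
  by apply: cmeasurableM; [exact: cmeasurable_ek|exact: cmeasurable_cst].
have mh : cmeasurable I01 h.
  apply: cmeasurableM; last exact: cmeasurableV.
  by apply: cmeasurableB => //; exact: cmeasurable_cst.
have ih : cintegrable I01 h := cintegrable_bounded measurable01 (@mu01_lty R) mh hB.
have ih2 : mu.-integrable I01 (EFin \o (fun y => normc (h y) ^+ 2)).
  apply: measurable_bounded_integrable => //; first exact: mu01_lty.
    exact: measurable_normc_sqr.
  exists ((C / d) ^+ 2); split => [|M sM y Iy /=]; first exact: num_real.
  rewrite ger0_norm ?sqr_ge0//; apply: le_trans (ltW sM).
  by rewrite ler_sqr ?nnegrE ?normc_ge0 ?hB ?divr_ge0// ltW.
have GhE y : I01 y -> G y = G x + (ek 1 x * (ek (-1) y * h y) - h y).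
  rewrite /= in_itv/= => y01.
  have [yx|yx] := eqVneq y x.
    by rewrite /h yx subrr mul0r !mulr0 subrr addr0.
  have -> : ek 1 x * (ek (-1) y * h y) - h y = E y * h y.
    by rewrite /E ekDr ek_oppr opprK; ring.
  by rewrite /h mulrCA mulfV ?mulr1 ?E0// addrC subrK.
pose eta k := normc (fourier h k).
have GE k : fourier G k = G x * (k == 0)%:R + (ek 1 x * fourier h (k - 1) - fourier h k).
  rewrite -fourier1 -fourierZ; last exact: cintegrable_cst01.
  rewrite -fourier_ekM -fourierZ; last exact: cintegrable_ekM.
  rewrite -fourierB//; last by apply: cintegrableZ => //; exact: cintegrable_ekM.
  rewrite -fourierD; last 2 first.
  - by apply: cintegrableZ => //; exact: cintegrable_cst01.
  - apply: cintegrableB => //.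
    by apply: cintegrableZ => //; exact: cintegrable_ekM.
  by apply: eq_cintegral => y; rewrite inE => Iy; rewrite mulr1 -GhE.
have bnd N : normc (trig (zrange N) (fourier G) x - G x)
    <= eta (- N.+1%:Z) + eta N%:Z.
  have -> : trig (zrange N) (fourier G) x - G x =
      ek N.+1%:Z x * fourier h (- N.+1%:Z) - ek (- N%:Z) x * fourier h N%:Z.
    rewrite /trig.
    under eq_bigr do rewrite GE mulrDl.
    rewrite big_split /= addrAC.
    have -> : \sum_(k <- zrange N) G x * (k == 0)%:R * ek (- k) x = G x.
      rewrite (bigD1_seq 0) ?mem_zrange ?zrange_uniq// eqxx mulr1 oppr0 ek0l mulr1 /=.
      by rewrite big1 ?addr0// => k /negbTE ->; rewrite mulr0 mul0r.
    rewrite subrr add0r big_map.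
    (* With $k=n-N$ this is $e^{2\pi i(k-1)x}\widehat h(k-1)$, and by [GE] the $k$-th remaining term
       of the partial sum is the difference of two consecutive ones. *)
    pose eta' n := ek (N.+1%:Z - n%:Z) x * fourier h (n%:Z - N.+1%:Z).
    transitivity (\sum_(0 <= n < N.*2.+1) (eta' n - eta' n.+1)).
      rewrite /index_iota subn0; apply: eq_bigr => n _; rewrite /eta'.
      rewrite mulrBl mulrAC -ekDl; congr (ek _ x * fourier h _ - _); [lia|lia|].
      rewrite mulrC; congr (ek _ x * fourier h _); lia.
    rewrite (@telescope_sumr_eq _ 0 _ (fun n => - eta' n)) => // [|n _].
      rewrite opprK addrC /eta' subr0 sub0r.
      congr (_ - ek _ x * fourier h _); lia.
    by rewrite opprK addrC.
  apply: le_trans (normcB _ _) _.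
  by rewrite !ComplexField.Normc.normcM !normc_ek !mul1r.
have eta0 (s : nat -> int) : injective s -> eta (s n) @[n --> \oo] --> (0 : R).
  move=> sI; have sB X : uniq X -> \sum_(k <- X) (eta k) ^+ 2 <=
      \int[mu]_(y in I01) (normc (h y) ^+ 2).
    by move=> uX; exact: bessel.
  have c2 := cvg0_bounded_sums sI (fun k => sqr_ge0 (eta k)) sB.
  have -> : (fun n => eta (s n)) = (fun n => Num.sqrt (eta (s n) ^+ 2)).
    by apply/funext => n; rewrite sqrtr_sqr ger0_norm ?normc_ge0.
  rewrite -[X in _ --> X]sqrtr0.
  by apply: (cvg_comp _ _ c2); exact: sqrt_continuous.
apply: (@squeeze_cvgr _ _ _ _ (cst 0) (fun N => eta (- N.+1%:Z) + eta N%:Z)).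
- by apply: nearW => N; rewrite normc_ge0 bnd.
- exact: cvg_cst.
- rewrite -[X in _ --> X]addr0; apply: cvgD; apply: eta0; last by move=> m n [].
  by move=> m n /oppr_inj [].
Qed.

End Chernoff.

(** * Translations and Fatou's lemma *)

Section Translation.
Context {R : realType}.
Local Notation mu := (@lebesgue_measure R).
Local Notation mR := (measurableTypeR R).

Let measurable_shift (a : R) : measurable_fun [set: mR] (fun x : mR => (x + a : mR)).
Proof. by apply: measurable_funD => //; exact: measurable_cst. Qed.

(** The image measure under the translation gives half-open intervals their length, and this
    determines Lebesgue measure. *)
Lemma lebesgue_measure_shift (a : R) (A : set mR) : measurable A ->
  mu ((fun x => x + a) @^-1` A) = mu A.
Proof.
move=> mA.
pose nu := @pushforward _ _ mR mR R mu (fun x : mR => (x + a : mR)).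
pose m : {measure set mR -> \bar R} :=
  measure_function_pushforward__canonical__measure_function_Measure mu (measurable_shift a).
rewrite -[LHS]/(m A); apply/esym; apply: lebesgue_measure_unique => // X [[c d] _ <-].
rewrite /m /= /pushforward.
rewrite (_ : _ @^-1` _ = `](c - a), (d - a)]%classic); last first.
  by apply/seteqP; split => x /=; rewrite !in_itv/= ltrBlDr lerBrDr.
by rewrite !lebesgue_measure_itv/= !lte_fin ltrD2r -!EFinD opprB addrA subrK.
Qed.

Lemma ge0_integral_shift (f : R -> \bar R) (a : R) (D : set mR) :
  measurable D -> measurable_fun D f -> (forall x, D x -> (0 <= f x)%E) ->
  (\int[mu]_(x in (fun x => x + a)%R @^-1` D) f (x + a)%R = \int[mu]_(x in D) f x)%E.
Proof.
move=> mD mf f0.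
pose m : {measure set mR -> \bar R} :=
  measure_function_pushforward__canonical__measure_function_Measure mu (measurable_shift a).
transitivity (\int[m]_(x in D) f x)%E; last first.
  by apply: eq_measure_integral => A mA _; rewrite /= /pushforward lebesgue_measure_shift.
rewrite (ge0_integral_pushforward (measurable_shift a))// => x.
by rewrite inE => /f0.
Qed.

Lemma preimage_shift_itv (a c d : R) :
  (fun x => x + a) @^-1` `[c, d] = `[(c - a), (d - a)]%classic.
Proof. by apply/seteqP; split => x /=; rewrite !in_itv/= lerBlDr lerBrDr. Qed.

Lemma measurable_fun_shift d' (T : measurableType d') (f : R -> T) (a c d : R) :
  measurable_fun (`[c, d] : set mR) f ->
  measurable_fun (`[(c - a), (d - a)] : set mR) (fun x => f (x + a)).
Proof.
move=> mf; apply: (measurable_comp (F := `[c, d])) => //.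
  move=> _ [x + <-]; rewrite /= !in_itv/= => /andP[xc xd].
  by apply/andP; split; lra.
exact: measurable_funS (measurable_shift a).
Qed.

Lemma integrable_shift (f : R -> R) (a c d : R) :
  mu.-integrable `[c, d] (EFin \o f) ->
  mu.-integrable `[(c - a), (d - a)] (EFin \o (fun x => f (x + a))).
Proof.
move=> /integrableP[mf foo]; apply/integrableP; split.
  apply/measurable_EFinP; apply: measurable_fun_shift; exact/measurable_EFinP.
rewrite -preimage_shift_itv.
rewrite (@ge0_integral_shift (fun x => `|(f x)%:E|)%E)//.
exact: measurableT_comp.
Qed.

Lemma Rintegral_shift (f : R -> R) (a c d : R) :
  mu.-integrable `[c, d] (EFin \o f) ->
  \int[mu]_(x in `[(c - a), (d - a)]) f (x + a) = \int[mu]_(x in `[c, d]) f x.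
Proof.
move=> intf; have /integrableP[mf foo] := intf.
rewrite /Rintegral -preimage_shift_itv; congr fine.
rewrite integralE [RHS]integralE.
rewrite -(@ge0_integral_shift (EFin \o f)^\+%E a)//; last exact: measurable_funepos.
rewrite -(@ge0_integral_shift (EFin \o f)^\-%E a)//; last exact: measurable_funeneg.
by congr (_ - _)%E; apply: eq_integral => x _; rewrite ?funeposE ?funenegE.
Qed.

Lemma cintegral_shift (f : R -> R[i]) (a c d : R) : cintegrable (`[c, d] : set mR) f ->
  cintegral `[(c - a), (d - a)] (fun x => f (x + a)) = cintegral `[c, d] f.
Proof.
move=> [r i]; congr Complex.
  exact: (@Rintegral_shift (fun x => complex.Re (f x))).
exact: (@Rintegral_shift (fun x => complex.Im (f x))).
Qed.

Lemma cintegrable_shift (f : R -> R[i]) (a c d : R) : cintegrable (`[c, d] : set mR) f ->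
  cintegrable (`[(c - a), (d - a)] : set mR) (fun x => f (x + a)).
Proof.
move=> [r i]; split.
  exact: (@integrable_shift (fun x => complex.Re (f x))).
exact: (@integrable_shift (fun x => complex.Im (f x))).
Qed.

Lemma ae_shift (a : R) (P : R -> Prop) :
  {ae mu, forall x, P x} -> {ae mu, forall x, P (x + a)}.
Proof.
move=> [N [mN N0 PN]]; exists ((fun x => x + a) @^-1` N); split.
- by rewrite -[X in measurable X]setTI; exact: measurable_shift.
- by rewrite -[RHS]N0; exact: lebesgue_measure_shift.
- by move=> x /= nPx; exact: PN.
Qed.

End Translation.

Section Limits.
Context {R : realType}.
Local Notation mu := (@lebesgue_measure R).
Local Notation mR := (measurableTypeR R).

(** Wherever the sequence converges its limit is the lower limit, so Fatou's lemma transfers a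
    uniform bound under convergence almost everywhere. *)
Lemma fatou_bound (D : set mR) (f : nat -> R -> R) (g : R -> R) (B : R) :
  measurable D -> (forall n, measurable_fun D (f n)) -> measurable_fun D g ->
  (forall n x, 0 <= f n x) -> (forall x, 0 <= g x) ->
  {ae mu, forall x, D x -> f n x @[n --> \oo] --> g x} ->
  (forall n, (\int[mu]_(x in D) (f n x)%:E <= B%:E)%E) ->
  (\int[mu]_(x in D) (g x)%:E <= B%:E)%E.
Proof.
move=> mD mf mg f0 g0 fg fB.
have mF n : measurable_fun D (fun x => (f n x)%:E) by exact/measurable_EFinP.
have F0 n x : D x -> (0 <= (f n x)%:E)%E by rewrite lee_fin.
have l0 x : D x -> (0 <= limn_einf (fun n => (f n x)%:E))%E.
  move=> Dx; rewrite limn_einf_lim; apply: lime_ge; first exact: is_cvg_einfs.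
  by apply: nearW => n; apply: le_ereal_inf_tmp => _ [m /= nm <-]; exact: F0.
apply: (@le_trans _ _ (\int[mu]_(x in D) limn_einf (fun n => (f n x)%:E))%E).
  apply: ae_ge0_le_integral => //.
  - by move=> x _; rewrite lee_fin.
  - exact/measurable_EFinP.
  - apply: (emeasurable_fun_cvg (fun n x => einfs (fun m => (f m x)%:E) n)).
      by move=> n; exact: (measurable_fun_einfs mF).
    by move=> x _; rewrite limn_einf_lim; exact: is_cvg_einfs.
  - apply: filterS fg => x fgx Dx.
    have c : (f n x)%:E @[n --> \oo] --> (g x)%:E by apply: cvg_EFin; [exact: nearW|exact: fgx].
    by rewrite is_cvg_limn_einfE ?(cvg_lim _ c)//; apply/cvg_ex; exists (g x)%:E.
apply: le_trans (fatou _ _ mF F0) _ => //.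
rewrite limn_einf_lim; apply: lime_le; first exact: is_cvg_einfs.
apply: nearW => n; apply: le_trans (fB n).
by apply: ereal_inf_lbound; exists n => /=.
Qed.

End Limits.

(** * Fourier coefficients of primitives *)

Section Primitive.
Context {R : realType}.
Local Notation mu := (@lebesgue_measure R).
Local Notation mR := (measurableTypeR R).
Local Notation Re := (@complex.Re R).
Local Notation Im := (@complex.Im R).
Local Notation I01 := (`[(0 : R), 1]%classic : set mR).

Lemma EFin_Rintegral (D : set mR) (f : R -> R) : measurable D ->
  mu.-integrable D (EFin \o f) ->
  (\int[mu]_(x in D) (f x)%:E)%E = (\int[mu]_(x in D) f x)%:E.
Proof. by move=> mD fi; rewrite /Rintegral fineK//; exact: integrable_fin_num. Qed.

(** Both sides are iterated integrals of $\phi(x)f(t)$ over the triangle $0\le t\le x\le1$. This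
    stands in for integration by parts, as the primitive is differentiable only almost
    everywhere. *)
Lemma Rintegral_primitive_mul (f phi : R -> R) :
  mu.-integrable I01 (EFin \o f) -> continuous phi ->
  \int[mu]_(x in `[0, 1]) (phi x * \int[mu]_(t in `[0, x]) f t) =
  \int[mu]_(t in `[0, 1]) (f t * \int[mu]_(x in `[t, 1]) phi x).
Proof.
move=> fi cphi.
have mI : measurable I01 by [].
have iphi : mu.-integrable I01 (EFin \o phi).
  apply: continuous_compact_integrable; first exact: segment_compact.
  exact: continuous_subspaceT.
pose fI := f \_ I01; pose pI := phi \_ I01.
have ifI : mu.-integrable [set: mR] (EFin \o fI).
  by rewrite -restrict_EFin; exact: (@integrable_mkcond _ _ _ mu I01 (EFin \o f) mI).1.
have ipI : mu.-integrable [set: mR] (EFin \o pI).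
  by rewrite -restrict_EFin; exact: (@integrable_mkcond _ _ _ mu I01 (EFin \o phi) mI).1.
have mfI : measurable_fun [set: mR] fI.
  by apply/measurable_EFinP; exact: (measurable_int mu).
have mpI : measurable_fun [set: mR] pI.
  by apply/measurable_EFinP; exact: (measurable_int mu).
pose K (z : mR * mR) : R := if z.2 <= z.1 then pI z.1 * fI z.2 else 0.
have mK : measurable_fun [set: mR * mR] K.
  apply: measurable_fun_ifT.
  - exact: (measurable_fun_ler measurable_snd measurable_fst).
  - by apply: measurable_funM; [exact: (measurableT_comp mpI measurable_fst)
      |exact: (measurableT_comp mfI measurable_snd)].
  - exact: measurable_cst.
have mEK : measurable_fun [set: mR * mR] (EFin \o K) by exact/measurable_EFinP.
(* Dropping the condition $t\le x$ bounds the iterated integral of $|K|$ by the product of two $L^1$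
   norms. *)
have iK : (mu \x mu)%E.-integrable [set: mR * mR] (EFin \o K).
  apply/(integrable12ltyP mu mu mEK).
  have /integrableP[_ Loo] := ifI; set L := (X in (X < +oo)%E) in Loo.
  have L0 : (0 <= L)%E by exact: integral_ge0.
  have LE : L = (fine L)%:E by rewrite fineK// ge0_fin_numE.
  have /integrableP[_ poo] := ipI.
  apply: (@le_lt_trans _ _ (\int[mu]_x (L * `|(EFin \o pI) x|))%E); last first.
    by rewrite LE ge0_integralZl ?lte_mul_pinfty ?lee_fin ?fine_ge0//;
      do 2 apply: measurableT_comp => //.
  apply: ge0_le_integral => //.
  - by move=> x _; exact: integral_ge0.
  - apply: (measurable_fun_fubini_tonelli_F (abse \o (EFin \o K))) => //=.
    exact: measurableT_comp.
  - apply: emeasurable_funM; [exact: measurable_cst|by do 2 apply: measurableT_comp => //].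
  move=> x _; rewrite muleC -ge0_integralZl//; last by do 2 apply: measurableT_comp => //.
  apply: ge0_le_integral => //.
  - apply: (@measurableT_comp _ _ _ _ _ _ (abse)) => //.
    exact: (measurable_fun_pair2 x mEK).
  - apply: emeasurable_funM; [exact: measurable_cst|by do 2 apply: measurableT_comp => //].
  move=> t _; rewrite /K /=; case: ifP => _; first by rewrite normrM EFinM.
  by rewrite normr0 -EFinM lee_fin mulr_ge0.
have := Fubini iK.
have -> : (\int[mu]_x \int[mu]_y (EFin \o K) (x, y))%E =
    (\int[mu]_(x in I01) (phi x * \int[mu]_(t in `[0, x]) f t)%:E)%E.
  rewrite [RHS]integral_mkcond; apply: eq_integral => x _; rewrite patchE.
  case: ifPn => xI; last first.
    apply: integral0_eq => t _; rewrite /K /= /pI patchE (negbTE xI) mul0r.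
    by case: ifP.
  have x01 : 0 <= x <= 1 by move: xI; rewrite inE /= in_itv/=.
  have sub : `[0, x] `<=` I01.
    by move=> t /=; rewrite !in_itv/= => /andP[-> /le_trans]; apply; case/andP: x01.
  have fx : mu.-integrable (`[0, x] : set mR) (EFin \o f) by exact: integrableS fi.
  rewrite EFinM -EFin_Rintegral// -integralZl// [RHS]integral_mkcond.
  apply: eq_integral => t _; rewrite patchE /K /= /pI patchE xI.
  case: (boolP (_ \in _)) => [|/negP tx]; last first.
    case: ifP => // tx'; rewrite /fI patchE; case: ifPn => [|_]; rewrite ?mulr0//.
    rewrite inE/= in_itv/= => /andP[t0 _]; case: tx; apply: mem_set.
    by rewrite /= in_itv/= t0.
  rewrite inE/= in_itv/= => /andP[t0 tx]; rewrite tx /fI patchE mem_set ?EFinM//=.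
  by rewrite in_itv/= t0 (le_trans tx)//; case/andP: x01.
have -> : (\int[mu]_y \int[mu]_x (EFin \o K) (x, y))%E =
    (\int[mu]_(t in I01) (f t * \int[mu]_(x in `[t, 1]) phi x)%:E)%E.
  rewrite [RHS]integral_mkcond; apply: eq_integral => t _; rewrite patchE.
  case: ifPn => tI; last first.
    apply: integral0_eq => x _; rewrite /K /= /fI patchE (negbTE tI) mulr0.
    by case: ifP.
  have t01 : 0 <= t <= 1 by move: tI; rewrite inE /= in_itv/=.
  have sub : `[t, 1] `<=` I01.
    move=> x /=; rewrite !in_itv/= => /andP[tx ->]; rewrite andbT.
    by apply: le_trans tx; case/andP: t01.
  have px : mu.-integrable (`[t, 1] : set mR) (EFin \o phi) by exact: integrableS iphi.
  rewrite EFinM -EFin_Rintegral// -integralZl// [RHS]integral_mkcond.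
  apply: eq_integral => x _; rewrite patchE /K /= /fI patchE tI.
  case: (boolP (_ \in _)) => [|/negP tx]; last first.
    case: ifP => // tx'; rewrite /pI patchE; case: ifPn => [|_]; rewrite ?mul0r//.
    rewrite inE/= in_itv/= => /andP[_ x1]; case: tx; apply: mem_set.
    by rewrite /= in_itv/= tx'.
  rewrite inE/= in_itv/= => /andP[tx x1]; rewrite tx /pI patchE mem_set ?EFinM 1?muleC//=.
  by rewrite in_itv/= x1 andbT (le_trans _ tx)//; case/andP: t01.
by rewrite /Rintegral => ->.
Qed.

End Primitive.

Section FourierPrimitive.
Context {R : realType}.
Local Notation mu := (@lebesgue_measure R).
Local Notation mR := (measurableTypeR R).
Local Notation Re := (@complex.Re R).
Local Notation Im := (@complex.Im R).
Local Notation I01 := (`[(0 : R), 1]%classic : set mR).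

Lemma integrableM_bounded (D : set mR) (f h : R -> R) (M : R) : measurable D ->
  measurable_fun D h -> (forall x, D x -> `|h x| <= M) ->
  mu.-integrable D (EFin \o f) -> mu.-integrable D (EFin \o (fun x => f x * h x)).
Proof.
move=> mD mh hM fi; have iM := integrableZl mD M fi.
apply: le_integrable iM => //.
  apply/measurable_EFinP; apply: measurable_funM => //.
  by apply/measurable_EFinP; exact: (measurable_int mu).
move=> x Dx; rewrite /= lee_fin mulrC !normrM ler_wpM2r//.
by rewrite (le_trans (hM x Dx))// ler_norm.
Qed.

Lemma measurable_primitive (f : R -> R) : mu.-integrable I01 (EFin \o f) ->
  measurable_fun I01 (fun x => \int[mu]_(t in `[0, x]) f t).
Proof.
move=> fi; apply: subspace_continuous_measurable_fun => //.
exact: (parameterized_integral_continuous ler01 fi).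
Qed.

Lemma subitv0x (x : R) : x <= 1 -> `[0, x]%classic `<=` I01.
Proof. by move=> x1 t /=; rewrite !in_itv/= => /andP[-> /le_trans]; apply. Qed.

Lemma primitive_bounded (f : R -> R) (x : R) : mu.-integrable I01 (EFin \o f) ->
  x <= 1 -> `|\int[mu]_(t in `[0, x]) f t| <= \int[mu]_(t in `[0, 1]) `|f t|.
Proof.
move=> fi x1; have sub := subitv0x x1.
have mI : measurable I01 by [].
have fx : mu.-integrable (`[0, x] : set mR) (EFin \o f) by exact: integrableS fi.
apply: le_trans (le_normr_Rintegral _ fx) _ => //.
rewrite -lee_fin -!EFin_Rintegral//; last 2 first.
- exact: (integrable_norm fi).
- exact: (integrable_norm fx).
apply: ge0_subset_integral => //.
apply/measurable_EFinP; apply: measurableT_comp => //.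
by apply/measurable_EFinP; exact: (measurable_int mu).
Qed.

Lemma cmeasurable_primitive (g : R -> R[i]) : cintegrable I01 g ->
  cmeasurable I01 (fun x => cintegral `[0, x] g).
Proof. by move=> [r i]; split; exact: measurable_primitive. Qed.

(** Splits a complex product so that the real identity [Rintegral_primitive_mul] can be applied to
    each of four integrals. *)
Lemma cintegralM (D : set mR) (p q : R -> R[i]) : measurable D ->
  mu.-integrable D (EFin \o (fun x => Re (p x) * Re (q x))) ->
  mu.-integrable D (EFin \o (fun x => Im (p x) * Im (q x))) ->
  mu.-integrable D (EFin \o (fun x => Re (p x) * Im (q x))) ->
  mu.-integrable D (EFin \o (fun x => Im (p x) * Re (q x))) ->
  cintegral D (fun x => p x * q x) =
    (\int[mu]_(x in D) (Re (p x) * Re (q x)) - \int[mu]_(x in D) (Im (p x) * Im (q x)))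
    +i* (\int[mu]_(x in D) (Re (p x) * Im (q x)) + \int[mu]_(x in D) (Im (p x) * Re (q x))).
Proof.
move=> mD i1 i2 i3 i4; rewrite -RintegralB// -RintegralD// /cintegral.
by congr (_ +i* _); apply: eq_Rintegral => x _; rewrite ?ReM ?ImM.
Qed.

(** By Fubini the coefficient of the primitive is $\int g(t)E(t)\,dt$ with $E(t)=\int_t^1e^{-2\pi
    ikx}dx$, and $2\pi ik\,E(t)=e^{-2\pi ikt}-1$. The constant $-1$ contributes $-\int g=0$. *)
Lemma fourier_primitive (g : R -> R[i]) k : cintegrable I01 g ->
  cintegral `[0, 1] g = 0 ->
  ddx (fourier (fun x => cintegral `[0, x] g)) k = fourier g k.
Proof.
move=> ig g0; have mI : measurable I01 by [].
have [->|k0] := eqVneq k 0.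
  rewrite /ddx freq0 -[0 +i* 0]/(0 : R[i]) mul0r -[LHS]g0.
  by apply: eq_cintegral => x _; rewrite -/(ek 0 x) ek0l mul1r.
have w0 : freq k != 0 :> R by rewrite freq_eq0.
pose E (t : R) := cintegral `[t, 1] (ek k).
have EE t : t <= 1 -> (0 +i* freq k) * E t = ek k t - 1.
  by move=> t1; have := cintegral_ek k t1; rewrite ek1r.
have iw0 : (0 +i* freq k) != 0 :> R[i] by rewrite eq_complex /= eqxx.
have EE' t : I01 t -> E t = (0 +i* freq k)^-1 * (ek k t - 1).
  by rewrite /= in_itv/= => /andP[_ t1]; rewrite -EE// mulKf.
have mE' : cmeasurable I01 (fun t => (0 +i* freq k)^-1 * (ek k t - 1)).
  apply: cmeasurableM; first exact: cmeasurable_cst.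
  by apply: cmeasurableB; [exact: cmeasurable_ek|exact: cmeasurable_cst].
have mE : cmeasurable I01 E.
  have [r i] := mE'; split.
    by apply: eq_measurable_fun r => t; rewrite inE => It; rewrite /comp EE'.
  by apply: eq_measurable_fun i => t; rewrite inE => It; rewrite /comp EE'.
pose M : R := normc (0 +i* freq k)^-1 * 2.
have EM t : I01 t -> normc (E t) <= M.
  move=> It; rewrite EE'// ComplexField.Normc.normcM ler_wpM2l ?normc_ge0//.
  by rewrite (le_trans (normcB _ _))// normc_ek ComplexField.Normc.normc1.
have ErM t : I01 t -> `|Re (E t)| <= M.
  by move=> It; exact: le_trans (Re_le_normc _) (EM t It).
have EiM t : I01 t -> `|Im (E t)| <= M.
  by move=> It; exact: le_trans (Im_le_normc _) (EM t It).
have [gr gi] := ig; have [Er Ei] := mE.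
pose P (x : R) := cintegral `[0, x] g.
have [Pr Pi] : cmeasurable I01 P := cmeasurable_primitive ig.
have kr : continuous (Re \o ek k) by rewrite Re_ek; exact: continuous_cosM.
have ki : continuous (Im \o ek k).
  by rewrite Im_ek => x; apply: cvgN; exact: continuous_sinM.
have ikr : mu.-integrable I01 (EFin \o (Re \o ek k)).
  by apply: continuous_compact_integrable; [exact: segment_compact|exact: continuous_subspaceT].
have iki : mu.-integrable I01 (EFin \o (Im \o ek k)).
  by apply: continuous_compact_integrable; [exact: segment_compact|exact: continuous_subspaceT].
have PrM t : I01 t -> `|Re (P t)| <= \int[mu]_(t in `[0, 1]) `|Re (g t)|.
  by rewrite /= in_itv/= => /andP[_ t1]; exact: primitive_bounded.
have PiM t : I01 t -> `|Im (P t)| <= \int[mu]_(t in `[0, 1]) `|Im (g t)|.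
  by rewrite /= in_itv/= => /andP[_ t1]; exact: primitive_bounded.
rewrite /ddx -/P; have -> : fourier P k = cintegral I01 (fun t => g t * E t).
  have i1 : mu.-integrable I01 (EFin \o (fun x => Re (ek k x) * Re (P x))).
    exact: (integrableM_bounded mI Pr PrM ikr).
  have i2 : mu.-integrable I01 (EFin \o (fun x => Im (ek k x) * Im (P x))).
    exact: (integrableM_bounded mI Pi PiM iki).
  have i3 : mu.-integrable I01 (EFin \o (fun x => Re (ek k x) * Im (P x))).
    exact: (integrableM_bounded mI Pi PiM ikr).
  have i4 : mu.-integrable I01 (EFin \o (fun x => Im (ek k x) * Re (P x))).
    exact: (integrableM_bounded mI Pr PrM iki).
  have j1 : mu.-integrable I01 (EFin \o (fun t => Re (g t) * Re (E t))).
    exact: (integrableM_bounded mI Er ErM gr).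
  have j2 : mu.-integrable I01 (EFin \o (fun t => Im (g t) * Im (E t))).
    exact: (integrableM_bounded mI Ei EiM gi).
  have j3 : mu.-integrable I01 (EFin \o (fun t => Re (g t) * Im (E t))).
    exact: (integrableM_bounded mI Ei EiM gr).
  have j4 : mu.-integrable I01 (EFin \o (fun t => Im (g t) * Re (E t))).
    exact: (integrableM_bounded mI Er ErM gi).
  have F1 : \int[mu]_(x in I01) (Re (ek k x) * Re (P x)) =
    \int[mu]_(t in I01) (Re (g t) * Re (E t)) := Rintegral_primitive_mul gr kr.
  have F2 : \int[mu]_(x in I01) (Im (ek k x) * Im (P x)) =
    \int[mu]_(t in I01) (Im (g t) * Im (E t)) := Rintegral_primitive_mul gi ki.
  have F3 : \int[mu]_(x in I01) (Re (ek k x) * Im (P x)) =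
    \int[mu]_(t in I01) (Im (g t) * Re (E t)) := Rintegral_primitive_mul gi kr.
  have F4 : \int[mu]_(x in I01) (Im (ek k x) * Re (P x)) =
    \int[mu]_(t in I01) (Re (g t) * Im (E t)) := Rintegral_primitive_mul gr ki.
  rewrite (cintegralM mI j1 j2 j3 j4) -F1 -F2 -F3 -F4 [X in _ +i* X]addrC.
  exact: (cintegralM mI i1 i2 i3 i4).
rewrite -cintegralZ//; last first.
  apply: eq_cintegrable (cintegrableM_bounded mI mE EM ig) => // t _.
  by rewrite mulrC.
transitivity (cintegral I01 (fun t => ek k t * g t - g t)).
  apply: eq_cintegral => t; rewrite inE /= in_itv/= => /andP[_ t1].
  by rewrite mulrCA EE// mulrBr mulr1 mulrC.
rewrite cintegralB//; last exact: cintegrable_ekM.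
by rewrite [X in _ - X]g0 subr0.
Qed.

End FourierPrimitive.

(** * Plancherel's inequality *)

Section Plancherel.
Context {R : realType}.
Local Notation mu := (@lebesgue_measure R).
Local Notation mR := (measurableTypeR R).
Local Notation Re := (@complex.Re R).
Local Notation Im := (@complex.Im R).
Local Notation I01 := (`[(0 : R), 1]%classic : set mR).

(** Lebesgue differentiation is applied to the restriction of [f] to $[0,1]$, whose averages on
    small balls around an interior point are those of [f]. *)
Lemma ae_derive_primitive (f : R -> R) : mu.-integrable I01 (EFin \o f) ->
  {ae mu, forall x : R, 0 < x < 1 ->
     is_derive x 1 (fun y : R => \int[mu]_(t in `[0, y]) f t) (f x)}.
Proof.
move=> fi; have mI : measurable I01 by [].
have := lebesgue_differentiation (integrable_locally mI fi).
apply: filterS; first exact: (ae_filter_ringOfSetsType mu).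
move=> x fx /andP[x0 x1].
have {}fx : lebesgue_pt f x.
  apply: cvg_trans fx; apply: near_eq_cvg.
  have x0' : (BLeft (0%R : R) < BRight x)%E by rewrite lte_fin.
  have nd := near_davg f x1 x0'.
  by near=> r; apply/esym; near: r; exact: nd.
have x0' : (BLeft (0%R : R) < BRight x)%E by rewrite lte_fin.
have [dF F'] := FTC1_lebesgue_pt x1 fi x0' fx.
by split; [exact: dF|rewrite -F' derive1E].
Unshelve. all: by end_near. Qed.

(** Closer to $x$ than some $r$ the difference quotient is within 1 of the derivative; farther away
    $2M\le(2M/r)|y-x|$. This supplies the hypothesis of [fourier_pointwise_cvg]. *)
Lemma derive_lipschitz_at (F : R -> R) (x l M : R) : is_derive x 1 F l ->
  (forall y, 0 <= y <= 1 -> `|F y| <= M) -> 0 <= x <= 1 ->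
  exists C, forall y, 0 <= y <= 1 -> `|F y - F x| <= C * `|y - x|.
Proof.
move=> [dF _] FM x01.
have M0 : 0 <= M by apply: le_trans (FM x x01).
have /cvgrPdist_le /(_ 1 ltr01) := dF.
rewrite /derivable; set L := lim _ => nr.
have [r /= r0 {}nr] := nr.
exists (Num.max (`|L| + 1) (2 * M / r)) => y y01.
have [->|yx] := eqVneq y x; first by rewrite !subrr normr0 mulr0.
have yx0 : 0 < `|y - x| by rewrite normr_gt0 subr_eq0.
have [yr|yr] := ltP `|y - x| r.
  apply: (@le_trans _ _ ((`|L| + 1) * `|y - x|)); last first.
    by rewrite ler_wpM2r// le_max lexx.
  have := nr (y - x); rewrite /ball_ /= sub0r normrN subr_eq0 => /(_ yr yx).
  rewrite /GRing.scale /= mulr1 subrK => h.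
  have : `|(y - x)^-1 * (F y - F x)| <= `|L| + 1.
    rewrite -[X in `|X|](subKr L) (le_trans (ler_normB _ _))//.
    by rewrite lerD2l.
  by rewrite normrM normfV ler_pdivrMl// mulrC.
apply: (@le_trans _ _ (2 * M / r * `|y - x|)); last first.
  by rewrite ler_wpM2r// le_max lexx orbT.
rewrite (le_trans (ler_normB _ _))//.
apply: (@le_trans _ _ (2 * M)).
  by have := FM y y01; have := FM x x01; lra.
by rewrite mulrAC ler_pdivlMr// ler_wpM2l// mulr_ge0.
Qed.

Lemma cvg_normc (u : nat -> R[i]) (l : R[i]) :
  normc (u n - l) @[n --> \oo] --> (0 : R) ->
  normc (u n) ^+ 2 @[n --> \oo] --> normc l ^+ 2.
Proof.
move=> ul.
have c : normc (u n) @[n --> \oo] --> normc l.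
  apply/cvgrPdist_le => e e0; move/cvgrPdist_le : ul => /(_ e e0).
  apply: filterS => n; rewrite sub0r normrN ger0_norm ?normc_ge0//.
  apply: le_trans; rewrite ler_norml; apply/andP; split.
    rewrite lerNl opprB lerBlDr -[X in normc X <= _](subrK l).
    exact: normcD.
  rewrite lerBlDr addrC -[X in normc X <= _](subKr (u n)).
  exact: normcB.
rewrite [X in _ --> X]expr2; under eq_fun do rewrite expr2.
exact: cvgM.
Qed.

Lemma cvg_diff_quotient (F : R -> R) (x l : R) (h : nat -> R) : is_derive x 1 F l ->
  h n @[n --> \oo] --> (0 : R) -> (forall n, h n != 0) ->
  (h n)^-1 * (F (x + h n) - F x) @[n --> \oo] --> l.
Proof.
move=> [dF dFl] h0 hn0; have := dF; rewrite /derivable => cF.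
have c : (fun y => y^-1 *: (F (y *: 1 + x) - F x)) y @[y --> 0^'] --> l.
  by rewrite -dFl; exact: cF.
have h0' : h n @[n --> \oo] --> 0^'.
  move=> A /= [e /= e0 eA].
  move/cvgrPdist_lt : h0 => /(_ e e0); apply: filterS => n hn.
  by apply: eA => //=; exact: hn0.
rewrite (_ : (fun n => _) = (fun y => y^-1 *: (F (y *: 1 + x) - F x)) \o h).
  exact: cvg_comp h0' c.
by apply/funext => n /=; rewrite /GRing.scale /= mulr1 [h n + x]addrC.
Qed.

Lemma ae_neq (p : R) : {ae mu, forall x : R, x != p}.
Proof.
exists [set p]; split; [exact: measurable_set1|exact: lebesgue_measure_set1|].
by move=> x /= /negP; rewrite negbK => /eqP.
Qed.

(** Subtracting the mean [c] makes the primitive [G] take equal values at 0 and 1. The coefficients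
    of its difference quotient are those of [g] damped by $(e^{2\pi ikh}-1)/(2\pi ikh)$, of modulus
    at most 1, so the bound [B] is inherited uniformly in $h$. The limits are taken in the partial
    sums for fixed $h$, then in $h\to0$. *)
Lemma plancherel_le (g : R -> R[i]) (B : R) : cintegrable I01 g ->
  (forall X, uniq X -> \sum_(k <- X) normc (fourier g k) ^+ 2 <= B) ->
  (\int[mu]_(x in I01) (normc (g x) ^+ 2)%:E <= B%:E)%E.
Proof.
move=> ig gB; have mI : measurable I01 by [].
pose c := cintegral `[0, 1] g.
have cE : c = fourier g 0.
  by apply: eq_cintegral => x _; rewrite -/(ek 0 x) ek0l mul1r.
have aeF : Filter (nbhs (almost_everywhere mu)) := ae_filter_ringOfSetsType mu.
pose g0 x := g x - c.
have ig0 : cintegrable I01 g0 by apply: cintegrableB => //; exact: cintegrable_cst01.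
have g00 : cintegral `[0, 1] g0 = 0.
  by rewrite cintegralB ?cintegral_cst01 ?subrr//; exact: cintegrable_cst01.
have g0E k : k != 0 -> fourier g0 k = fourier g k.
  move=> k0; rewrite fourierB//; last exact: cintegrable_cst01.
  have -> : fourier (fun=> c) k = c * fourier (fun=> 1) k.
    rewrite -fourierZ; last exact: cintegrable_cst01.
    by congr fourier; apply/funext => x; rewrite mulr1.
  by rewrite fourier1 (negbTE k0) mulr0 subr0.
pose G (x : R) := cintegral `[0, x] g0.
have mG : cmeasurable I01 G := cmeasurable_primitive ig0.
have [ir ii] := ig0.
pose good (x : R) := is_derive x 1 (fun y : R => Re (G y)) (Re (g0 x)) /\
  is_derive x 1 (fun y : R => Im (G y)) (Im (g0 x)).
have good_ae : {ae mu, forall x : R, 0 < x < 1 -> good x}.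
  have a1 := ae_derive_primitive ir; have a2 := ae_derive_primitive ii.
  apply: (@filterS2 _ _ (ae_filter_ringOfSetsType mu) _ _ _ _ a1 a2).
  by move=> x h1 h2 x01; split; [exact: h1|exact: h2].
have good_cvg x : 0 < x < 1 -> good x ->
    normc (trig (zrange N) (fourier G) x - G x) @[N --> \oo] --> (0 : R).
  move=> x01 [Gr Gi].
  have x01' : 0 <= x <= 1 by case/andP: x01 => ? ?; apply/andP; split; exact: ltW.
  have [C1 HC1] := derive_lipschitz_at Gr
    (fun y yI => primitive_bounded ir (proj2 (andP yI))) x01'.
  have [C2 HC2] := derive_lipschitz_at Gi
    (fun y yI => primitive_bounded ii (proj2 (andP yI))) x01'.
  apply: (@fourier_pointwise_cvg _ _ _ (C1 + C2)) => // y y01.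
  rewrite mulrDl (le_trans (normc_le _))// lerD//.
    by have := HC1 y y01; case: (G y) (G x) => a b [a' b'].
  by have := HC2 y y01; case: (G y) (G x) => a b [a' b'].
(* Coefficients of the difference quotient of the periodic extension of [G], with the mean [c]
   restored. *)
pose a (h : R) (k : int) : R[i] := (if k == 0 then c else 0)
  + (h^-1)%:C * (fourier G k * (ek (- k) h - 1)).
have aB h k : 0 < h -> normc (a h k) <= normc (fourier g k).
  move=> h0; rewrite /a; have [->|k0] := eqVneq k 0.
    by rewrite oppr0 ek0l subrr !mulr0 addr0 cE.
  rewrite add0r.
  have d1 : (0 +i* freq k) * fourier G k = fourier g k.
    by rewrite -g0E// -(fourier_primitive k ig0 g00).
  (* Writing $e^{2\pi ikh}-1$ as $2\pi ik$ times an integral over $[0,h]$ of a function of modulus 1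
     gives the bound $h$ that cancels $h^{-1}$. *)
  have d2 : ek (- k) h - 1 = (0 +i* freq k) * cintegral `[0, h] (ek (- k)).
    have := cintegral_ek (- k) (ltW h0); rewrite /ddx freqN ek0r => d.
    rewrite -[LHS]opprB -d; set J := cintegral _ _.
    by case: J => p q; apply/eqP; rewrite eq_complex /=; apply/andP; split; apply/eqP; ring.
  rewrite d2 [fourier G k * _]mulrA [fourier G k * _]mulrC d1.
  rewrite !ComplexField.Normc.normcM normc_real ger0_norm ?invr_ge0 ?(ltW h0)//.
  rewrite mulrCA -[leRHS]mulr1 ler_wpM2l ?normc_ge0// ler_pdivrMl// mulr1.
  have mh : measurable (`[0, h] : set mR) by [].
  have hoo : (mu `[0%R, h] < +oo)%E by rewrite lebesgue_measure_itv/= lte_fin h0 -EFinB ltry.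
  have ie : cintegrable (`[0, h] : set mR) (ek (- k)).
    apply: (@cintegrable_bounded _ _ _ 1) => //; first exact: cmeasurable_ek.
    by move=> x _; rewrite normc_ek.
  apply: le_trans (normc_cintegral mh ie) _.
  under eq_Rintegral do rewrite normc_ek.
  rewrite Rintegral_cst// mul1r.
  have -> : fine (mu `[0%R, h]) = h by rewrite lebesgue_measure_itv/= lte_fin h0 -EFinB /= subr0.
  exact: lexx.
pose A (h x : R) : R[i] := c + (h^-1)%:C * (G (x + h) - G x).
have trigA h N x : trig (zrange N) (a h) x =
    c + (h^-1)%:C * (trig (zrange N) (fourier G) (x + h) - trig (zrange N) (fourier G) x).
  rewrite /trig /a.
  under eq_bigr do rewrite mulrDl.
  rewrite big_split /=; congr (_ + _).
    rewrite (bigD1_seq 0) ?mem_zrange ?zrange_uniq//= oppr0 ek0l mulr1.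
    by rewrite big1 ?addr0// => k /negbTE ->; rewrite mul0r.
  rewrite -sumrB big_distrr /=; apply: eq_bigr => k _; rewrite ekDr; ring.
(* The point $x+h$ has to stay in $[0,1]$, where the series of [G] is known to converge to [G]. *)
have subh h : 0 < h < 1 -> `[0, 1 - h] `<=` I01.
  by move=> /andP[h0 h1] x /=; rewrite !in_itv/= => /andP[-> xh]/=; lra.
have mA h : 0 < h < 1 -> cmeasurable (`[0, 1 - h] : set mR) (A h).
  move=> h01; have sub := subh h h01; move: h01 => /andP[h0 h1].
  have mDh : measurable (`[0, 1 - h] : set mR) by [].
  apply: cmeasurableD; first exact: cmeasurable_cst.
  apply: cmeasurableM; first exact: cmeasurable_cst.
  have [Gr Gi] := mG; apply: cmeasurableB; last first.
    by split; [exact: measurable_funS Gr|exact: measurable_funS Gi].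
  have sub' : `[0, 1 - h]%classic `<=` (`[(0 - h), (1 - h)]%classic : set mR).
    by move=> x /=; rewrite !in_itv/= => /andP[x0 ->]; rewrite andbT; lra.
  have mS : measurable (`[0 - h, 1 - h] : set mR) by [].
  split.
    exact: (measurable_funS mS sub' (measurable_fun_shift (a := h) Gr)).
  exact: (measurable_funS mS sub' (measurable_fun_shift (a := h) Gi)).
have step1 h : 0 < h < 1 ->
    (\int[mu]_(x in `[0%R, (1 - h)%R]) (normc (A h x) ^+ 2)%:E <= B%:E)%E.
  move=> h01; have mAh := mA h h01; have sub := subh h h01; move: h01 => /andP[h0 h1].
  have mDh : measurable (`[0, 1 - h] : set mR) by [].
  apply: (@fatou_bound _ _ (fun N x => normc (trig (zrange N) (a h) x) ^+ 2)) => //.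
  - by move=> N; apply: measurable_normc_sqr; exact: cmeasurable_trig.
  - exact: measurable_normc_sqr.
  - by move=> N x; exact: sqr_ge0.
  - by move=> x; exact: sqr_ge0.
  - have bd := @filterS2 _ _ aeF _ _ _ (fun x h1 h2 => conj h1 h2) (ae_neq 0) (ae_neq (1 - h)).
    have gs := @filterS2 _ _ aeF _ _ _ (fun x h1 h2 => conj h1 h2) good_ae (ae_shift h good_ae).
    apply: (@filterS2 _ _ aeF _ _ _ _ bd gs) => x [x0 xh] [gx gxh].
    move=> Ix; have /andP[x0' xh'] : 0 <= x <= 1 - h by move: Ix; rewrite /= in_itv.
    have {x0'}x0 : 0 < x by rewrite lt_neqAle eq_sym x0.
    have {xh'}xh : x < 1 - h by rewrite lt_neqAle xh.
    have x01 : 0 < x < 1 by apply/andP; split; lra.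
    have xh01 : 0 < x + h < 1 by apply/andP; split; lra.
    have c1 := good_cvg _ x01 (gx x01); have c2 := good_cvg _ xh01 (gxh xh01).
    apply: (@cvg_normc (fun N => trig (zrange N) (a h) x)).
    apply: (@squeeze_cvgr _ _ _ _ (cst 0) (fun N => h^-1 *
       (normc (trig (zrange N) (fourier G) (x + h) - G (x + h))
        + normc (trig (zrange N) (fourier G) x - G x)))).
    + apply: nearW => N; rewrite normc_ge0/= trigA /A opprD addrACA subrr add0r -mulrBr.
      rewrite ComplexField.Normc.normcM normc_real ger0_norm ?invr_ge0 ?(ltW h0)//.
      rewrite ler_wpM2l ?invr_ge0 ?(ltW h0)//.
      have -> : trig (zrange N) (fourier G) (x + h) - trig (zrange N) (fourier G) x
          - (G (x + h) - G x)
        = (trig (zrange N) (fourier G) (x + h) - G (x + h))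
          - (trig (zrange N) (fourier G) x - G x) by ring.
      exact: normcB.
    + exact: cvg_cst.
    + rewrite -[X in _ --> X](mulr0 h^-1) -[in X in _ --> X](addr0 0).
      by apply: cvgM; [exact: cvg_cst|exact: cvgD].
  - move=> N; have it := integrable_trig_sqr (zrange N) (a h).
    apply: (@le_trans _ _ (\int[mu]_(x in I01) (normc (trig (zrange N) (a h) x) ^+ 2)%:E)%E).
      apply: ge0_subset_integral => //; first exact: (measurable_int mu).
      by move=> x _; rewrite lee_fin sqr_ge0.
    rewrite EFin_Rintegral// lee_fin Rintegral_trig_sqr ?zrange_uniq//.
    apply: le_trans (gB _ (zrange_uniq N)); apply: ler_sum => k _.
    by rewrite ler_sqr ?nnegrE ?normc_ge0 ?aB.
(* The shift by 2 keeps every step strictly between 0 and 1. *)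
pose h n : R := n.+2%:R^-1.
have h0 n : 0 < h n by rewrite invr_gt0 ltr0n.
have h1 n : h n < 1 by rewrite invf_lt1 ?ltr1n ?ltr0n.
have hcvg : h n @[n --> \oo] --> (0 : R).
  have := @cvg_harmonic R; rewrite -(cvg_shiftS _).
  by apply: cvg_trans; apply: near_eq_cvg; apply: nearW => n.
(* Cut off to have a fixed domain; each $x<1$ lies in $[0,1-h_n]$ for large $n$, so the limit is
   unaffected. *)
pose F n := (fun x => normc (A (h n) x) ^+ 2) \_ `[0, 1 - h n].
apply: (@fatou_bound _ I01 F) => //.
- move=> n; have h01 : 0 < h n < 1 by rewrite h0 h1.
  apply: (measurable_restrict _ _ _).1 => //.
  rewrite setIidr; last exact: subh.
  by apply: measurable_normc_sqr; exact: mA.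
- by apply: measurable_normc_sqr; exact: cintegrable_measurable.
- by move=> n x; rewrite /F patchE; case: ifP => // _; exact: sqr_ge0.
- by move=> x; exact: sqr_ge0.
- have bd := @filterS2 _ _ aeF _ _ _ (fun x h1 h2 => conj h1 h2) (ae_neq 0) (ae_neq 1).
  apply: (@filterS2 _ _ aeF _ _ _ _ bd good_ae) => x [x0 x1] gx.
  move=> Ix; have /andP[x0' x1'] : 0 <= x <= 1 by move: Ix; rewrite /= in_itv.
  have {x0'}x0 : 0 < x by rewrite lt_neqAle eq_sym x0.
  have {x1'}x1 : x < 1 by rewrite lt_neqAle x1.
  have x01 : 0 < x < 1 by rewrite x0 x1.
  have [Gr Gi] := gx x01.
  have cr := cvg_diff_quotient Gr hcvg (fun n => lt0r_neq0 (h0 n)).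
  have ci := cvg_diff_quotient Gi hcvg (fun n => lt0r_neq0 (h0 n)).
  have cA : normc (A (h n) x) ^+ 2 @[n --> \oo] --> normc (g x) ^+ 2.
    apply: (@cvg_normc (fun n => A (h n) x)).
    apply: (@squeeze_cvgr _ _ _ _ (cst 0) (fun n =>
      `|(h n)^-1 * (Re (G (x + h n)) - Re (G x)) - Re (g0 x)|
      + `|(h n)^-1 * (Im (G (x + h n)) - Im (G x)) - Im (g0 x)|)).
    + apply: nearW => n; rewrite normc_ge0 andTb /A.
      have -> : c + ((h n)^-1)%:C * (G (x + h n) - G x) - g x =
          ((h n)^-1)%:C * (G (x + h n) - G x) - g0 x by rewrite /g0; ring.
      apply: le_trans (normc_le _) _.
      move: (G (x + h n)) (G x) (g0 x) => [p q] [p' q'] [r s] /=.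
      by rewrite !mul0r subr0 addr0.
    + exact: cvg_cst.
    + rewrite -[X in _ --> X](addr0 0); apply: cvgD.
        by rewrite -(normr0 R) -(subrr (Re (g0 x))); apply: cvg_norm; apply: cvgB => //; exact: cvg_cst.
      by rewrite -(normr0 R) -(subrr (Im (g0 x))); apply: cvg_norm; apply: cvgB => //; exact: cvg_cst.
  move: cA; apply: cvg_trans; apply: near_eq_cvg.
  move/cvgrPdist_lt : hcvg => /(_ (1 - x)); rewrite subr_gt0 => /(_ x1).
  apply: filterS => n; rewrite sub0r normrN gtr0_norm// => hn.
  rewrite /F patchE mem_set//= in_itv/= (ltW x0)/=; lra.
- move=> n; rewrite /F.
  have h01 : 0 < h n < 1 by rewrite h0 h1.
  apply: le_trans (step1 (h n) h01).
  rewrite -[X in (_ <= integral _ X _)%E](setIidr (subh (h n) h01)) integral_mkcondr.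
  by rewrite restrict_EFin.
Qed.

End Plancherel.

(** * Sobolev norms *)

Section FiniteSums.
Context {R : realType}.

Lemma cauchy_schwarz_seq (I : Type) (r : seq I) (x y : I -> R) :
  (\sum_(i <- r) x i * y i) ^+ 2 <= (\sum_(i <- r) x i ^+ 2) * (\sum_(i <- r) y i ^+ 2).
Proof.
elim: r => [|i r IH]; first by rewrite !big_nil expr0n mulr0.
rewrite !big_cons; set s := \sum_(j <- r) _ in IH *.
have X0 : 0 <= \sum_(j <- r) x j ^+ 2 by apply: sumr_ge0 => j _; exact: sqr_ge0.
have Y0 : 0 <= \sum_(j <- r) y j ^+ 2 by apply: sumr_ge0 => j _; exact: sqr_ge0.
move: X0 Y0 IH; set X := \sum_(j <- r) x j ^+ 2; set Y := \sum_(j <- r) y j ^+ 2.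
move=> X0 Y0 IH.
(* Compare squares: $s^2\le XY$ by induction, and the square of the right side minus $4XYx_i^2y_i^2$
   is $(Xy_i^2-Yx_i^2)^2$. *)
suff : 2 * (s * (x i * y i)) <= X * y i ^+ 2 + Y * x i ^+ 2 by nra.
set T := X * y i ^+ 2 + Y * x i ^+ 2.
have T0 : 0 <= T by rewrite addr_ge0// mulr_ge0// sqr_ge0.
rewrite leNgt; apply/negP => lt.
have : T ^+ 2 < (2 * (s * (x i * y i))) ^+ 2 by rewrite ltr_sqr ?nnegrE// ltW// (le_lt_trans T0).
apply/negP; rewrite -leNgt.
apply: (@le_trans _ _ (4 * (X * Y) * (x i * y i) ^+ 2)).
  have -> : (2 * (s * (x i * y i))) ^+ 2 = 4 * s ^+ 2 * (x i * y i) ^+ 2 by ring.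
  by rewrite ler_wpM2r ?sqr_ge0// ler_wpM2l.
rewrite -subr_ge0.
have -> : T ^+ 2 - 4 * (X * Y) * (x i * y i) ^+ 2
   = (X * y i ^+ 2 - Y * x i ^+ 2) ^+ 2 by rewrite /T; ring.
exact: sqr_ge0.
Qed.

Lemma cauchy_schwarz_le (I : Type) (r : seq I) (x y : I -> R) (a b : R) :
  0 <= a -> 0 <= b -> \sum_(i <- r) x i ^+ 2 <= a ^+ 2 ->
  \sum_(i <- r) y i ^+ 2 <= b ^+ 2 -> \sum_(i <- r) x i * y i <= a * b.
Proof.
move=> a0 b0 xa yb; rewrite (le_trans (ler_norm _))//.
rewrite -ler_sqr ?nnegrE ?mulr_ge0// real_normK ?num_real// exprMn.
apply: le_trans (cauchy_schwarz_seq _ _ _) _; apply: ler_pM => //;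
  by apply: sumr_ge0 => j _; exact: sqr_ge0.
Qed.

Lemma ler_sum_subset (I : eqType) (X Y : seq I) (f : I -> R) :
  uniq X -> uniq Y -> {subset X <= Y} -> (forall i, 0 <= f i) ->
  \sum_(i <- X) f i <= \sum_(i <- Y) f i.
Proof.
move=> uX uY XY f0; have p : perm_eq X [seq y <- Y | y \in X].
  apply: uniq_perm => //; first exact: filter_uniq.
  by move=> i; rewrite mem_filter; case: (boolP (i \in X)) => // /XY ->.
rewrite (perm_big _ p) /= big_filter [leRHS](bigID (mem X)) /= lerDl.
exact: sumr_ge0.
Qed.

End FiniteSums.

Section SobolevNorm.
Context {R : realType}.
Implicit Types (c d : int -> R[i]) (l a b : R) (X : seq int).

(** $\langle k\rangle^\ell$, the square root of the weight in [Hnorm], so that [Hnorm] is the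
    $\ell^2$ norm of [wnorm]. *)
Definition weight l (k : int) : R := Num.sqrt ((1 + freq k ^+ 2) `^ l).

Lemma freq2_gt0 (k : int) : 0 < 1 + freq k ^+ 2 :> R.
Proof. by rewrite ltr_wpDr// sqr_ge0. Qed.

Lemma weight_sqr l k : weight l k ^+ 2 = (1 + freq k ^+ 2) `^ l.
Proof. by rewrite sqr_sqrtr// powR_ge0. Qed.

Lemma weight_ge0 l k : 0 <= weight l k. Proof. exact: sqrtr_ge0. Qed.

Lemma weight_gt0 l k : 0 < weight l k.
Proof. by rewrite sqrtr_gt0 powR_gt0// freq2_gt0. Qed.

Lemma weight_ge1 l k : 0 <= l -> 1 <= weight l k.
Proof.
move=> l0; rewrite -sqrtr1 ler_wsqrtr//.
have w1 : 1 <= 1 + freq k ^+ 2 :> R by rewrite lerDl sqr_ge0.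
by have := ler_powR w1 l0; rewrite powRr0.
Qed.

(* Peetre's inequality *)
Lemma weightD l j k : 0 <= l ->
  weight l (j + k) <= Num.sqrt (2 `^ l) * (weight l j * weight l k).
Proof.
move=> l0; rewrite /weight -!sqrtrM ?powR_ge0// ler_wsqrtr//.
have f0 i : 0 <= 1 + freq i ^+ 2 :> R by exact/ltW/freq2_gt0.
rewrite -!powRM ?mulr_ge0//.
apply: ge0_ler_powR => //; rewrite ?nnegrE ?mulr_ge0//.
rewrite freqD; set x := freq j; set y := freq k.
have := sqr_ge0 (x - y); have := sqr_ge0 (x * y).
rewrite exprMn; nra.
Qed.

Definition wnorm l c k := weight l k * normc (c k).

Lemma wnorm_ge0 l c k : 0 <= wnorm l c k.
Proof. by rewrite mulr_ge0 ?weight_ge0 ?normc_ge0. Qed.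

(** Turns a bound on the extended-real norm into inequalities between finite real sums, where
    Cauchy-Schwarz is available. *)
Lemma Hnorm_leP l c a : 0 <= a ->
  (Hnorm l c <= a%:E)%E <->
  (forall X, uniq X -> \sum_(k <- X) wnorm l c k ^+ 2 <= a ^+ 2).
Proof.
move=> a0; have -> : a%:E = sqrte (a ^+ 2)%:E by rewrite /= sqrtr_sqr ger0_norm.
rewrite /Hnorm lee_sqrt ?lee_fin ?sqr_ge0//.
have E X : uniq X -> (\sum_(k \in [set` X])
   ((1 + freq k ^+ 2) `^ l * normc (c k) ^+ 2)%:E)%E =
   (\sum_(k <- X) wnorm l c k ^+ 2)%:E.
  move=> uX; rewrite -fsbig_seq// sumEFin; congr (_%:E).
  by apply: eq_bigr => k _; rewrite /wnorm [RHS]exprMn weight_sqr.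
split=> [ca X uX|ca].
  rewrite -lee_fin -E//; apply: le_trans ca.
  apply: ereal_sup_ubound; exists [set` X] => //.
  by split; [exact: finite_seq|exact: subsetT].
apply: ge_ereal_sup => /= _ [A [finA _] <-].
rewrite fsbig_finite// sumEFin lee_fin.
under eq_bigr do rewrite -weight_sqr -exprMn.
by apply: ca; exact: finmap.fset_uniq.
Qed.

Lemma wnorm_le l c a k : 0 <= a -> (Hnorm l c <= a%:E)%E -> wnorm l c k <= a.
Proof.
move=> a0 /(Hnorm_leP _ _ a0) /(_ [:: k] isT).
by rewrite big_seq1 ler_sqr ?nnegrE ?wnorm_ge0.
Qed.

(** Cauchy-Schwarz bounds the cross term. With real bounds in place of the norms, infinite values
    never have to be discussed. *)
Lemma HnormD l c d a b : 0 <= a -> 0 <= b ->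
  (Hnorm l c <= a%:E)%E -> (Hnorm l d <= b%:E)%E ->
  (Hnorm l (fun k => (c k + d k)%R) <= (a + b)%:E)%E.
Proof.
move=> a0 b0 /(Hnorm_leP _ _ a0) ca /(Hnorm_leP _ _ b0) db.
apply/Hnorm_leP => [|X uX]; first exact: addr_ge0.
have cX := ca X uX; have dX := db X uX.
have cs := cauchy_schwarz_le a0 b0 cX dX.
apply: (@le_trans _ _ (\sum_(k <- X) (wnorm l c k ^+ 2 + wnorm l c k * wnorm l d k *+ 2
   + wnorm l d k ^+ 2))).
  apply: ler_sum => k _; rewrite -sqrrD ler_sqr ?nnegrE ?addr_ge0 ?wnorm_ge0//.
  by rewrite /wnorm -mulrDr ler_wpM2l ?weight_ge0// normcD.
have -> : (a + b) ^+ 2 = a ^+ 2 + 2 * (a * b) + b ^+ 2 by ring.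
rewrite !big_split /=; move: cX dX cs; rewrite /wnorm; lra.
Qed.

Lemma HnormN l c : Hnorm l (fun k => - c k) = Hnorm l c.
Proof. by rewrite /Hnorm; under eq_esum do rewrite normcN. Qed.

Lemma eq_Hnorm l c d : c =1 d -> Hnorm l c = Hnorm l d.
Proof. by move=> /funext ->. Qed.

Lemma sum_inv_freq2 : exists2 Z : R, 0 <= Z & forall X, uniq X ->
  \sum_(k <- X) (1 + freq k ^+ 2)^-1 <= Z.
Proof.
pose f (n : nat) : R := (1 + n%:R ^+ 2)^-1.
have f0 n : 0 <= f n by rewrite invr_ge0 addr_ge0 ?sqr_ge0.
have fk (k : int) : (1 + freq k ^+ 2)^-1 <= f `|k|%N.
  rewrite lef_pV2 ?posrE ?freq2_gt0 ?ltr_wpDr ?sqr_ge0// lerD2l.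
  have -> : (`|k|%N%:R : R) ^+ 2 = k%:~R ^+ 2.
    by rewrite natr_absz intr_norm real_normK ?num_real.
  rewrite /freq exprMn ler_peMl ?sqr_ge0//.
  by have := @pi_ge2 R; nra.
(* For $n\ge1$ one has $1/(1+n^2)\le2/(n(n+1))=2/n-2/(n+1)$, which telescopes; the term $f(0)=1$
   fixes the constant 3. *)
have fN N : \sum_(n <- iota 0 N.+1) f n <= 3 - 2 / N.+1%:R.
  elim: N => [|N IH]; first by rewrite big_seq1 /f expr0n addr0 invr1; lra.
  rewrite -addn1 iotaD big_cat big_seq1 /= add0n.
  have -> : 3 - 2 / (N.+1 + 1)%:R = 3 - 2 / N.+1%:R + (2 / N.+1%:R - 2 / (N.+1 + 1)%:R) :> R.
    ring.
  apply: lerD => //; rewrite /f.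
  set x : R := N.+1%:R; have x1 : 1 <= x by rewrite ler1n.
  have -> : (N.+1 + 1)%:R = x + 1 :> R by rewrite natrD.
  have x0 : 0 < x by lra.
  have -> : 2 / x - 2 / (x + 1) = 2 / (x * (x + 1)).
    by field; apply/andP; split; apply: lt0r_neq0; lra.
  rewrite ler_pdivlMr ?mulr_gt0 ?addr_gt0// mulrC ler_pdivrMr ?ltr_wpDr ?sqr_ge0//.
  by nra.
have fB N : \sum_(n <- iota 0 N) f n <= 3.
  case: N => [|N]; first by rewrite big_nil.
  by apply: le_trans (fN N) _; rewrite gerBl divr_ge0.
exists 6 => // X uX.
(* The sum of all $|k|$ dominates each of them, so [X] lies in [Y], the integers from $-N$ to $N-1$.
   Since [Negz n] is $-(n+1)$, the negative half is compared with the sum of [f] from 1 on. *)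
pose N := (\sum_(k <- X) `|k|).+1%N.
pose Y := [seq Posz n | n <- iota 0 N] ++ [seq Negz n | n <- iota 0 N].
have uY : uniq Y.
  rewrite cat_uniq; apply/and3P; split.
  - by rewrite map_inj_uniq ?iota_uniq// => m n [].
  - by apply/hasPn => _ /mapP[n _ ->]; apply/negP => /mapP[].
  - by rewrite map_inj_uniq ?iota_uniq// => m n [].
have XY : {subset X <= Y}.
  move=> k kX; have kN : (`|k| < N)%N.
    by rewrite ltnS (big_rem k)//= leq_addr.
  rewrite mem_cat; case: k kX kN => n nX nN; apply/orP; [left|right];
    apply/mapP; exists n => //; rewrite mem_iota//=.
  by apply: leq_ltn_trans nN; rewrite /= ltnW.
apply: le_trans (ler_sum_subset uX uY XY _) _.
  by move=> k; rewrite invr_ge0 ltW// freq2_gt0.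
apply: (@le_trans _ _ (\sum_(k <- Y) f `|k|%N)); first by apply: ler_sum => k _.
rewrite big_cat !big_map.
have -> : 6 = 3 + 3 :> R by ring.
apply: lerD; first exact: fB.
apply: le_trans (fB N.+1).
have -> : iota 0 N.+1 = 0%N :: [seq n.+1 | n <- iota 0 N].
  by congr (_ :: _); exact: (iotaDl 1 0 N).
by rewrite [leRHS]big_cons big_map lerDr.
Qed.

End SobolevNorm.

(** * The bilinear estimate *)

Section Product.
Context {R : realType}.
Local Notation mu := (@lebesgue_measure R).
Local Notation mR := (measurableTypeR R).
Local Notation Re := (@complex.Re R).
Local Notation Im := (@complex.Im R).
Local Notation I01 := (`[(0 : R), 1]%classic : set mR).
Implicit Types (v w : R -> R[i]) (l a b : R) (k : int).

Lemma Hnorm_plancherel l v a : 0 <= l -> 0 <= a -> cintegrable I01 v ->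
  (Hnorm l (fourier v) <= a%:E)%E ->
  (\int[mu]_(x in I01) (normc (v x) ^+ 2)%:E <= (a ^+ 2)%:E)%E.
Proof.
move=> l0 a0 iv /(Hnorm_leP _ _ a0) va; apply: plancherel_le => // X uX.
apply: le_trans (va X uX); apply: ler_sum => k _.
rewrite ler_sqr ?nnegrE ?wnorm_ge0 ?normc_ge0//.
by rewrite ler_peMl ?normc_ge0 ?weight_ge1.
Qed.

Lemma integrable_normc_sqr v (B : R) : cintegrable I01 v ->
  (\int[mu]_(x in I01) (normc (v x) ^+ 2)%:E <= B%:E)%E ->
  mu.-integrable I01 (EFin \o (fun x => normc (v x) ^+ 2)).
Proof.
move=> iv vB; apply/integrableP; split.
  by apply/measurable_EFinP; apply: measurable_normc_sqr; exact: cintegrable_measurable.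
apply: (@le_lt_trans _ _ B%:E); last exact: ltry.
apply: le_trans vB; rewrite le_eqVlt; apply/orP; left; apply/eqP.
by apply: eq_integral => x _; rewrite /= ger0_norm ?sqr_ge0.
Qed.

Lemma cintegrableM_sqr v w :
  cintegrable I01 v -> cintegrable I01 w ->
  mu.-integrable I01 (EFin \o (fun x => normc (v x) ^+ 2)) ->
  mu.-integrable I01 (EFin \o (fun x => normc (w x) ^+ 2)) ->
  cintegrable I01 (fun x => v x * w x).
Proof.
move=> iv iw v2 w2; have mI : measurable I01 by [].
have i2 : mu.-integrable I01 (EFin \o (fun x => normc (v x) ^+ 2 + normc (w x) ^+ 2)).
  exact: (integrableD mI v2 w2).
apply: (cintegrable_le mI _ i2).
  by apply: cmeasurableM; exact: cintegrable_measurable.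
move=> x _; rewrite ComplexField.Normc.normcM.
have := sqr_ge0 (normc (v x) - normc (w x)).
have := sqr_ge0 (normc (v x)); have := sqr_ge0 (normc (w x)); nra.
Qed.

(** Replacing [v] by a partial Fourier sum turns the coefficient into a finite convolution, bounded
    by Peetre and Cauchy-Schwarz independently of the chosen frequencies. The remainder is small in
    $L^2$ by [plancherel_le], hence its product with [w] is small in $L^1$; the factor [weight l k]
    is harmless because $k$ is fixed. *)
Lemma fourier_product l v w a b k : 0 <= l -> 0 <= a -> 0 <= b ->
  cintegrable I01 v -> cintegrable I01 w ->
  (Hnorm l (fourier v) <= a%:E)%E -> (Hnorm l (fourier w) <= b%:E)%E ->
  cintegrable I01 (fun x => v x * w x) /\
  wnorm l (fourier (fun x => v x * w x)) k <= Num.sqrt (2 `^ l) * (a * b).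
Proof.
move=> l0 a0 b0 iv iw va wb; have mI : measurable I01 by [].
have Pv := Hnorm_plancherel l0 a0 iv va; have Pw := Hnorm_plancherel l0 b0 iw wb.
have iv2 := integrable_normc_sqr iv Pv; have iw2 := integrable_normc_sqr iw Pw.
have ivw := cintegrableM_sqr iv iw iv2 iw2.
split=> //.
have va' := (Hnorm_leP _ _ a0).1 va; have wb' := (Hnorm_leP _ _ b0).1 wb.
have vs X : uniq X -> \sum_(j <- X) normc (fourier v j) ^+ 2 <= a ^+ 2.
  move=> uX; apply: le_trans (va' X uX); apply: ler_sum => j _.
  rewrite ler_sqr ?nnegrE ?wnorm_ge0 ?normc_ge0//.
  by rewrite ler_peMl ?normc_ge0 ?weight_ge1.
(* A finite [X] whose sum comes within $\eta^2$ of the supremum leaves at most $\eta^2$ for any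
   finite set of frequencies outside [X]. *)
pose S := [set \sum_(j <- X) normc (fourier v j) ^+ 2 | X in [set X | uniq X]].
have supS : has_sup S.
  split; first by exists 0; exists [::] => //; rewrite big_nil.
  by exists (a ^+ 2) => _ [X uX <-]; exact: vs.
have key (eta : R) : 0 < eta ->
    wnorm l (fourier (fun x => v x * w x)) k <=
    Num.sqrt (2 `^ l) * (a * b) + weight l k * (eta * (1 + b ^+ 2) / 2).
  move=> eta0.
  have [_ [X uX <-] SX] := sup_adherent (exprn_gt0 2 eta0) supS.
  pose p := trig X (fourier v); pose r x := v x - p x.
  have ip : cintegrable I01 p := cintegrable_trig X (fourier v).
  have ir : cintegrable I01 r by apply: cintegrableB.
  have fr j : fourier r j = if j \in X then 0 else fourier v j.
    rewrite fourierB// fourier_trig//; case: ifP => _; by rewrite ?subrr ?subr0.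
  have Pr : (\int[mu]_(x in I01) (normc (r x) ^+ 2)%:E <= (eta ^+ 2)%:E)%E.
    apply: plancherel_le => // Y uY.
    have -> : \sum_(j <- Y) normc (fourier r j) ^+ 2 =
        \sum_(j <- [seq j <- Y | j \notin X]) normc (fourier v j) ^+ 2.
      rewrite big_filter [RHS]big_mkcond; apply: eq_bigr => j _; rewrite fr.
      by case: (j \in X); last by []; rewrite ComplexField.Normc.normc0 expr0n.
    have uZ : uniq ([seq j <- Y | j \notin X] ++ X).
      rewrite cat_uniq uX filter_uniq// andbT/=.
      by apply/hasPn => j jX; rewrite mem_filter jX.
    have : \sum_(j <- [seq j <- Y | j \notin X] ++ X) normc (fourier v j) ^+ 2 <= sup S.
      by apply: ub_le_sup; [case: supS|exists ([seq j <- Y | j \notin X] ++ X)].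
    rewrite big_cat /=; move: SX; lra.
  have ir2 := integrable_normc_sqr ir Pr.
  have irw := cintegrableM_sqr ir iw ir2 iw2.
  have ipw : cintegrable I01 (fun x => p x * w x) by exact: cintegrable_trigM.
  have -> : fourier (fun x => v x * w x) =
      (fun k => fourier (fun x => p x * w x) k + fourier (fun x => r x * w x) k).
    apply/funext => j; rewrite -fourierD//; congr fourier; apply/funext => x.
    by rewrite -mulrDl /r addrC subrK.
  rewrite /wnorm; apply: (@le_trans _ _ (weight l k * (normc (fourier (fun x => p x * w x) k)
      + normc (fourier (fun x => r x * w x) k)))).
    by rewrite ler_wpM2l ?weight_ge0// normcD.
  rewrite mulrDr; apply: lerD.
    rewrite fourier_trigM//.
    apply: (@le_trans _ _ (\sum_(j <- X) Num.sqrt (2 `^ l) *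
        (wnorm l (fourier v) j * wnorm l (fourier w) (k - j)))).
      apply: (@le_trans _ _ (weight l k *
          \sum_(j <- X) normc (fourier v j * fourier w (k - j)))).
        by rewrite ler_wpM2l ?weight_ge0// normc_sum.
      rewrite mulr_sumr; apply: ler_sum => j _; rewrite ComplexField.Normc.normcM.
      have := weightD j (k - j) l0; rewrite addrC subrK => wD.
      apply: (@le_trans _ _ (Num.sqrt (2 `^ l) * (weight l j * weight l (k - j)) *
          (normc (fourier v j) * normc (fourier w (k - j))))).
        by rewrite ler_wpM2r// mulr_ge0// normc_ge0.
      by rewrite /wnorm le_eqVlt; apply/orP; left; apply/eqP; ring.
    rewrite -mulr_sumr ler_wpM2l ?sqrtr_ge0//.
    apply: cauchy_schwarz_le => //; first exact: va'.
    rewrite -(big_map (fun j => k - j) xpredT (fun i => wnorm l (fourier w) i ^+ 2)).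
    by apply: wb'; rewrite map_inj_uniq// => i j /addrI /oppr_inj.
  rewrite ler_wpM2l ?weight_ge0//.
  apply: le_trans (normc_fourier k irw) _.
  (* Weighted arithmetic-geometric mean: $|r||w|\le|r|^2/(2\eta)+\eta|w|^2/2$, of integral at most
     $\eta(1+b^2)/2$ because $\int|r|^2\le\eta^2$. *)
  have i2 : mu.-integrable I01 (EFin \o (fun x => eta^-1 / 2 * normc (r x) ^+ 2 +
      eta / 2 * normc (w x) ^+ 2)).
    exact: (integrableD mI (integrableZl mI _ ir2) (integrableZl mI _ iw2)).
  apply: (@le_trans _ _ (\int[mu]_(x in I01) (eta^-1 / 2 * normc (r x) ^+ 2 +
      eta / 2 * normc (w x) ^+ 2))).
    apply: le_Rintegral => //; first exact: cintegrable_normc.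
    move=> x _; rewrite ComplexField.Normc.normcM.
    rewrite -subr_ge0; set A := normc (r x); set B := normc (w x).
    have -> : eta^-1 / 2 * A ^+ 2 + eta / 2 * B ^+ 2 - A * B
      = eta^-1 / 2 * (A - eta * B) ^+ 2 by field; exact: lt0r_neq0.
    by rewrite mulr_ge0 ?sqr_ge0// divr_ge0// invr_ge0 ltW.
  rewrite RintegralD//; last 2 first.
  - exact: (integrableZl mI _ ir2).
  - exact: (integrableZl mI _ iw2).
  rewrite !RintegralZl//.
  move: Pr Pw; rewrite !EFin_Rintegral// !lee_fin => Pr Pw'.
  have -> : eta * (1 + b ^+ 2) / 2 = eta^-1 / 2 * eta ^+ 2 + eta / 2 * b ^+ 2.
    by field; exact: lt0r_neq0.
  apply: lerD; rewrite ler_wpM2l// divr_ge0// ?invr_ge0 ltW//.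
apply/ler_addgt0Pr => e e0.
have D0 : 0 < weight l k * ((1 + b ^+ 2) / 2).
  by rewrite mulr_gt0 ?weight_gt0// divr_gt0// ltr_wpDr ?sqr_ge0.
(* The value of [eta] for which the error term equals [e]. *)
have := key (e / (weight l k * ((1 + b ^+ 2) / 2))) (divr_gt0 e0 D0).
move=> /le_trans; apply; rewrite lerD2l le_eqVlt; apply/orP; left; apply/eqP.
field.
by apply/andP; split; apply: lt0r_neq0; rewrite ?weight_gt0// ltr_wpDr ?sqr_ge0.
Qed.

(** The symmetric bilinear form whose diagonal is $(I-\Delta)^{-1}(uu_x)$; through it the difference
    of two nonlinear terms factors. *)
Definition half_product v w (k : int) : R[i] :=
  inv_I_minus_Laplacian (ddx (fourier (fun x => (2^-1)%:C * (v x * w x)))) k.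

(** The square of the multiplier $2\pi k/(1+(2\pi k)^2)$ is at most $(1+(2\pi k)^2)^{-1}$, whose sum
    is bounded by [Z]. Thus [Num.sqrt Z] measures the smoothing in $\ell^2$, and [m] is Peetre's
    constant. *)
Lemma bilinear_estimate l : 0 <= l -> exists2 K : R, 0 <= K &
  forall v w a b, 0 <= a -> 0 <= b -> cintegrable I01 v -> cintegrable I01 w ->
  (Hnorm l (fourier v) <= a%:E)%E -> (Hnorm l (fourier w) <= b%:E)%E ->
  (Hnorm l (half_product v w) <= (K * (a * b))%:E)%E.
Proof.
move=> l0; have [Z Z0 ZP] := @sum_inv_freq2 R.
pose m := Num.sqrt (2 `^ l : R); have m0 : 0 <= m by exact: sqrtr_ge0.
exists (Num.sqrt Z * m); first by rewrite mulr_ge0// sqrtr_ge0.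
move=> v w a b a0 b0 iv iw va wb.
have ab0 : 0 <= m * (a * b) by rewrite mulr_ge0// mulr_ge0.
apply/Hnorm_leP => [|X uX]; first by rewrite !mulr_ge0// sqrtr_ge0.
apply: (@le_trans _ _ (\sum_(k <- X) (1 + freq k ^+ 2)^-1 * (m * (a * b)) ^+ 2)).
  apply: ler_sum => k _.
  have [ivw Pk] := fourier_product k l0 a0 b0 iv iw va wb.
  rewrite /wnorm /half_product /inv_I_minus_Laplacian /ddx fourierZ//.
  rewrite !ComplexField.Normc.normcM !normc_real.
  have -> : normc (0 +i* freq k) = `|freq k| :> R.
    by rewrite -[LHS]/(Num.sqrt (0 ^+ 2 + freq k ^+ 2)) expr0n add0r sqrtr_sqr.
  have f0 := @freq2_gt0 R k.
  move: Pk; rewrite /wnorm; set p := normc _; set W := weight l k => Pk.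
  rewrite (ger0_norm (x := 2^-1))// (ger0_norm (x := (1 + _)^-1)) ?invr_ge0 ?(ltW f0)//.
  have -> : (W * ((1 + freq k ^+ 2)^-1 * (`|freq k| * (2^-1 * p)))) ^+ 2
    = (1 + freq k ^+ 2)^-1 * ((`|freq k| ^+ 2 / (1 + freq k ^+ 2)) * 4^-1 * (W * p) ^+ 2).
    by field; exact: lt0r_neq0.
  rewrite ler_wpM2l ?invr_ge0 ?(ltW f0)// real_normK ?num_real//.
  apply: (@le_trans _ _ ((W * p) ^+ 2)).
    rewrite ler_piMl ?sqr_ge0//.
    have : (freq k : R) ^+ 2 / (1 + freq k ^+ 2) <= 1 by rewrite ler_pdivrMr// mul1r lerDr.
    have : 0 <= (freq k : R) ^+ 2 / (1 + freq k ^+ 2) by rewrite divr_ge0 ?sqr_ge0 ?(ltW f0).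
    lra.
  by rewrite ler_sqr// nnegrE mulr_ge0 ?weight_ge0 ?normc_ge0.
have -> : (Num.sqrt Z * m * (a * b)) ^+ 2 = Z * (m * (a * b)) ^+ 2.
  by rewrite -[in RHS](sqr_sqrtr Z0); ring.
by rewrite -mulr_suml ler_wpM2r ?sqr_ge0// ZP.
Qed.

End Product.

(** * Norms of Bochner integrals *)

Section BochnerNorm.
Context {R : realType}.
Local Notation mu := (@lebesgue_measure R).
Local Notation mR := (measurableTypeR R).
Local Notation Re := (@complex.Re R).
Local Notation Im := (@complex.Im R).

Lemma ae_le_integrable (D : set mR) (f q : R -> R) : measurable D ->
  measurable_fun D f -> mu.-integrable D (EFin \o q) ->
  (forall s, D s -> 0 <= q s) ->
  {ae mu, forall s, D s -> `|f s| <= q s} -> mu.-integrable D (EFin \o f).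
Proof.
move=> mD mf /integrableP[mq qoo] q0 fq; apply/integrableP; split.
  exact/measurable_EFinP.
apply: le_lt_trans qoo; apply: ae_ge0_le_integral => //.
- by apply: measurableT_comp => //; exact/measurable_EFinP.
- exact: measurableT_comp.
- apply: (@filterS _ _ (ae_filter_ringOfSetsType mu) _ _ _ fq) => s fqs Ds.
  by rewrite /= lee_fin (ger0_norm (q0 s Ds)) fqs.
Qed.

Lemma ae_le_Rintegral (D : set mR) (f q : R -> R) : measurable D ->
  measurable_fun D f -> mu.-integrable D (EFin \o q) ->
  (forall s, D s -> 0 <= q s) ->
  {ae mu, forall s, D s -> `|f s| <= q s} ->
  \int[mu]_(s in D) f s <= \int[mu]_(s in D) q s.
Proof.
move=> mD mf iq q0 fq; have fi := ae_le_integrable mD mf iq q0 fq.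
apply: (@le_trans _ _ (\int[mu]_(s in D) `|f s|)).
  by rewrite (le_trans (ler_norm _))// le_normr_Rintegral.
rewrite -lee_fin -!EFin_Rintegral//; last exact: (integrable_norm fi).
apply: ae_ge0_le_integral => //.
- by apply/measurable_EFinP; apply: measurableT_comp.
- exact: (measurable_int mu).
Qed.

(** Minkowski's integral inequality by duality: the square sum [E] of the integral over a finite set
    of frequencies is its pairing with itself, so Cauchy-Schwarz under the integral gives $E\le\sqrt
    E\int q$. The majorant is needed only almost everywhere, as suits a force that is essentially
    bounded. *)
Lemma Hnorm_bochner_le l (D : set mR) (h : R -> int -> R[i]) (q : R -> R) :
  measurable D -> (forall k, cmeasurable D (fun s => h s k)) ->
  mu.-integrable D (EFin \o q) -> (forall s, D s -> 0 <= q s) ->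
  {ae mu, forall s, D s -> (Hnorm l (h s) <= (q s)%:E)%E} ->
  (Hnorm l (bochner D h) <= (\int[mu]_(s in D) q s)%:E)%E.
Proof.
move=> mD mh iq q0 hq; have N0 : 0 <= \int[mu]_(s in D) q s by exact: Rintegral_ge0.
have aeF : Filter (nbhs (almost_everywhere mu)) := ae_filter_ringOfSetsType mu.
have ih k : cintegrable D (fun s => h s k).
  have bd : {ae mu, forall s, D s -> normc (h s k) <= (weight l k)^-1 * q s}.
    apply: (@filterS _ _ aeF _ _ _ hq) => s hs Ds.
    by rewrite ler_pdivlMl ?weight_gt0// (wnorm_le k (q0 s Ds) (hs Ds)).
  have iqk : mu.-integrable D (EFin \o (fun s => (weight l k)^-1 * q s)).
    exact: (integrableZl mD _ iq).
  have qk0 s : D s -> 0 <= (weight l k)^-1 * q s.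
    by move=> Ds; rewrite mulr_ge0 ?invr_ge0 ?weight_ge0 ?q0.
  have [mr mi] := mh k.
  split; [apply: (ae_le_integrable mD mr iqk qk0)|apply: (ae_le_integrable mD mi iqk qk0)];
    apply: (@filterS _ _ aeF _ _ _ bd) => s hs Ds; apply: le_trans (hs Ds).
    exact: Re_le_normc.
  exact: Im_le_normc.
apply/Hnorm_leP => // X uX.
pose z k := (weight l k ^+ 2)%:C * (bochner D h k)^*%C.
pose E := \sum_(k <- X) wnorm l (bochner D h) k ^+ 2; rewrite -/E.
have E0 : 0 <= E by apply: sumr_ge0 => k _; exact: sqr_ge0.
have izh : cintegrable D (fun s => \sum_(k <- X) z k * h s k).
  by apply: cintegrable_sum => // k; exact: cintegrableZ.
have EE : E = \int[mu]_(s in D) Re (\sum_(k <- X) z k * h s k).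
  rewrite -[RHS]/(Re (cintegral D (fun s => \sum_(k <- X) z k * h s k))).
  rewrite cintegral_sum//; last by move=> k; exact: cintegrableZ.
  rewrite Re_sum; apply: eq_bigr => k _; rewrite cintegralZ// -/(bochner D h k).
  rewrite /wnorm exprMn normc_sqrE /z.
  by case: (bochner D h k) => p q'; rewrite /=; ring.
have EN : E <= Num.sqrt E * \int[mu]_(s in D) q s.
  rewrite {1}EE -RintegralZl//; apply: ae_le_Rintegral => //.
  - by have [r _] := izh; apply/measurable_EFinP; exact: (measurable_int mu).
  - exact: (integrableZl mD _ iq).
  - by move=> s Ds; rewrite mulr_ge0 ?sqrtr_ge0 ?q0.
  apply: (@filterS _ _ aeF _ _ _ hq) => s hs Ds.
  apply: le_trans (Re_le_normc _) _; apply: le_trans (normc_sum _ _) _.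
  apply: (@le_trans _ _ (\sum_(k <- X) wnorm l (bochner D h) k * wnorm l (h s) k)).
    apply: ler_sum => k _; rewrite /z !ComplexField.Normc.normcM normc_real normc_conj.
    by rewrite ger0_norm ?sqr_ge0// /wnorm le_eqVlt; apply/orP; left; apply/eqP; ring.
  apply: cauchy_schwarz_le; rewrite ?sqrtr_ge0 ?q0//; first by rewrite sqr_sqrtr.
  exact: ((Hnorm_leP _ _ (q0 s Ds)).1 (hs Ds)).
have [->|En0] := eqVneq E 0; first exact: sqr_ge0.
have sE : 0 < Num.sqrt E by rewrite sqrtr_gt0 lt_neqAle eq_sym En0.
rewrite -(sqr_sqrtr E0) ler_sqr ?nnegrE ?sqrtr_ge0//.
by move: EN; rewrite -{1}(sqr_sqrtr E0) expr2 ler_pM2l.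
Qed.

(** The norm is the increasing limit of its truncations to $|k|\le N$, which are measurable finite
    expressions. *)
Lemma measurable_Hnorm l (D : set mR) (h : R -> int -> R[i]) : measurable D ->
  (forall k, cmeasurable D (fun s => h s k)) ->
  measurable_fun D (fun s => Hnorm l (h s)).
Proof.
move=> mD mh.
pose p (N : nat) s := Num.sqrt (\sum_(k <- zrange N) wnorm l (h s) k ^+ 2).
apply: (emeasurable_fun_cvg (fun N s => (p N s)%:E)) => [N|s Ds].
  apply/measurable_EFinP.
  apply: (@measurableT_comp _ _ _ _ _ _ (@Num.sqrt R)) => //.
    by apply: continuous_measurable_fun; exact: sqrt_continuous.
  elim: (zrange N) => [|k X IH].
    by under eq_fun do rewrite big_nil; exact: measurable_cst.
  under eq_fun do rewrite big_cons; apply: measurable_funD => //.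
  under eq_fun do rewrite /wnorm exprMn.
  by apply: measurable_funM => //; exact: measurable_normc_sqr.
have S0 N : 0 <= \sum_(k <- zrange N) wnorm l (h s) k ^+ 2.
  by apply: sumr_ge0 => k _; exact: sqr_ge0.
have nd : nondecreasing_seq (fun N => (p N s)%:E).
  move=> M N MN; rewrite lee_fin ler_wsqrtr//.
  apply: ler_sum_subset => [||k|k];
    [exact: zrange_uniq|exact: zrange_uniq| |exact: sqr_ge0].
  by rewrite !mem_zrange => /leq_trans; apply.
have := ereal_nondecreasing_cvgn nd; set S := ereal_sup _ => pS.
suff -> : Hnorm l (h s) = S by [].
apply/eqP; rewrite eq_le; apply/andP; split; last first.
  apply: ge_ereal_sup => _ [N _ <-].
  have [->|fin] := eqVneq (Hnorm l (h s)) +oo%E; first exact: leey.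
  have nE : Hnorm l (h s) = (fine (Hnorm l (h s)))%:E.
    by rewrite fineK// ge0_fin_numE ?Hnorm_ge0// ltey.
  have n0 : 0 <= fine (Hnorm l (h s)) by rewrite fine_ge0 ?Hnorm_ge0.
  rewrite nE lee_fin /p -[leRHS]ger0_norm// -sqrtr_sqr ler_wsqrtr//.
  by apply: ((Hnorm_leP _ _ n0).1 _ _ (zrange_uniq N)); rewrite -nE.
have pleS N : ((p N s)%:E <= S)%E by apply: ereal_sup_ubound; exists N.
case: S pS pleS => [r| |] pS pleS; [|exact: leey|by have := pleS 0%N].
have r0 : 0 <= r by have := pleS 0%N; rewrite lee_fin; apply: le_trans; exact: sqrtr_ge0.
apply/Hnorm_leP => // X uX.
pose N := (\sum_(k <- X) `|k|)%N.
apply: (@le_trans _ _ (\sum_(k <- zrange N) wnorm l (h s) k ^+ 2)).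
  apply: ler_sum_subset => [||k kX|k]; [by []|exact: zrange_uniq| |exact: sqr_ge0].
  by rewrite mem_zrange /N (big_rem k)//= leq_addr.
have := pleS N; rewrite lee_fin /p -(ler_sqr (x := Num.sqrt _)) ?nnegrE ?sqrtr_ge0//.
by rewrite sqr_sqrtr.
Qed.

End BochnerNorm.

(** * The semigroup and mild solutions *)

Section Semigroup.
Context {R : realType}.
Local Notation mu := (@lebesgue_measure R).
Local Notation mR := (measurableTypeR R).
Local Notation Re := (@complex.Re R).
Local Notation Im := (@complex.Im R).
Implicit Types (beta gamma l t a : R) (c : int -> R[i]).

(** As a function of $x=(2\pi k)^2\ge x_0=4\pi^2$ the rate $(\beta+\gamma x)/(1+x)$ is monotone,
    with value [r1] at $x_0$ and limit $\gamma$; it stays above the smaller of the two. The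
    hypothesis on $\gamma$ makes both positive. *)
Lemma spectral_gap beta gamma :
  Num.max 0 (- (beta / (4 * pi ^+ 2))) < gamma ->
  exists2 rho : R, 0 < rho & forall k, k != 0 -> Re (symbolA beta gamma k) <= - rho.
Proof.
rewrite gt_max => /andP[g0]; set x0 : R := 4 * pi ^+ 2.
have x00 : 0 < x0 by rewrite mulr_gt0// exprn_gt0// pi_gt0.
rewrite -mulNr ltr_pdivrMr// => bg.
pose r1 := (beta + gamma * x0) / (1 + x0).
have n0 : 0 < beta + gamma * x0 by move: bg; lra.
have r10 : 0 < r1 by rewrite divr_gt0// addr_gt0.
exists (Num.min gamma r1); first by rewrite lt_min g0.
move=> k k0; rewrite /symbolA /=; set rho := Num.min _ _.
have rg : rho <= gamma by rewrite ge_min lexx.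
have rr : rho <= r1 by rewrite ge_min lexx orbT.
have rr' : rho * (1 + x0) <= beta + gamma * x0 by rewrite -ler_pdivlMr// addr_gt0.
have xk : x0 <= freq k ^+ 2.
  rewrite /freq exprMn [leLHS](_ : _ = (2 * pi) ^+ 2 * 1); last by rewrite /x0; ring.
  rewrite ler_wpM2l ?sqr_ge0// -(real_normK (num_real k%:~R)) -intr_norm.
  rewrite -[leLHS](expr1n _ 2) ler_sqr ?nnegrE// ?ler0z// ler1z.
  by rewrite -gtz0_ge1 normr_gt0.
have f0 := @freq2_gt0 R k.
rewrite mulNr lerN2 ler_pdivlMr//.
move: (freq k ^+ 2) xk => x xk; clearbody rho x0.
have := mulr_ge0 (_ : 0 <= gamma - rho) (_ : 0 <= x - x0); rewrite !subr_ge0.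
by move=> /(_ rg xk); lra.
Qed.

Lemma normc_cexp (z : R[i]) : normc (cexp z) = expR (Re z).
Proof.
rewrite /cexp /= !exprMn -mulrDr cos2Dsin2 mulr1 sqrtr_sqr.
by rewrite ger0_norm// expR_ge0.
Qed.

Lemma normc_expA beta gamma t c k :
  normc (expA beta gamma t c k) = expR (t * Re (symbolA beta gamma k)) * normc (c k).
Proof.
rewrite /expA ComplexField.Normc.normcM normc_cexp.
by congr (expR _ * _); rewrite ReM /= mul0r subr0.
Qed.

Lemma Hnorm_expA_decay l beta gamma rho t a c :
  (forall k, k != 0 -> Re (symbolA beta gamma k) <= - rho) -> c 0 = 0 ->
  0 <= t -> (Hnorm l c <= a%:E)%E ->
  (Hnorm l (expA beta gamma t c) <= (expR (- (rho * t)) * a)%:E)%E.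
Proof.
move=> gap c0 t0 ca; rewrite EFinM.
apply: (@le_trans _ _ ((expR (- (rho * t)))%:E * Hnorm l c)%E); last first.
  by rewrite lee_wpmul2l// lee_fin expR_ge0.
apply: le_Hnorm => [|k]; first exact: expR_ge0.
have [->|k0] := eqVneq k 0.
  by rewrite normc_expA c0 ComplexField.Normc.normc0 !mulr0.
rewrite normc_expA ler_wpM2r ?normc_ge0// ler_expR.
by have := gap k k0; nra.
Qed.

(** The symbol is bounded, so $e^{At}$ is a group. The negative times are the ones that
    [mild_norm_jump] uses. *)
Lemma Hnorm_expA_bounded beta gamma : exists2 K : R, 0 <= K &
  forall l t c, `|t| <= 1 -> (Hnorm l (expA beta gamma t c) <= K%:E * Hnorm l c)%E.
Proof.
have [m Hm] := symbolA_bounded beta gamma.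
exists (expR m) => [|l t c t1]; first exact: expR_ge0.
apply: le_Hnorm => [|k]; first exact: expR_ge0.
rewrite normc_expA ler_wpM2r ?normc_ge0// ler_expR.
have [am _] := Hm k; rewrite (le_trans (ler_norm _))// normrM.
have := normr_ge0 t; have := normr_ge0 (Re (symbolA beta gamma k)); nra.
Qed.

Lemma wnorm_le_Hnorm l c k : ((wnorm l c k)%:E <= Hnorm l c)%E.
Proof.
have [->|fin] := eqVneq (Hnorm l c) +oo%E; first exact: leey.
have nE : Hnorm l c = (fine (Hnorm l c))%:E.
  by rewrite fineK// ge0_fin_numE ?Hnorm_ge0// ltey.
rewrite nE lee_fin wnorm_le// -?nE//.
by rewrite fine_ge0 ?Hnorm_ge0.
Qed.

Lemma bochner_integrable_cintegrable l (D : set mR) (h : R -> int -> R[i]) k :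
  measurable D -> bochner_integrable l D h -> cintegrable D (fun s => h s k).
Proof.
move=> mD [mh hoo]; have [mr mi] := mh k.
have mH : measurable_fun D (fun s => Hnorm l (h s)) by exact: measurable_Hnorm.
have W0 : (0 <= ((weight l k)^-1)%:E :> \bar R)%E by rewrite lee_fin invr_ge0 weight_ge0.
have fin : (\int[mu]_(s in D) (((weight l k)^-1)%:E * Hnorm l (h s)) < +oo)%E.
  rewrite ge0_integralZl//; last by move=> s _; exact: Hnorm_ge0.
  by rewrite lte_mul_pinfty.
have B s : ((normc (h s k))%:E <= ((weight l k)^-1)%:E * Hnorm l (h s))%E.
  have -> : (normc (h s k))%:E = (((weight l k)^-1)%:E * (wnorm l (h s) k)%:E)%E.
    by rewrite -EFinM /wnorm mulKf// lt0r_neq0// weight_gt0.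
  by rewrite lee_wpmul2l// wnorm_le_Hnorm.
split; apply/integrableP; (split; first exact/measurable_EFinP);
  apply: le_lt_trans fin; apply: ge0_le_integral => //.
- by apply: measurableT_comp => //; exact/measurable_EFinP.
- by apply: emeasurable_funM => //; exact: measurable_cst.
- by move=> s _; apply: le_trans (B s); rewrite lee_fin Re_le_normc.
- by apply: measurableT_comp => //; exact/measurable_EFinP.
- by apply: emeasurable_funM => //; exact: measurable_cst.
- by move=> s _; apply: le_trans (B s); rewrite lee_fin Im_le_normc.
Qed.

End Semigroup.

(** * Duhamel's formula and the bound for all times *)

Section MildSolution.
Context {R : realType}.
Local Notation mu := (@lebesgue_measure R).
Local Notation mR := (measurableTypeR R).
Local Notation Re := (@complex.Re R).
Local Notation Im := (@complex.Im R).
Local Notation I01 := (`[(0 : R), 1]%classic : set mR).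
Context (l beta gamma : R) (phi : R -> R[i]) (f u : R -> R -> R[i]).
Local Notation S := (expA beta gamma).
Local Notation D := (duhamel beta gamma f u).

Definition forcing (s : R) : int -> R[i] :=
  inv_I_minus_Laplacian (fun k => fourier (f s) k - uux (u s) k).

Lemma duhamelE (t s : R) : D t s = S (t - s) (forcing s). Proof. by []. Qed.

Lemma expA_duhamel (r t s : R) : S r (D t s) = D (r + t) s.
Proof. by rewrite !duhamelE -expAD addrA. Qed.

Context (mild : mild_solution l beta gamma phi f u).

Lemma duhamel_cintegrable (t : R) k : 0 <= t ->
  cintegrable (`[0, t] : set mR) (fun s => D t s k).
Proof.
move=> t0; have [_ bi _] := mild t0.
exact: (bochner_integrable_cintegrable k _ bi).
Qed.

Lemma cintegral_itvU (a t : R) (g : R -> R[i]) : 0 <= a -> a <= t ->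
  cintegrable (`[0, t] : set mR) g ->
  cintegral `[0, t] g = cintegral `[0, a] g + cintegral `[a, t] g.
Proof.
move=> a0 at' [gr gi].
have H (h : R -> R) : mu.-integrable `[0, t] (EFin \o h) ->
    \int[mu]_(s in `[0, t]) h s =
    \int[mu]_(s in `[0, a]) h s + \int[mu]_(s in `[a, t]) h s.
  move=> ih; rewrite -Rintegral_itv_obnd_cbnd; last first.
    by apply: integrableS ih => //; apply: subset_itvr; rewrite bnd_simp.
  rewrite -(Rintegral_itvB ih (x := a)) ?bnd_simp//.
  by rewrite addrC subrK.
by apply/eqP; rewrite eq_complex /=; apply/andP; split; apply/eqP; exact: H.
Qed.

(** Split the Duhamel integral at [a]; by the semigroup law $e^{A(t-a)}$ factors out of the part
    over $[0,a]$. *)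
Lemma mild_restart (a t : R) k : 0 <= a -> a <= t ->
  fourier (u t) k = S (t - a) (fourier (u a)) k + bochner `[a, t] (D t) k.
Proof.
move=> a0 at'; have t0 : 0 <= t := le_trans a0 at'.
have [_ _ ut] := mild t0; have [_ _ ua] := mild a0.
rewrite ut /bochner (cintegral_itvU a0 at' (duhamel_cintegrable k t0)) addrA.
congr (_ + _); rewrite {2}/expA ua mulrDr; congr (_ + _).
  rewrite -[RHS]/(S (t - a) (S a (fourier phi)) k) -expAD.
  by rewrite subrK.
rewrite /bochner -cintegralZ//; last exact: duhamel_cintegrable.
apply: eq_cintegral => s _.
by rewrite -[RHS]/(S (t - a) (D a s) k) expA_duhamel subrK.
Qed.


Context (rho K delta : R).
Context (l0 : 0 <= l) (rho0 : 0 < rho).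
Context (gap : forall k, k != 0 -> Re (symbolA beta gamma k) <= - rho).
Context (delta0 : 0 <= delta) (f0 : forall s, 0 <= s -> Hper0 l (f s)).
Context (f_le : {ae mu, forall s, 0 <= s -> (Hnorm l (fourier (f s)) <= delta%:E)%E}).
Context (K0 : 0 <= K).
Context (bilinear : forall v w a b, 0 <= a -> 0 <= b ->
  cintegrable I01 v -> cintegrable I01 w ->
  (Hnorm l (fourier v) <= a%:E)%E -> (Hnorm l (fourier w) <= b%:E)%E ->
  (Hnorm l (half_product v w) <= (K * (a * b))%:E)%E).

Lemma fourier_mean (g : R -> R[i]) : mean g = 0 -> fourier g 0 = 0.
Proof. by move=> <-; apply: eq_cintegral => x _; rewrite -/(ek 0 x) ek0l mul1r. Qed.

Lemma mild_integrable (t : R) : 0 <= t -> cintegrable I01 (u t).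
Proof. by move=> t0; have [[[_ r i _] _] _ _] := mild t0; split. Qed.

Lemma mild_mean (t : R) : 0 <= t -> fourier (u t) 0 = 0.
Proof. by move=> t0; have [[_ m] _ _] := mild t0; exact: fourier_mean. Qed.

Lemma duhamel_measurable (t : R) (E : set mR) k : 0 <= t -> measurable E ->
  E `<=` `[0, t] -> cmeasurable E (fun s => D t s k).
Proof.
move=> t0 mE Et; apply: cintegrable_measurable.
exact: cintegrableS Et (duhamel_cintegrable k t0).
Qed.

(* For [0 <= h <= 1] the integrand [D (t + h) s] is the image of the integrable
   function [D (t + 1) s] under a bounded operator, so the integral over
   [t, t + h] tends to 0 with [h]. *)
Lemma mild_norm_jump (t a e : R) : 0 <= t -> 0 <= a -> 0 < e ->
  (Hnorm l (fourier (u t)) <= a%:E)%E ->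
  exists2 eta : R, 0 < eta &
    forall h, 0 <= h <= eta -> (Hnorm l (fourier (u (t + h))) <= (a + e)%:E)%E.
Proof.
move=> t0 a0 e0 ua; have t10 : 0 <= t + 1 by rewrite addr_ge0.
have aeF : Filter (nbhs (almost_everywhere mu)) := ae_filter_ringOfSetsType mu.
have [M M0 SM] := Hnorm_expA_bounded beta gamma.
have [_ [mD Doo] _] := mild t10.
have mI : measurable (`[0, t + 1] : set mR) by [].
have mH : measurable_fun (`[0, t + 1] : set mR) (fun s => Hnorm l (D (t + 1) s)).
  exact: measurable_Hnorm.
have iH : mu.-integrable (`[0, t + 1] : set mR) (fun s => Hnorm l (D (t + 1) s)).
  apply/integrableP; split => //; under eq_integral do rewrite gee0_abs ?Hnorm_ge0//.
  exact: Doo.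
(* An integrable norm is finite almost everywhere, where [fine] loses nothing; [M] bounds
   $e^{A(h-1)}$ for all $0\le h\le1$. *)
pose q s := M * fine (Hnorm l (D (t + 1) s)).
have q0 s : 0 <= q s by rewrite mulr_ge0// fine_ge0// Hnorm_ge0.
have finH := integrable_ae mI iH.
have mfH : measurable_fun (`[0, t + 1] : set mR) (fun s => fine (Hnorm l (D (t + 1) s))).
  exact: (measurableT_comp (fine_measurable measurableT) mH).
have iq : mu.-integrable (`[0, t + 1] : set mR) (EFin \o q).
  apply: (integrableZl mI M (f := EFin \o (fun s => fine (Hnorm l (D (t + 1) s))))).
  apply/integrableP; split.
    exact/measurable_EFinP.
  apply: le_lt_trans Doo; apply: ge0_le_integral => //.
  - by apply: measurableT_comp => //; exact/measurable_EFinP.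
  - move=> s _ /=; rewrite ger0_norm ?fine_ge0 ?Hnorm_ge0//.
    have [->|fin] := eqVneq (Hnorm l (D (t + 1) s)) +oo%E; first exact: leey.
    by rewrite fineK// ge0_fin_numE ?Hnorm_ge0// ltey.
have sub : `[t, t + 1]%classic `<=` (`[0, t + 1] : set mR).
  by move=> s /=; rewrite !in_itv/= => /andP[ts ->]; rewrite andbT (le_trans t0).
have iqt : mu.-integrable (`[t, t + 1] : set mR) (EFin \o q) by exact: integrableS iq.
have t1 : t < t + 1 by rewrite ltrDl.
have /cvgrPdist_le /(_ e e0) [r /= r0 rP] := parameterized_integral_cvg_left t1 iqt.
(* The 1 keeps $|h-1|\le1$; half of [r] keeps $h$ strictly inside the neighbourhood on which the
   integral of [q] is at most [e]. *)
exists (Num.min 1 (r / 2)) => [|h /andP[h0]].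
  by rewrite lt_min ltr01 divr_gt0.
rewrite le_min => /andP[h1 hr].
have th0 : 0 <= t + h by rewrite addr_ge0.
have tth : t <= t + h by rewrite lerDl.
have qe : \int[mu]_(s in `[t, t + h]) q s <= e.
  have := rP (t + h); rewrite /ball_ /= opprD addrA subrr add0r normrN ger0_norm//.
  move=> /(_ _); rewrite sub0r normrN /parameterized_integral => le.
  by apply: le_trans (ler_norm _) (le _); lra.
rewrite (eq_Hnorm l (fun k => mild_restart k t0 tth)).
apply: (HnormD a0 (ltW e0)).
  have hE : t + h - t = h by rewrite addrC addKr.
  rewrite hE; apply: le_trans (Hnorm_expA_decay gap (mild_mean t0) h0 ua) _.
  by rewrite lee_fin ler_piMl// -expR0 ler_expR oppr_le0 mulr_ge0 ?(ltW rho0).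
apply: (@le_trans _ _ (\int[mu]_(s in `[t, t + h]) q s)%:E); last by rewrite lee_fin.
have subh : `[t, t + h]%classic `<=` (`[0, t + 1] : set mR).
  move=> s /=; rewrite !in_itv/= => /andP[ts sth].
  by apply/andP; split; lra.
apply: Hnorm_bochner_le => //.
- move=> k; apply: duhamel_measurable => // s /=.
  by rewrite !in_itv/= => /andP[ts ->]; rewrite andbT (le_trans t0).
- exact: integrableS iq.
- apply: (@filterS _ _ aeF _ _ _ finH) => s fs /subh Is.
  have -> : D (t + h) s = S (h - 1) (D (t + 1) s).
    by rewrite expA_duhamel; congr (D _ s); lra.
  rewrite /q EFinM fineK; last exact: fs.
  by apply: SM; rewrite ler_norml; apply/andP; split; lra.
Qed.

Lemma inv_I_minus_LaplacianB c d k :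
  inv_I_minus_Laplacian (fun k => c k - d k) k
    = inv_I_minus_Laplacian c k - inv_I_minus_Laplacian d k :> R[i].
Proof. by rewrite /inv_I_minus_Laplacian mulrBr. Qed.

Lemma Hnorm_inv_I_minus_Laplacian c a : 0 <= a -> (Hnorm l c <= a%:E)%E ->
  (Hnorm l (inv_I_minus_Laplacian c) <= a%:E)%E.
Proof.
move=> a0; apply: le_trans; rewrite -[leRHS]mul1e; apply: le_Hnorm => // k.
rewrite ComplexField.Normc.normcM normc_real ler_wpM2r ?normc_ge0//.
rewrite ger0_norm ?invr_ge0 ?(ltW (freq2_gt0 k))//.
by rewrite invf_le1 ?freq2_gt0// lerDl sqr_ge0.
Qed.

Lemma uuxE (g : R -> R[i]) : inv_I_minus_Laplacian (uux g) = half_product g g.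
Proof. by []. Qed.

Lemma forcing_mean (s : R) : 0 <= s -> forcing s 0 = 0.
Proof.
move=> s0; have [_ m] := f0 s0.
rewrite /forcing /inv_I_minus_Laplacian fourier_mean// /uux /ddx freq0.
by rewrite -[0 +i* 0]/(0 : R[i]) mul0r subrr mulr0.
Qed.

Lemma expR_itv_integrable (r t : R) :
  mu.-integrable (`[0, t] : set mR) (EFin \o (fun s => expR (- (r * (t - s))))).
Proof.
apply: continuous_compact_integrable; first exact: segment_compact.
apply: continuous_subspaceT => x; apply: continuous_comp; last exact: continuous_expR.
apply: cvgN; apply: cvgM; first exact: cvg_cst.
by apply: cvgB; [exact: cvg_cst|exact: cvg_id].
Qed.

Lemma Rintegral_expR_le (r t : R) : 0 < r -> 0 <= t ->
  \int[mu]_(s in `[0, t]) expR (- (r * (t - s))) <= r^-1.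
Proof.
move=> r0 t0.
have dF (s : R) : is_derive s 1 (fun s => r^-1 * expR (- (r * (t - s)))) (expR (- (r * (t - s)))).
  have lin : is_derive s 1 (fun y : R => - (r * (t - y))) r.
    have -> : (fun y : R => - (r * (t - y))) = (r \*: (id : R -> R^o)) + cst (- (r * t)).
      by apply/funext => y; rewrite -[RHS]/(r * y - r * t); ring.
    by apply: is_derive_eq; rewrite /GRing.scale /=; ring.
  have := is_deriveZ r^-1 (@is_derive1_comp R expR _ s _ _ (is_derive_expR _) lin).
  move=> H; apply: is_derive_eq H _.
  by rewrite /GRing.scale /=; field; exact: lt0r_neq0.
have cF : continuous (fun s : R => expR (- (r * (t - s)))).
  move=> x; apply: continuous_comp; last exact: continuous_expR.
  apply: cvgN; apply: cvgM; first exact: cvg_cst.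
  by apply: cvgB; [exact: cvg_cst|exact: cvg_id].
rewrite (Rintegral_derive t0 dF cF) subrr mulr0 oppr0 expR0 mulr1.
by rewrite gerBl mulr_ge0 ?expR_ge0// invr_ge0 ltW.
Qed.

(** The forcing is at most $\delta+K\varepsilon^2$ and the kernel has integral at most $1/\rho$. The
    solution is controlled only strictly before [t], the endpoint being a null set; this permits the
    use at the infimum in [mild_bound]. *)
Lemma mild_bound_step (eps t : R) : 0 <= eps -> 0 <= t ->
  (Hnorm l (fourier (u 0)) <= delta%:E)%E ->
  (forall s, 0 <= s -> s < t -> (Hnorm l (fourier (u s)) <= eps%:E)%E) ->
  (Hnorm l (fourier (u t)) <= (delta + (delta + K * (eps * eps)) / rho)%:E)%E.
Proof.
move=> e0 t0 u0 us; set B := delta + K * (eps * eps).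
have aeF : Filter (nbhs (almost_everywhere mu)) := ae_filter_ringOfSetsType mu.
have B0 : 0 <= B by rewrite addr_ge0// !mulr_ge0.
rewrite (eq_Hnorm l (fun k => mild_restart k (lexx 0) t0)).
apply: (HnormD delta0); first by rewrite divr_ge0// ltW.
  apply: le_trans (Hnorm_expA_decay gap (mild_mean (lexx 0)) _ u0) _; first by rewrite subr0.
  by rewrite lee_fin ler_piMl// -expR0 ler_expR oppr_le0 subr0 mulr_ge0// ltW.
have mI : measurable (`[0, t] : set mR) by [].
have ie := expR_itv_integrable rho t.
apply: (@le_trans _ _ (\int[mu]_(s in `[0, t]) (B * expR (- (rho * (t - s)))))%:E); last first.
  rewrite lee_fin RintegralZl//; apply: ler_wpM2l => //; exact: Rintegral_expR_le.
apply: Hnorm_bochner_le => //.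
- by move=> k; exact: duhamel_measurable.
- exact: (integrableZl mI B ie).
- by move=> s _; rewrite mulr_ge0// expR_ge0.
apply: (@filterS2 _ _ aeF _ _ _ _ f_le (ae_neq t)) => s fs snt.
rewrite /= in_itv/= => /andP[s0 st].
rewrite duhamelE mulrC; apply: Hnorm_expA_decay => //; first exact: forcing_mean.
  by rewrite subr_ge0.
have us' : (Hnorm l (fourier (u s)) <= eps%:E)%E by apply: us => //; rewrite lt_neqAle snt.
have -> : forcing s = fun k =>
    inv_I_minus_Laplacian (fourier (f s)) k + - half_product (u s) (u s) k.
  by apply/funext => k; rewrite -uuxE -inv_I_minus_LaplacianB.
apply: HnormD => //; first by rewrite !mulr_ge0.
  exact: (Hnorm_inv_I_minus_Laplacian delta0 (fs s0)).
by rewrite HnormN; apply: bilinear => //; exact: mild_integrable.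
Qed.

(** At the infimum of the times where the bound fails, [mild_bound_step] gives [eps / 2]. A jump of
    at most [eps / 2] then keeps the bound on an interval beyond the infimum, a contradiction. *)
Lemma mild_bound (eps t : R) : 0 < eps ->
  delta + (delta + K * (eps * eps)) / rho <= eps / 2 ->
  (Hnorm l (fourier (u 0)) <= delta%:E)%E -> 0 <= t ->
  (Hnorm l (fourier (u t)) <= eps%:E)%E.
Proof.
move=> e0 small u0 t0; apply/negP => /negP bt.
pose E := [set s : R | 0 <= s /\ ~ (Hnorm l (fourier (u s)) <= eps%:E)%E].
have hE : has_inf E.
  split; first by exists t; split => //; exact/negP.
  by exists 0 => s [].
have T0 : 0 <= inf E.
  by apply: lb_le_inf => [|s []//]; case: hE.
have before s : 0 <= s -> s < inf E -> (Hnorm l (fourier (u s)) <= eps%:E)%E.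
  move=> s0 sE; apply: contrapT => ns.
  have : inf E <= s by apply: ge_inf => //; case: hE.
  by rewrite leNgt sE.
have uT : (Hnorm l (fourier (u (inf E))) <= (eps / 2)%:E)%E.
  apply: le_trans (mild_bound_step (ltW e0) T0 u0 before) _.
  by rewrite lee_fin.
have e20 : 0 < eps / 2 by rewrite divr_gt0.
have [eta eta0 after] := mild_norm_jump T0 (ltW e20) e20 uT.
have : inf E + eta <= inf E.
  apply: lb_le_inf => [|s [s0 ns]]; first by case: hE.
  rewrite leNgt; apply/negP => sT; apply: ns.
  have [lt|ge] := ltP s (inf E); first exact: before.
  have -> : s = inf E + (s - inf E) by rewrite addrC subrK.
  rewrite [eps]splitr; apply: after; apply/andP; split; lra.
by rewrite gerDl leNgt eta0.
Qed.

(** * The increment over one period *)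

Context (theta : R) (theta0 : 0 < theta).
Context (f_periodic : forall s k, 0 <= s -> fourier (f (s + theta)) k = fourier (f s) k).

Definition increment (t : R) (k : int) : R[i] :=
  fourier (u (t + theta)) k - fourier (u t) k.

(** Restart $u(t+\theta)$ at time $\theta$ and translate its integral to $[0,t]$, so that it can be
    subtracted from that of $u(t)$. *)
Lemma increment_eq (t : R) k : 0 <= t ->
  increment t k = S t (increment 0) k
    + bochner `[0, t] (fun s k => D (t + theta) (s + theta) k - D t s k) k.
Proof.
move=> t0; have tt0 : 0 <= t + theta by rewrite addr_ge0// ltW.
have th_le : theta <= t + theta by rewrite lerDr.
rewrite /increment (mild_restart k (ltW theta0) th_le) (mild_restart k (lexx 0) t0).
rewrite addrK subr0 add0r.
have -> : S t (fun k => fourier (u theta) k - fourier (u 0) k) k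
    = S t (fourier (u theta)) k - S t (fourier (u 0)) k by rewrite /expA mulrBr.
rewrite opprD addrACA; congr (_ + _).
have ish : cintegrable (`[theta, t + theta] : set mR) (fun s => D (t + theta) s k).
  apply: cintegrableS (duhamel_cintegrable k tt0) => // s /=.
  by rewrite !in_itv/= => /andP[ts ->]; rewrite andbT (le_trans (ltW theta0)).
have sh := cintegral_shift theta ish.
have ish' := cintegrable_shift theta ish.
move: sh ish'; rewrite subrr addrK => sh ish'.
have sub (g h : R -> R[i]) : cintegrable (`[0, t] : set mR) (fun s => g (s + theta)) ->
    cintegrable (`[0, t] : set mR) h ->
    cintegral `[0, t] (fun s => g (s + theta)) = cintegral `[theta, t + theta] g ->
    cintegral `[theta, t + theta] g - cintegral `[0, t] h
      = cintegral `[0, t] (fun s => g (s + theta) - h s).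
  by move=> ig ih <-; rewrite cintegralB.
exact: (sub _ _ ish' (duhamel_cintegrable k t0) sh).
Qed.

(** $v^2-w^2=(v+w)(v-w)$; the norm bounds make the squares integrable, so that [fourier] is additive
    on them. *)
Lemma half_product_sqrB (v w : R -> R[i]) (a : R) k : 0 <= a ->
  cintegrable I01 v -> cintegrable I01 w ->
  (Hnorm l (fourier v) <= a%:E)%E -> (Hnorm l (fourier w) <= a%:E)%E ->
  half_product v v k - half_product w w k
    = half_product (fun x => v x + w x) (fun x => v x - w x) k.
Proof.
move=> a0 iv iw va wa.
have [ivv _] := fourier_product k l0 a0 a0 iv iv va va.
have [iww _] := fourier_product k l0 a0 a0 iw iw wa wa.
have E (z : R[i]) : (fun x => z * ((v x + w x) * (v x - w x)))
    = (fun x => z * (v x * v x) - z * (w x * w x)).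
  by apply/funext => x; ring.
rewrite /half_product E -inv_I_minus_LaplacianB /inv_I_minus_Laplacian /ddx -mulrBr.
by rewrite fourierB//; exact: cintegrableZ.
Qed.

(** The force cancels by periodicity, and the difference of squares factors. *)
Lemma forcing_increment (a s : R) k : 0 <= a -> 0 <= s ->
  (forall t, 0 <= t -> (Hnorm l (fourier (u t)) <= a%:E)%E) ->
  forcing (s + theta) k - forcing s k
    = - half_product (fun x => u (s + theta) x + u s x)
                     (fun x => u (s + theta) x - u s x) k.
Proof.
move=> a0 s0 ua; have st0 : 0 <= s + theta by rewrite addr_ge0// ltW.
rewrite -(half_product_sqrB k a0 (mild_integrable st0) (mild_integrable s0) (ua _ st0) (ua _ s0)).
rewrite /forcing !inv_I_minus_LaplacianB -!uuxE /inv_I_minus_Laplacian f_periodic//.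
ring.
Qed.

Lemma duhamel_increment (t s : R) k :
  D (t + theta) (s + theta) k - D t s k
    = S (t - s) (fun k => forcing (s + theta) k - forcing s k) k.
Proof.
rewrite -[D (t + theta) (s + theta)]/(S (t + theta - (s + theta)) (forcing (s + theta))).
rewrite -[D t s]/(S (t - s) (forcing s)).
have -> : t + theta - (s + theta) = t - s by ring.
by rewrite /expA mulrBr.
Qed.

Lemma fourier_increment (t : R) k : 0 <= t ->
  fourier (fun x => u (t + theta) x - u t x) k = increment t k.
Proof.
move=> t0; rewrite fourierB//; apply: mild_integrable => //.
by rewrite addr_ge0// ltW.
Qed.

Lemma increment_mean (t : R) : 0 <= t -> increment t 0 = 0.
Proof.
by move=> t0; rewrite /increment !mild_mean ?subrr// addr_ge0// ltW.
Qed.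

Lemma increment_bounded (a t : R) : 0 <= a -> 0 <= t ->
  (forall s, 0 <= s -> (Hnorm l (fourier (u s)) <= a%:E)%E) ->
  (Hnorm l (increment t) <= (2 * a)%:E)%E.
Proof.
move=> a0 t0 ua; have -> : 2 * a = a + a by ring.
apply: HnormD => //; first by apply: ua; rewrite addr_ge0// ltW.
by rewrite HnormN ua.
Qed.

(** $e^{-\rho(t-s)}e^{-\rho s/2}=e^{-\rho t/2}e^{-\rho(t-s)/2}$, and the last factor has integral at
    most $2/\rho$. As the coefficient $u(\cdot+\theta)+u$ has size $2a$, the integral term carries
    $K\cdot2a\cdot M\cdot2/\rho$. *)
Lemma increment_step (a M t : R) : 0 <= a -> 0 <= M -> 0 <= t ->
  (forall s, 0 <= s -> (Hnorm l (fourier (u s)) <= a%:E)%E) ->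
  (forall s, 0 <= s <= t ->
     (Hnorm l (increment s) <= (M * expR (- (rho / 2 * s)))%:E)%E) ->
  (Hnorm l (increment t)
    <= ((2 * a + 4 * K * a / rho * M) * expR (- (rho / 2 * t)))%:E)%E.
Proof.
move=> a0 M0 t0 ua wM; have mI : measurable (`[0, t] : set mR) by [].
have tt0 : 0 <= t + theta by rewrite addr_ge0// ltW.
rewrite (eq_Hnorm l (fun k => increment_eq k t0)) mulrDl.
have e0 := expR_ge0 (- (rho / 2 * t)).
have C0 : 0 <= K * (2 * a * M) * expR (- (rho / 2 * t)) by rewrite !mulr_ge0.
apply: HnormD; rewrite ?mulr_ge0 ?invr_ge0 ?(ltW rho0)//.
  have := increment_bounded a0 (lexx 0) ua => w0.
  apply: le_trans (Hnorm_expA_decay gap (increment_mean (lexx 0)) t0 w0) _.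
  rewrite lee_fin mulrC ler_wpM2l ?mulr_ge0// ler_expR lerN2.
  by rewrite ler_wpM2r//; move: rho0; lra.
have r20 : 0 < rho / 2 by rewrite divr_gt0.
have ie := expR_itv_integrable (rho / 2) t.
apply: (@le_trans _ _ (\int[mu]_(s in `[0, t])
    (K * (2 * a * M) * expR (- (rho / 2 * t)) * expR (- (rho / 2 * (t - s)))))%:E); last first.
  rewrite lee_fin RintegralZl//.
  apply: le_trans (ler_wpM2l C0 (Rintegral_expR_le r20 t0)) _.
  rewrite le_eqVlt; apply/orP; left; apply/eqP.
  by field; exact: lt0r_neq0.
apply: Hnorm_bochner_le => //.
- move=> k; apply: cmeasurableB; last exact: duhamel_measurable.
  have ish : cintegrable (`[theta, t + theta] : set mR) (fun s => D (t + theta) s k).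
    apply: cintegrableS (duhamel_cintegrable k tt0) => // s /=.
    by rewrite !in_itv/= => /andP[ts ->]; rewrite andbT (le_trans (ltW theta0)).
  have := cintegrable_shift theta ish; rewrite subrr addrK.
  exact: cintegrable_measurable.
- exact: (integrableZl mI _ ie).
- by move=> s _; rewrite mulr_ge0// expR_ge0.
apply: aeW => s; rewrite /= in_itv/= => s0t; have /andP[s0 st] := s0t.
have st0 : 0 <= s + theta by rewrite addr_ge0// ltW.
rewrite (eq_Hnorm l (duhamel_increment t s)).
have fm : (fun k => forcing (s + theta) k - forcing s k) 0 = 0.
  by rewrite /= !forcing_mean// subrr.
have ts0 : 0 <= t - s by rewrite subr_ge0.
have iu := mild_integrable s0; have iu' := mild_integrable st0.
have fb : (Hnorm l (fun k => (forcing (s + theta) k - forcing s k)%R)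
    <= (K * (2 * a * (M * expR (- (rho / 2 * s)))))%:E)%E.
  rewrite (eq_Hnorm l (fun k => forcing_increment k a0 s0 ua)) HnormN.
  apply: bilinear.
  - by rewrite mulr_ge0.
  - by rewrite mulr_ge0// expR_ge0.
  - exact: cintegrableD.
  - exact: cintegrableB.
  - have -> : 2 * a = a + a by ring.
    rewrite (eq_Hnorm l (fun k => fourierD k iu' iu)).
    by apply: HnormD => //; exact: ua.
  - rewrite (eq_Hnorm l (fun k => fourier_increment k s0)).
    exact: wM.
apply: le_trans (Hnorm_expA_decay gap fm ts0 fb) _.
rewrite lee_fin le_eqVlt; apply/orP; left; apply/eqP.
have -> : expR (- (rho * (t - s))) =
    expR (- (rho / 2 * t)) * expR (rho / 2 * s) * expR (- (rho / 2 * (t - s))).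
  by rewrite -!expRD; congr expR; field.
have e1 : expR (rho / 2 * s) * expR (- (rho / 2 * s)) = 1.
  by rewrite -expRD subrr expR0.
transitivity (K * (2 * a * M) * expR (- (rho / 2 * t)) * expR (- (rho / 2 * (t - s)))
    * (expR (rho / 2 * s) * expR (- (rho / 2 * s)))); last by rewrite e1 mulr1.
ring.
Qed.

(** The condition on [a] makes $4Ka/\rho\le1/2$, so half of the supremum is absorbed. Absorption
    needs a finite supremum, hence the compact interval $[0,t]$, where [increment_bounded] supplies
    a crude bound; the resulting $4a$ is independent of [t]. *)
Lemma increment_decay (a t : R) : 0 <= a -> 8 * K * a <= rho -> 0 <= t ->
  (forall s, 0 <= s -> (Hnorm l (fourier (u s)) <= a%:E)%E) ->
  (Hnorm l (increment t) <= (4 * a * expR (- (rho / 2 * t)))%:E)%E.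
Proof.
move=> a0 Ka t0 ua.
pose n s := fine (Hnorm l (increment s)).
have nE s : 0 <= s -> Hnorm l (increment s) = (n s)%:E.
  move=> s0; rewrite /n fineK// ge0_fin_numE ?Hnorm_ge0//.
  exact: le_lt_trans (increment_bounded a0 s0 ua) (ltry _).
have n0 s : 0 <= n s by rewrite fine_ge0// Hnorm_ge0.
have r20 : 0 < rho / 2 by rewrite divr_gt0.
pose A := [set expR (rho / 2 * s) * n s | s in `[0, t]%classic].
have supA : has_sup A.
  split; first by exists (expR (rho / 2 * 0) * n 0); exists 0 => //=; rewrite in_itv/= lexx.
  exists (expR (rho / 2 * t) * (2 * a)) => _ [s + <-]; rewrite /= in_itv/= => /andP[s0 st].
  apply: ler_pM; rewrite ?expR_ge0//; first by rewrite ler_expR ler_wpM2l// ltW.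
  by rewrite -lee_fin -nE// increment_bounded.
have leM s : 0 <= s <= t -> expR (rho / 2 * s) * n s <= sup A.
  move=> s0t; apply: ub_le_sup; first by case: supA.
  by exists s.
have M0 : 0 <= sup A.
  by apply: le_trans (leM 0 _); rewrite ?lexx ?t0// mulr_ge0 ?expR_ge0.
have wM s : 0 <= s <= t ->
    (Hnorm l (increment s) <= (sup A * expR (- (rho / 2 * s)))%:E)%E.
  move=> s0t; have /andP[s0 st] := s0t.
  by rewrite nE// lee_fin expRN ler_pdivlMr ?expR_gt0// mulrC leM.
have half : sup A <= 2 * a + 4 * K * a / rho * sup A.
  apply: ge_sup => [|_ [s + <-]]; first by case: supA.
  rewrite /= in_itv/= => /andP[s0 st].
  have : (Hnorm l (increment s) <=
      ((2 * a + 4 * K * a / rho * sup A) * expR (- (rho / 2 * s)))%:E)%E.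
    apply: increment_step => // r /andP[r0 rs]; apply: wM.
    by rewrite r0 (le_trans rs).
  by rewrite nE// lee_fin expRN ler_pdivlMr ?expR_gt0// mulrC.
have K2 : 4 * K * a / rho <= 1 / 2.
  by rewrite ler_pdivrMr//; move: Ka; lra.
have M4 : sup A <= 4 * a.
  by have := ler_wpM2r M0 K2; lra.
apply: le_trans (wM t _) _; first by rewrite t0 lexx.
by rewrite lee_fin ler_wpM2r// expR_ge0.
Qed.

End MildSolution.

(** * Exponential decay of the increments *)

(** Used to see that the essential supremum of a nonnegative function is nonnegative. *)
Lemma lebesgue_measure_setT_gt0 (R : realType) :
  (0 < @lebesgue_measure R [set: measurableTypeR R])%E.
Proof.
apply: (@lt_le_trans _ _ (lebesgue_measure (`[(0 : R), 1]%classic : set (measurableTypeR R)))).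
  by rewrite mu01 lte_fin.
by apply: le_measure => //; rewrite inE.
Qed.

(** Periodicity of the force holds only up to null sets in space; the coefficients depend on the
    class alone. *)
Lemma ae_eq_fourier (R : realType) (l : R) (f : R -> R -> R[i]) (theta s : R) k :
  (forall t, 0 <= t -> Hper0 l (f t)) -> 0 < theta -> 0 <= s ->
  {ae @lebesgue_measure R, forall x, f (s + theta) x = f s x} ->
  fourier (f (s + theta)) k = fourier (f s) k.
Proof.
move=> f0 th0 s0 fae; have st0 : 0 <= s + theta by rewrite addr_ge0// ltW.
have [[_ r i _] _] := f0 s s0; have [[_ r' i' _] _] := f0 _ st0.
have mI : measurable (`[(0 : R), 1]%classic : set (measurableTypeR R)) by [].
have [a1 a2] := cintegrable_ekM k (conj r' i').
have [b1 b2] := cintegrable_ekM k (conj r i).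
have aeF := ae_filter_ringOfSetsType (@lebesgue_measure R).
congr (fine _ +i* fine _); apply: ae_eq_integral => //.
- exact: measurable_int a1.
- exact: measurable_int b1.
- by apply: (@filterS _ _ aeF _ _ _ fae) => x -> _.
- exact: measurable_int a2.
- exact: measurable_int b2.
- by apply: (@filterS _ _ aeF _ _ _ fae) => x -> _.
Qed.

(* [ge0_le_integral] without measurability: the integral of a nonnegative function
   is a supremum over the simple functions below it. *)
Lemma ge0_le_integral_simple d (X : measurableType d) (R : realType)
    (m : {measure set X -> \bar R}) (D : set X) (f g : X -> \bar R) :
  (forall x, D x -> (0 <= f x)%E) -> (forall x, D x -> (f x <= g x)%E) ->
  (\int[m]_(x in D) f x <= \int[m]_(x in D) g x)%E.
Proof.
move=> f0 fg; rewrite !ge0_integralE//; last first.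
  by move=> x Dx; apply: le_trans (fg x Dx); exact: f0.
apply: ereal_sup_le => _ [h hf <-]; exists h => // x; apply: le_trans (hf x) _.
by rewrite !patchE; case: ifPn => // /[!inE] Dx; exact: fg.
Qed.

Lemma Ynorm_le (R : realType) (l tau T C : R) (w : R -> R -> R[i]) :
  0 <= T -> 0 <= C ->
  (forall s, tau <= s -> (Hnorm l (fourier (w s)) <= C%:E)%E) ->
  (Ynorm l tau T w <= (C * (1 + Num.sqrt T))%:E)%E.
Proof.
move=> T0 C0 wC; rewrite mulrDr mulr1 EFinD /Ynorm; apply: leeD.
  apply: ge_ereal_sup => _ [s + <-]; rewrite /= in_itv/= => /andP[ts _].
  exact: wC.
have -> : (C * Num.sqrt T)%:E = sqrte (C ^+ 2 * T)%:E :> \bar R.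
  by rewrite /= sqrtrM ?sqr_ge0// sqrtr_sqr ger0_norm.
rewrite lee_sqrt ?lee_fin ?mulr_ge0 ?sqr_ge0//.
have -> : (C ^+ 2 * T)%:E = (\int[@lebesgue_measure R]_(s in `[tau, (tau + T)%R]) (C ^+ 2)%:E)%E.
  rewrite integral_cst//= lebesgue_measure_itv/= lte_fin.
  case: ifPn => [_|]; first by rewrite -EFinD addrAC subrr add0r EFinM.
  rewrite -leNgt gerDl => T0'; have -> : T = 0 by apply/le_anti; rewrite T0'.
  by rewrite mulr0 mule0.
(* Nothing is assumed about the measurability in time of [w]. *)
apply: ge0_le_integral_simple => s; rewrite /= in_itv/= => /andP[ts _].
  by rewrite sqre_ge0.
by rewrite EFin_expe !expe2 lee_pmul ?Hnorm_ge0 ?wC.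
Qed.

Theorem theorem1p4 (R : realType) (l beta gamma theta T : R) :
  0 <= l ->
  Num.max 0 (- (beta / (4 * pi ^+ 2))) < gamma ->
  0 < theta -> 0 < T ->
  exists delta : R, 0 < delta /\
    forall (phi : R -> R[i]) (f : R -> R -> R[i]),
      Hper0 l phi ->
      LinfHper0 l f ->
      (forall t : R, 0 <= t ->
         {ae @lebesgue_measure R, forall x, f (t + theta) x = f t x}) ->
      (forall t : R, 0 <= t < theta -> mean (f t) = 0) ->
      (Hnorm l (fourier phi) + LinfHnorm l f <= delta%:E)%E ->
      forall u : R -> R -> R[i],
        mild_solution l beta gamma phi f u ->
        exists C rho : R, [/\ 0 < C, 0 < rho &
          forall tau : R, 0 < tau ->
            (Ynorm l tau T (fun t x => (u (t + theta) x - u t x)%R)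
             <= (C * expR (- (rho * tau)))%:E)%E].
Proof.
move=> l0 gamma_gt theta0 T0.
have [rho rho0 gap] := spectral_gap gamma_gt.
have [K K0 bilinear] := bilinear_estimate l0.
(* Ensures $8K\varepsilon\le\rho$, which [increment_decay] asks for; $K+1$ keeps the quotient
   meaningful when $K=0$. *)
pose eps := rho / (8 * (K + 1)).
have K1 : 0 < 8 * (K + 1) by rewrite mulr_gt0// ltr_wpDl.
have eps0 : 0 < eps by rewrite divr_gt0.
have epsK : 8 * K * eps <= rho.
  by rewrite /eps mulrA ler_pdivrMr// [leLHS]mulrC ler_wpM2l ?(ltW rho0)//; lra.
have r1 : 0 < 1 + rho^-1 by rewrite addr_gt0// invr_gt0.
(* Then $\delta(1+1/\rho)=\varepsilon/4$, while the quadratic term $K\varepsilon^2/\rho$ is at most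
   $\varepsilon/8$; together they stay below $\varepsilon/2$. *)
pose delta := eps / (4 * (1 + rho^-1)).
have delta0 : 0 < delta by rewrite divr_gt0// mulr_gt0.
exists delta; split => // phi f phi0 [f0 mf foo] f_ae _ small u mild.
have Linf0 : (0 <= LinfHnorm l f)%E.
  apply: ess_sup_gee; first exact: lebesgue_measure_setT_gt0.
  by apply: nearW => t; rewrite patchE; case: ifP => // _; exact: Hnorm_ge0.
have phi_le : (Hnorm l (fourier phi) <= delta%:E)%E.
  by apply: le_trans small; rewrite leeDl.
have f_le : {ae @lebesgue_measure R, forall s : R, 0 <= s ->
    (Hnorm l (fourier (f s)) <= delta%:E)%E}.
  have : (LinfHnorm l f <= delta%:E)%E.
    by apply: le_trans small; rewrite leeDr// Hnorm_ge0.
  move=> /ess_supP f_ess.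
  apply: (@filterS _ _ (ae_filter_ringOfSetsType (@lebesgue_measure R)) _ _ _ f_ess) => s.
  by rewrite patchE => + s0; rewrite mem_set//= in_itv/= s0.
(* At time 0 the Duhamel integral runs over a single point, so $u(0)$ has the coefficients of
   [phi]. *)
have u0 : (Hnorm l (fourier (u 0%R)) <= delta%:E)%E.
  apply: le_trans phi_le; rewrite le_eqVlt; apply/orP; left; apply/eqP; apply: eq_Hnorm => k.
  have [_ _ ->] := mild 0 (lexx 0); rewrite expA0 /bochner set_itv1 /cintegral.
  by rewrite !Rintegral_set1 -[0 +i* 0]/(0 : R[i]) addr0.
have step : delta + (delta + K * (eps * eps)) / rho <= eps / 2.
  have -> : delta + (delta + K * (eps * eps)) / rho
      = delta * (1 + rho^-1) + (8 * K * eps) / rho * (eps / 8).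
    by field; exact: lt0r_neq0.
  have -> : delta * (1 + rho^-1) = eps / 4.
    by rewrite /delta invfM mulrA mulfVK// lt0r_neq0.
  have : 8 * K * eps / rho <= 1 by rewrite ler_pdivrMr// mul1r.
  move: (8 * K * eps / rho) => x x1; clearbody eps; nra.
have ub t := mild_bound mild rho0 gap (ltW delta0) f0 f_le K0 bilinear (t := t) eps0 step u0.
have f_per s k : 0 <= s -> fourier (f (s + theta)) k = fourier (f s) k.
  by move=> s0; apply: (ae_eq_fourier k f0) => //; exact: f_ae.
(* [4 * eps] comes from [increment_decay]; the 1 is for the supremum and [Num.sqrt T] for the $L^2$
   part of the norm over a window of length [T]. *)
exists (4 * eps * (1 + Num.sqrt T)), (rho / 2); split; [|by rewrite divr_gt0|].
- have T1 : 0 < 1 + Num.sqrt T by rewrite ltr_wpDr// sqrtr_ge0.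
  by rewrite mulr_gt0// mulr_gt0.
move=> tau tau0.
have e40 : 0 <= 4 * eps by exact: (mulr_ge0 _ (ltW eps0)).
have C0 : 0 <= 4 * eps * expR (- (rho / 2 * tau)) := mulr_ge0 e40 (expR_ge0 _).
rewrite mulrAC; apply: (Ynorm_le (ltW T0) C0).
move=> s ts; have s0 : 0 <= s := le_trans (ltW tau0) ts.
rewrite (eq_Hnorm l (fun k => fourier_increment mild theta0 k s0)).
apply: le_trans (increment_decay mild l0 rho0 gap f0 K0 bilinear theta0 f_per
  (ltW eps0) epsK s0 ub) _.
rewrite lee_fin ler_wpM2l// ler_expR lerN2.
by rewrite ler_wpM2l// divr_ge0// ltW.
Qed.
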